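(* Let $\Omega\subset\mathbb{R}^2$ be a star-shaped domain with smooth boundary and let $k>0$. Let $u$ be a radiating solution to the Helmholtz equation $\Delta u+k^2u=0$ in $\mathbb{R}^2\setminus\overline{\Omega}$, and assume that there exists $\mu\in L^2(\partial\Omega)$ with $\|\mu\|_{L^2(\partial\Omega)}<M$ such that $u(x)=\int_{\partial\Omega}\Phi_k(x,y)\mu(y)\,\mathrm{d}y$. Let $\delta>0$ and let $\Omega_\delta\Supset\Omega$ be a smooth domain such that $\operatorname{dist}(\partial\Omega_\delta,\Omega)\ge\delta$. Assume further that $O_\rho\Subset O_R\Subset\Omega\Subset\Omega_\delta$. Then there is a constant $C$ such that, with $\beta=\frac{C}{\delta}$, for all sufficiently large $N$ there exist $\{c_n\}_{n=-N}^N$ such that $$u_N(x)=\sum_{n=-N}^{N}c_n\frac{H_n^{(1)}(kr)}{H_n^{(1)}(k\rho)}e^{\mathrm{i}n\theta}$$ approximates $u$ with $$\|u-u_N\|_{L^2(\partial\Omega_\delta)}\le\left(\frac{\rho}{R}\right)^{N\cdot\frac{1}{1+\beta}}M\qquad\text{and}\qquad \left(\sum_{n=-N}^{N}\sqrt{1+n^2}\,|c_n|^2\right)^{1/2}\le C\left(\frac{R}{\rho}\right)^{N\cdot\frac{\beta}{1+\beta}}M .$$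
   Context: $O_r$ is the open disk of radius $r$ in $\mathbb{R}^2$ centered at the origin; $(r,\theta)$ are the polar coordinates of $x$. $A\Subset B$ means that $\overline{A}$ is a compact subset of $B$. $H_n^{(1)}$ is the Hankel function of the first kind of order $n$. $\Phi_k(x,y)=\frac{\mathrm{i}}{4}H_0^{(1)}(k|x-y|)$ is the fundamental solution of the Helmholtz equation. A solution of the Helmholtz equation outside a bounded set is radiating if it satisfies the Sommerfeld condition $\lim_{r\to\infty}\sqrt r\left(\frac{\partial u}{\partial r}-\mathrm{i}ku\right)=0$, $r=|x|$. Integrals over curves are with respect to arc length. The constant $C$ is independent of $N$, $u$ and $\delta$.
   Formalization: C is uniform only for 0<δ≤δ0 (δ0 arbitrary; C may depend on δ0): uniformity over all δ>0 fails, e.g. for concentric discs O_A, O_{A+δ} with δ large, where β≥log(A/ρ)/log(1+δ/A) is needed. Ω_δ is taken bounded. *)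

(* Defs.v *)
From HB Require Import structures.
From mathcomp Require Import all_boot all_order all_algebra.
From mathcomp Require Import all_classical all_reals all_analysis.
From mathcomp Require Export complex.

Set Implicit Arguments.
Unset Strict Implicit.
Unset Printing Implicit Defensive.

Import Order.TTheory GRing.Theory Num.Theory.
Import numFieldNormedType.Exports.

Local Open Scope classical_set_scope.
Local Open Scope ring_scope.
Local Open Scope complex_scope.

(* The plane is [R * R] (product topology) and complex values are in [R[i]].
   The norm the library puts on [R * R] is the sup norm, and the one on [R[i]]
   takes values in [R[i]]; hence the two moduli below. *)

Section Plane.
Variable R : realType.
Implicit Types (x y : R * R) (A B : set (R * R)) (z : R[i]).

Definition enorm x : R := Num.sqrt (x.1 ^+ 2 + x.2 ^+ 2).

Definition cabs z : R := Num.sqrt (complex.Re z ^+ 2 + complex.Im z ^+ 2).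

Definition disk (r : R) : set (R * R) := [set x | enorm x < r].

Definition frontier A : set (R * R) := closure A `\` A°.

Definition compactly_contained A B : Prop :=
  compact (closure A) /\ closure A `<=` B.

Definition set_dist A B : \bar R :=
  ereal_inf [set d | exists x y, [/\ A x, B y & d = (enorm (x - y))%:E]].

Definition star_shaped A : Prop :=
  exists2 p, A p & forall x (t : R), A x -> 0 <= t <= 1 ->
    A ((1 - t) *: p + t *: x).

End Plane.

Section Boundary.
Variable R : realType.
Implicit Types (Om : set (R * R)) (f : R -> R).

Definition smooth_fun f : Prop :=
  forall (n : nat) (t : R), derivable (derive1n n f) t 1.

Definition xcoord (g : R -> R * R) : R -> R := fun t => (g t).1.
Definition ycoord (g : R -> R * R) : R -> R := fun t => (g t).2.

Definition speed (g : R -> R * R) (t : R) : R :=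
  enorm (derive1 (xcoord g) t, derive1 (ycoord g) t).

(* A bounded domain with smooth boundary: the boundary is a finite disjoint
   union of smooth regular Jordan curves [gam j], parametrized with period 1.
   The condition [(closure Om)° = Om] says that [Om] lies locally on one side
   of its boundary, i.e. it excludes slits. *)
Record smooth_domain Om (m : nat) (gam : 'I_m -> R -> R * R) : Prop := {
  sd_open : open Om;
  sd_nonempty : Om !=set0;
  sd_connected : connected Om;
  sd_bounded : bounded_set Om;
  sd_one_sided : (closure Om)° = Om;
  sd_frontier : frontier Om = [set x | exists j t, gam j t = x];
  sd_smooth : forall j,
    smooth_fun (xcoord (gam j)) /\ smooth_fun (ycoord (gam j));
  sd_regular : forall j t, speed (gam j) t != 0;
  sd_periodic : forall j t, gam j (t + 1) = gam j t;
  sd_simple : forall i j (s t : R), 0 <= s < 1 -> 0 <= t < 1 ->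
    gam i s = gam j t -> i = j /\ s = t
}.

Variables (m : nat) (gam : 'I_m -> R -> R * R).

(* Arc-length integral over the union of the curves [gam j], for nonnegative
   extended-real-valued integrands. *)
Definition arc_integral (f : R * R -> \bar R) : \bar R :=
  (\sum_(j < m) \int[lebesgue_measure]_(t in `[0%R, 1%R])
      (f (gam j t) * (speed (gam j) t)%:E))%E.

(* Arc-length integral of a complex-valued function. *)
Definition arc_cintegral (f : R * R -> R[i]) : R[i] :=
  \sum_(j < m)
    ((\int[lebesgue_measure]_(t in `[0%R, 1%R])
        (complex.Re (f (gam j t)) * speed (gam j) t))%R
     +i*
     (\int[lebesgue_measure]_(t in `[0%R, 1%R])
        (complex.Im (f (gam j t)) * speed (gam j) t))%R).

Definition L2norm (f : R * R -> R[i]) : \bar R :=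
  sqrte (arc_integral (fun x => ((cabs (f x)) ^+ 2)%:E)).

Definition in_L2 (f : R * R -> R[i]) : Prop :=
  (forall j,
     measurable_fun (`[0, 1] : set R)
       (fun t : R => complex.Re (f (gam j t)) : R) /\
     measurable_fun (`[0, 1] : set R)
       (fun t : R => complex.Im (f (gam j t)) : R)) /\
  (L2norm f < +oo)%E.

End Boundary.

Section Hankel.
Variable R : realType.

Definition besselJ (n : nat) (t : R) : R :=
  limn (series (fun p : nat =>
    (-1) ^+ p / (p`!%:R * (n + p)`!%:R) * (t / 2) ^+ (n + 2 * p))).

Definition harmonic_sum (p : nat) : R := \sum_(1 <= i < p.+1) i%:R^-1.

Definition euler_gamma : R :=
  limn (fun p : nat => harmonic_sum p - ln p%:R).

(* Neumann's expansion of the Bessel function of the second kind, t > 0. *)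
Definition besselY (n : nat) (t : R) : R :=
  2 / pi * (ln (t / 2) + euler_gamma) * besselJ n t
  - pi^-1 * (\sum_(p < n) (n - 1 - p)`!%:R / p`!%:R * (2 / t) ^ (n%:Z - (2 * p)%:Z))
  - pi^-1 * limn (series (fun p : nat =>
      (-1) ^+ p / (p`!%:R * (n + p)`!%:R) * (t / 2) ^+ (n + 2 * p)
        * (harmonic_sum (p + n) + harmonic_sum p))).

(* H_n^{(1)}; at negative orders, H_{-n}^{(1)} = (-1)^n H_n^{(1)}. *)
Definition hankel1 (n : int) (t : R) : R[i] :=
  let h := besselJ `|n|%N t +i* besselY `|n|%N t in
  if n < 0 then (-1) ^+ `|n|%N * h else h.

Definition Phi (k : R) (x y : R * R) : R[i] :=
  'i%C / 4%:R * hankel1 0 (k * enorm (x - y)).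

(* e^{i n theta}, with theta the polar angle of x <> 0. *)
Definition cis_angle (n : int) (x : R * R) : R[i] :=
  ((x.1 / enorm x) +i* (x.2 / enorm x)) ^ n.

Definition hankel_sum (k rho : R) (N : nat) (c : int -> R[i]) (x : R * R) :
    R[i] :=
  \sum_(j < (2 * N).+1)
    (let n := (j%:Z - N%:Z)%R in
     c n * (hankel1 n (k * enorm x) / hankel1 n (k * rho)) * cis_angle n x).

Definition weighted_coef_norm (N : nat) (c : int -> R[i]) : R :=
  Num.sqrt (\sum_(j < (2 * N).+1)
    (let n := (j%:Z - N%:Z)%R in
     Num.sqrt (1 + (n%:~R : R) ^+ 2) * cabs (c n) ^+ 2)).

End Hankel.

Section Helmholtz.
Variable R : realType.
Implicit Types (u : R * R -> R[i]) (f : R * R -> R) (D : set (R * R)).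

Definition re_part u : R * R -> R^o := fun x => complex.Re (u x).
Definition im_part u : R * R -> R^o := fun x => complex.Im (u x).

Definition e1 : R * R := (1, 0).
Definition e2 : R * R := (0, 1).

Definition laplacian (f : R * R -> R^o) (x : R * R) : R :=
  'D_e1 ('D_e1 f) x + 'D_e2 ('D_e2 f) x.

Definition C2_on D (f : R * R -> R^o) : Prop :=
  forall x, D x ->
    {for x, continuous f} /\
    forall v w, v \in [:: e1; e2] -> w \in [:: e1; e2] ->
      [/\ derivable f x v, {for x, continuous ('D_v f)},
          derivable ('D_v f) x w & {for x, continuous ('D_w ('D_v f))}].

Definition helmholtz_sol (k : R) D u : Prop :=
  [/\ C2_on D (re_part u), C2_on D (im_part u) &
      forall x, D x ->
        laplacian (re_part u) x + k ^+ 2 * re_part u x = 0 /\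
        laplacian (im_part u) x + k ^+ 2 * im_part u x = 0].

(* The derivative of u in the direction x / |x|. *)
Definition radial_derive u (x : R * R) : R[i] :=
  ('D_((enorm x)^-1 *: x) (re_part u) x : R)
  +i* ('D_((enorm x)^-1 *: x) (im_part u) x : R).

(* Sommerfeld's condition, uniformly in all directions. *)
Definition radiating (k : R) u : Prop :=
  forall eps : R, 0 < eps -> exists r0 : R, forall x, r0 < enorm x ->
    Num.sqrt (enorm x) *
      cabs (radial_derive u x - 'i%C * k%:C * u x) < eps.

End Helmholtz.

(* Main.v *)
(* Write the single layer potential as an integral of sources Phi_k(x, y).  A
   source at a boundary point is moved, by Taylor expansion along a segment, first
   to the centre y of a disc of fixed radius inside Om that touches the boundary:
   for x at distance at least delta from Om the ratio of that expansion is at most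
   1 - c delta.  From y the centre is then moved along y -> p -> 0, where p is a
   star centre, in a number J of short steps independent of delta.  Each step
   expands waves of order q to order 2 q, with an error that decays geometrically
   at a rate independent of delta and coefficients that grow at most
   exponentially in q.  With q = N / Bt for a large constant Bt, the error is at most
   e^{- c delta N / Bt}, up to a polynomial factor, and the coefficients grow no
   faster than (Rad / rho)^{N / 4}; since beta / (1 + beta) >= 1/2 as soon as C >= delta0,
   every constant depending on the data is absorbed in N0. *)

Require Import Defs.
From HB Require Import structures.
From mathcomp Require Import all_boot all_order all_algebra.
From mathcomp Require Import all_classical all_reals all_analysis.
From mathcomp Require Import measurable_realfun.
From mathcomp Require Import ring lra zify.

Set Implicit Arguments.
Unset Strict Implicit.
Unset Printing Implicit Defensive.

Import Order.TTheory GRing.Theory Num.Theory.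
Import numFieldNormedType.Exports.

Local Open Scope classical_set_scope.
Local Open Scope ring_scope.
Local Open Scope complex_scope.

(** * Power series with coefficients O(1/p!) *)

Section FactorialSeries.
Variable R : realType.
Implicit Types (c : R^nat) (z K : R).

(** This is Runge's pole pushing with rates. Waves about a source y can be expanded about 0 only for
    |x| > |y|, whereas the outer boundary may pass closer to the origin than y; hence many short
    moves, each valid on the whole outer boundary. The move that leaves the boundary is the delicate
    one. There the clearance is only delta and the Taylor ratio is close to 1, so derivative bounds
    must yield the exact ratio |v|/|w|; a spare factor 2 per derivative would destroy 1 - c delta.
    This is why [bin_fact_le] weighs binomial coefficients against factorials. The other moves keep
    a clearance independent of delta, so their length is free and crude bounds suffice. Doubling the
    order at such a move squares the error factor of the moves still to come, which pays for the
    coefficients of the present one. The price is a factor 2^J in the order, with J fixed. Every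
    move is a Taylor expansion of explicit waves, whose derivatives are again combinations of waves.
    Touching discs are found without orienting the boundary: an interior point close to the given
    boundary point tells the side. *)

Definition fact_bounded K c := forall p, `|c p| <= K / p`!%:R.

Lemma fact_bounded_diffs K c :
  fact_bounded K c -> fact_bounded K (pseries_diffs c).
Proof.
move=> cK p; rewrite /pseries_diffs normrM normr_nat.
apply: (le_trans (ler_wpM2l (ler0n _ _) (cK p.+1))).
rewrite factS natrM le_eqVlt; apply/orP; left; apply/eqP; field.
by rewrite nat1r !pnatr_eq0 -lt0n fact_gt0.
Qed.

Lemma normed_pseries_le K c z p : fact_bounded K c ->
  `|c p * z ^+ p| <= (K *: exp_coeff `|z|) p.
Proof.
move=> cK; rewrite normrM normrX -[leRHS]/(K * (`|z| ^+ p / p`!%:R)).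
rewrite mulrA mulrAC.
by apply: ler_wpM2r; rewrite ?exprn_ge0.
Qed.

Lemma fact_bounded_ge0 K c : fact_bounded K c -> 0 <= K.
Proof. by move=> /(_ 0); rewrite fact0 divr1; apply: le_trans. Qed.

Lemma is_cvg_normed_pseries K c z : fact_bounded K c ->
  cvgn [normed series (fun i => c i * z ^+ i)].
Proof.
move=> cK.
apply: (@series_le_cvg _ _ (K *: exp_coeff `|z|)).
- by move=> n; exact: normr_ge0.
- move=> n; rewrite /GRing.scale /= mulr_ge0 ?(fact_bounded_ge0 cK)//.
  exact: exp_coeff_ge0.
- by move=> n; exact: normed_pseries_le.
- by apply: is_cvg_seriesZ; exact: is_cvg_series_exp_coeff.
Qed.

Lemma is_cvg_pseries K c z : fact_bounded K c -> cvgn (pseries c z).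
Proof. by move=> cK; apply: normed_cvg; exact: is_cvg_normed_pseries cK. Qed.

Definition psum c z := limn (pseries c z).

Lemma psum_bound K c z : fact_bounded K c -> `|psum c z| <= K * expR `|z|.
Proof.
move=> cK.
have h : `|psum c z| <= limn [normed series (fun i => c i * z ^+ i)].
  apply: (@lim_series_norm R R^o (fun i => c i * z ^+ i)).
  exact: (is_cvg_normed_pseries cK).
apply: le_trans h _.
rewrite /expR -[K * _]/(K *: _) -lim_seriesZ; last first.
  exact: is_cvg_series_exp_coeff.
apply: lim_series_le.
- exact: (is_cvg_normed_pseries cK).
- by apply: is_cvg_seriesZ; exact: is_cvg_series_exp_coeff.
- by move=> n; exact: normed_pseries_le.
Qed.

Lemma is_derive_psum K c z : fact_bounded K c ->
  is_derive z 1 (psum c) (psum (pseries_diffs c) z).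
Proof.
move=> cK; apply: (@pseries_snd_diffs _ c (`|z| + 1)).
- exact: is_cvg_pseries cK.
- by apply: is_cvg_pseries; exact: fact_bounded_diffs cK.
- by apply: is_cvg_pseries; do 2 apply: fact_bounded_diffs; exact: cK.
- by rewrite [ltRHS]ger0_norm ?addr_ge0// ltrDl.
Qed.

Lemma psum_lin K K' c d a b z : fact_bounded K c -> fact_bounded K' d ->
  psum (fun p => a * c p + b * d p) z = a * psum c z + b * psum d z.
Proof.
move=> cK dK; rewrite /psum /pseries.
have -> : (fun i => (a * c i + b * d i) * z ^+ i) =
   (a *: (fun i => c i * z ^+ i)) + (b *: (fun i => d i * z ^+ i)).
  by apply/funext => i; rewrite mulrDl -!mulrA.
have Cc := @is_cvg_pseries _ c z cK; have Cd := @is_cvg_pseries _ d z dK.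
have Ca : cvgn (series (a *: (fun i => c i * z ^+ i))).
  by apply: is_cvg_seriesZ; exact: Cc.
have Cb : cvgn (series (b *: (fun i => d i * z ^+ i))).
  by apply: is_cvg_seriesZ; exact: Cd.
by rewrite (lim_seriesD Ca Cb) (lim_seriesZ a Cc) (lim_seriesZ b Cd).
Qed.

Lemma psum_shift K c z : fact_bounded K c ->
  z * psum c z = psum (fun p => if p is p'.+1 then c p' else 0) z.
Proof.
move=> cK; set d := (fun p => _).
have Cc := @is_cvg_pseries _ c z cK.
rewrite -[z * _]/(z *: psum c z) /psum -lim_seriesZ; last exact: Cc.
have Cz : cvgn (series (z *: (fun i => c i * z ^+ i))) by exact: is_cvg_seriesZ.
symmetry; apply/cvg_lim => //.
rewrite -(cvg_shiftS (pseries d z)).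
apply: cvg_trans Cz; apply: near_eq_cvg; near=> n.
rewrite /pseries /series /= big_nat_recl//= mul0r add0r.
by apply: eq_bigr => i _; rewrite -[LHS]/(z * (c i * z ^+ i)) exprS; ring.
Unshelve. all: by end_near. Qed.

(** Constants become power series here, so that inhomogeneous recurrences can be compared
    coefficient by coefficient. *)
Lemma psum_head (a z : R) : psum (fun p => if p is p'.+1 then 0 else a) z = a.
Proof.
apply/cvg_lim => //; rewrite -(cvg_shiftS (pseries _ z)).
apply: (@cvg_trans _ (cst a @ \oo)); last exact: cvg_cst.
apply: near_eq_cvg; near=> n.
rewrite /pseries /series /= big_nat_recl//= expr0 mulr1 big1 ?addr0//.
by move=> i _; rewrite mul0r.
Unshelve. all: by end_near. Qed.

End FactorialSeries.

(** * Bessel functions of both kinds in the variable (t/2)^2 *)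

Section BesselSeries.
Variable R : realType.
Implicit Types (n p : nat) (z : R).

Lemma eqle (x y : R) : x = y -> x <= y. Proof. by move=> ->. Qed.

Definition bcoef n p : R := (-1) ^+ p / (p`!%:R * (n + p)`!%:R).

Lemma harmonic_sumS p :
  harmonic_sum R p.+1 = harmonic_sum R p + (p.+1)%:R^-1.
Proof. by rewrite /harmonic_sum big_nat_recr. Qed.

Lemma harmonic_sum_ge0 p : 0 <= harmonic_sum R p.
Proof. by apply: sumr_ge0 => i _; rewrite invr_ge0. Qed.

Lemma harmonic_sum_le p : harmonic_sum R p <= p%:R.
Proof.
elim: p => [|p IH]; first by rewrite /harmonic_sum big_nil.
by rewrite harmonic_sumS -[leRHS]natr1 lerD// invf_le1 ?ler1n ?ltr0n.
Qed.

Definition fcoef n p : R :=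
  bcoef n p * (harmonic_sum R (p + n) + harmonic_sum R p).

Lemma fact_gt0r p : 0 < p`!%:R :> R.
Proof. by rewrite ltr0n fact_gt0. Qed.

Lemma bcoef_norm n p : `|bcoef n p| = (p`!%:R * (n + p)`!%:R)^-1.
Proof.
rewrite /bcoef normrM normrX normrN1 expr1n mul1r ger0_norm//.
Qed.

Lemma bcoef_bounded n : fact_bounded n`!%:R^-1 (bcoef n).
Proof.
move=> p; rewrite bcoef_norm invfM mulrC ler_wpM2r ?invr_ge0//.
rewrite lef_pV2 ?posrE ?fact_gt0r// ler_nat.
by apply: leq_fact; rewrite leq_addr.
Qed.

Lemma fcoef_bounded n : fact_bounded 2 (fcoef n).
Proof.
move=> p; rewrite /fcoef normrM bcoef_norm invfM mulrAC -mulrA.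
rewrite [leRHS]mulrC ler_wpM2l ?invr_ge0//.
rewrite ger0_norm ?addr_ge0 ?harmonic_sum_ge0//.
rewrite ler_pdivrMr ?fact_gt0r//.
have h1 := harmonic_sum_le (p + n); have h2 := harmonic_sum_le p.
apply: (le_trans (lerD h1 h2)).
have le1 : (p + n)%:R <= (n + p)`!%:R :> R.
  by rewrite ler_nat addnC; apply: fact_geq.
have le2 : p%:R <= (n + p)`!%:R :> R.
  by apply: le_trans le1; rewrite ler_nat leq_addr.
by rewrite mulr_natl mulr2n lerD.
Qed.

(* With [z = (t / 2) ^+ 2], these are [J_n t] and the pieces of [pi * Y_n t]
   after division by [(t / 2) ^+ n]. *)
Definition besE n z := psum (bcoef n) z.
Definition besF n z := psum (fcoef n) z.

Definition besP n z := \sum_(p < n) (n - 1 - p)`!%:R / p`!%:R * z^-1 ^+ (n - p).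

Definition besQ n z := (ln z + 2 * euler_gamma R) * besE n z - besP n z - besF n z.

Lemma besE_bound n z : `|besE n z| <= expR `|z| / n`!%:R.
Proof. by rewrite mulrC; exact: psum_bound (bcoef_bounded n). Qed.

Lemma besF_bound n z : `|besF n z| <= 2 * expR `|z|.
Proof. exact: psum_bound (fcoef_bounded n). Qed.

Lemma bcoef_diffs n : pseries_diffs (bcoef n) = (fun p => - bcoef n.+1 p).
Proof.
apply/funext => p; rewrite /pseries_diffs /bcoef exprS factS addnS -addSn natrM.
field; rewrite nat1r !pnatr_eq0 -!lt0n !fact_gt0 //.
Qed.

Lemma is_derive_besE n z : is_derive z 1 (besE n) (- besE n.+1 z).
Proof.
have := is_derive_psum z (bcoef_bounded n).
rewrite bcoef_diffs.
have -> // : psum (fun p => - bcoef n.+1 p) z = - besE n.+1 z.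
have -> : (fun p => - bcoef n.+1 p) = (fun p => (-1) * bcoef n.+1 p + 0 * bcoef n.+1 p).
  by apply/funext => p; ring.
by rewrite (psum_lin _ _ _ (bcoef_bounded _) (bcoef_bounded _)); rewrite /besE; ring.
Qed.

Lemma besE_rec n z : besE n z = n.+1%:R * besE n.+1 z - z * besE n.+2 z.
Proof.
have b2 := bcoef_bounded n.+2.
have b1 := bcoef_bounded n.+1.
rewrite /besE (psum_shift _ b2).
pose d := fun p => if p is p'.+1 then bcoef n.+2 p' else 0.
have bd : fact_bounded 1 d.
  case=> [|p] /=; first by rewrite normr0 mulr_ge0// invr_ge0.
  rewrite bcoef_norm mul1r factS invfM natrM invfM.
  rewrite mulrC ler_wpM2r ?invr_ge0//.
  rewrite lef_pV2 ?posrE ?fact_gt0r ?ltr0n// ler_nat.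
  by rewrite addSn addSn (leq_trans _ (fact_geq _))// ltnS ltnW// ltnS leq_addl.
rewrite -/d -[X in _ = X]/(_ * psum _ _ - psum d z).
have -> : n.+1%:R * psum (bcoef n.+1) z - psum d z =
   n.+1%:R * psum (bcoef n.+1) z + (-1) * psum d z by ring.
rewrite -(psum_lin _ _ _ b1 bd); congr psum; apply/funext => -[|p] /=.
  rewrite /bcoef /d !addn0 factS natrM; field.
  by rewrite nat1r !pnatr_eq0 -!lt0n !fact_gt0.
rewrite /bcoef !addSn !addnS !factS !natrM exprS; field.
have hn : 0 <= n%:R :> R by []. have hp : 0 <= p%:R :> R by [].
rewrite !pnatr_eq0 -!lt0n !fact_gt0 /=.
by repeat (apply/andP; split); apply: lt0r_neq0; lra.
Qed.

Lemma derD (f g : R -> R) (x a b : R) : is_derive x 1 f a -> is_derive x 1 g b ->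
  is_derive x 1 (fun t => f t + g t) (a + b).
Proof. by move=> fa gb; have := is_deriveD fa gb. Qed.

Lemma derB (f g : R -> R) (x a b : R) : is_derive x 1 f a -> is_derive x 1 g b ->
  is_derive x 1 (fun t => f t - g t) (a - b).
Proof. by move=> fa gb; have := is_deriveB fa gb. Qed.

Lemma derM (f g : R -> R) (x a b : R) : is_derive x 1 f a -> is_derive x 1 g b ->
  is_derive x 1 (fun t => f t * g t) (a * g x + f x * b).
Proof.
move=> fa gb; apply: (is_derive_eq (is_deriveM fa gb)).
by rewrite addrC [X in X + _]mulrC.
Qed.

Lemma derc (x c : R) : is_derive x 1 (fun _ : R => c) 0.
Proof. exact: is_derive_cst. Qed.

Lemma derZ (f : R -> R) (c x a : R) : is_derive x 1 f a ->
  is_derive x 1 (fun t => c * f t) (c * a).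
Proof. by move=> fa; apply: (is_derive_eq (derM (derc x c) fa)); rewrite mul0r add0r. Qed.

Lemma derX (f : R -> R) n (x a : R) : is_derive x 1 f a ->
  is_derive x 1 (fun t => f t ^+ n) (n%:R * f x ^+ n.-1 * a).
Proof. by move=> fa; have := is_deriveX n fa; rewrite exprfctE. Qed.

Lemma derSum n (f : 'I_n -> R -> R) (x : R) (a : 'I_n -> R) :
  (forall i, is_derive x 1 (f i) (a i)) ->
  is_derive x 1 (fun t => \sum_(i < n) f i t) (\sum_(i < n) a i).
Proof. by move=> fa; have := is_derive_sum fa; rewrite fct_sumE. Qed.

Lemma bcoefS n p : bcoef n p.+1 = - (p.+1%:R^-1 * bcoef n.+1 p).
Proof.
rewrite /bcoef addSn addnS exprS factS natrM; field.
by rewrite nat1r !pnatr_eq0 -!lt0n !fact_gt0.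
Qed.

(** The power series of (1/n! - besE n z) / z. It is the defect left by the harmonic numbers when
    [fcoef] is differentiated term by term. *)
Let gcoef n p := p.+1%:R^-1 * bcoef n.+1 p.

Let gcoef_bounded n : fact_bounded 1 (gcoef n).
Proof.
move=> p; rewrite -normrN -bcoefS bcoef_norm mul1r factS natrM.
rewrite lef_pV2 ?posrE ?mulr_gt0 ?fact_gt0r ?ltr0n//.
rewrite -!natrM ler_nat mulnC mulnA -[X in (X <= _)%N]mul1n leq_mul ?fact_gt0//.
by rewrite muln_gt0 fact_gt0.
Qed.

Let psum_gcoef n z : z * psum (gcoef n) z = n`!%:R^-1 - besE n z.
Proof.
rewrite (psum_shift _ (gcoef_bounded n)).
set d := fun p => _.
have bd : fact_bounded 1 d.
  case=> [|p] /=; first by rewrite normr0 fact0 divr1.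
  rewrite /gcoef -normrN -bcoefS bcoef_norm mul1r lef_pV2 ?posrE ?mulr_gt0 ?fact_gt0r//.
  by rewrite -natrM ler_nat leq_pmulr ?fact_gt0.
have bh : fact_bounded n`!%:R^-1 (fun p => if p is p'.+1 then 0 else n`!%:R^-1 : R).
  case=> [|p]; last by rewrite normr0 mulr_ge0// invr_ge0.
  by rewrite fact0 divr1 ger0_norm// invr_ge0.
rewrite -[X in X - _](psum_head _ z).
have -> : besE n z = psum (fun p => 1 * (if p is p'.+1 then 0 else n`!%:R^-1) + (-1) * d p) z.
  congr psum; apply/funext => -[|p].
    rewrite /bcoef /d fact0 addn0 expr0 /=. by rewrite !mul1r mulr0 addr0.
  rewrite bcoefS -[d p.+1]/(p.+1%:R^-1 * bcoef n.+1 p) /=; ring.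
by rewrite (psum_lin _ _ _ bh bd); ring.
Qed.

(** The harmonic number gains 1/(p+1) under the index shift, which produces the last summand. In
    [besQ] it cancels against the derivative of the logarithm and the term 1/(n! z) from [besP]. *)
Lemma is_derive_besF n z : z != 0 ->
  is_derive z 1 (besF n) (- besF n.+1 z + (besE n z - n`!%:R^-1) / z).
Proof.
move=> z0; apply: (is_derive_eq (is_derive_psum z (fcoef_bounded n))).
have -> : (besE n z - n`!%:R^-1) / z = - psum (gcoef n) z.
  by apply: (mulfI z0); rewrite mulrN psum_gcoef opprB mulrC divfK.
have -> : - besF n.+1 z - psum (gcoef n) z = (-1) * besF n.+1 z + (-1) * psum (gcoef n) z.
  by ring.
rewrite /besF -(psum_lin _ _ _ (fcoef_bounded n.+1) (gcoef_bounded n)).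
congr psum; apply/funext => p; rewrite /pseries_diffs /fcoef /gcoef bcoefS.
rewrite addSn addnS !harmonic_sumS.
have h1 : p.+1%:R != 0 :> R by rewrite pnatr_eq0.
field.
rewrite nat1r h1 /=.
by have := ler0n R p; have := ler0n R n => h2 h3; apply: lt0r_neq0; lra.
Qed.

(** The defect 1/(n+1)! is opposite to the one in [besP_rec], so that [besQ] obeys the same
    homogeneous recurrence as [besE]. *)
Lemma besF_rec n z :
  besF n z = n.+1%:R * besF n.+1 z - z * besF n.+2 z - n.+1`!%:R^-1.
Proof.
have b1 := fcoef_bounded n.+1; have b2 := fcoef_bounded n.+2.
rewrite {3}/besF (psum_shift _ b2).
set d := fun p => _.
have bd : fact_bounded 2 d.
  case=> [|p] /=; first by rewrite normr0 mulr_ge0// invr_ge0.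
  rewrite /fcoef normrM bcoef_norm factS.
  rewrite ger0_norm ?addr_ge0 ?harmonic_sum_ge0//.
  have h1 := harmonic_sum_le (p + n.+2); have h2 := harmonic_sum_le p.
  have h3 : (p + n.+2)%:R <= (n.+2 + p)`!%:R / p.+1%:R :> R.
    rewrite ler_pdivlMr// -natrM ler_nat addnC !addSn factS.
    by rewrite leq_mul2l /= (leq_trans _ (fact_geq _))// ltnS leq_addl.
  have p0 : 0 < p`!%:R :> R by exact: fact_gt0r.
  have q0 : 0 < (n.+2 + p)`!%:R :> R by exact: fact_gt0r.
  have s0 : 0 < p.+1%:R :> R by [].
  rewrite natrM; set A := (n.+2 + p)`!%:R in h3 q0 *; set B := p`!%:R in p0 *.
  set c := p.+1%:R in h3 s0 *.
  have h4 : p%:R <= (p + n.+2)%:R :> R by rewrite ler_nat leq_addr.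
  have : harmonic_sum R (p + n.+2) + harmonic_sum R p <= 2 * (A / c).
    by rewrite mulr_natl mulr2n lerD// ?(le_trans h1 h3)// (le_trans h2 (le_trans h4 h3)).
  move=> h5; rewrite mulrC ler_pdivrMr ?mulr_gt0//.
  apply: le_trans h5 _; rewrite le_eqVlt; apply/orP; left; apply/eqP; field.
  by rewrite !lt0r_neq0.
rewrite -[X in _ = _ - X](psum_head _ z) {1 2}/besF.
set e := fun p => _.
have be : fact_bounded (n.+1`!%:R^-1) e.
  case=> [|p]; last by rewrite normr0 mulr_ge0// invr_ge0.
  by rewrite fact0 divr1 ger0_norm// invr_ge0.
have -> : n.+1%:R * psum (fcoef n.+1) z - psum d z - psum e z =
  1 * (n.+1%:R * psum (fcoef n.+1) z + (-1) * psum d z) + (-1) * psum e z by ring.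
have bf : fact_bounded (n.+1%:R * 2 + 2) (fun p => n.+1%:R * fcoef n.+1 p + (-1) * d p).
  move=> p; apply: le_trans (ler_normD _ _) _; rewrite mulrDl lerD//.
    by rewrite normrM normr_nat -mulrA ler_wpM2l.
  by rewrite normrM normrN1 mul1r.
rewrite -(psum_lin _ _ _ b1 bd) -(psum_lin _ _ _ bf be).
congr psum; apply/funext => -[|p].
  rewrite /e /d /fcoef !add0n harmonic_sumS /bcoef !addn0 factS natrM.
  rewrite /harmonic_sum [\sum_(1 <= i < 1) _]big_geq //.
  rewrite mulr1n; field.
  by rewrite nat1r !pnatr_eq0 -!lt0n !fact_gt0.
rewrite /e -[d p.+1]/(fcoef n.+2 p) /fcoef mulr0 addr0 mul1r.
rewrite !addnS !addSn !harmonic_sumS.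
rewrite /bcoef !addSn !addnS !factS !natrM exprS.
rewrite (addnC p n).
have hn : 0 <= n%:R :> R by []. have hp : 0 <= p%:R :> R by [].
set H := harmonic_sum _ _; set h := harmonic_sum _ p.
set A := (n + p)`!%:R; set B := p`!%:R.
have A0 : A != 0 by rewrite lt0r_neq0 ?fact_gt0r.
have B0 : B != 0 by rewrite lt0r_neq0 ?fact_gt0r.
field.
rewrite A0 B0 /=.
by repeat (apply/andP; split); apply: lt0r_neq0; lra.
Qed.

Lemma is_derive_besP n z : z != 0 ->
  is_derive z 1 (besP n) (n`!%:R^-1 / z - besP n.+1 z).
Proof.
move=> z0.
have dV : is_derive z 1 (fun t : R => t^-1) (- z^-1 ^+ 2).
  have := is_deriveV z0 (is_derive_id z (1 : R)).
  by move/is_derive_eq; apply; rewrite /GRing.scale /= mulr1 exprVn.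
apply: (is_derive_eq (derSum (fun i : 'I_n => derZ _ (derX (n - i) dV)))).
rewrite /besP big_ord_recr /= subSnn.
have -> : (n.+1 - 1 - n = 0)%N by rewrite subn1 subnn.
rewrite fact0 expr1 div1r.
rewrite opprD addrCA subrr addr0 -sumrN; apply: eq_bigr => -[p pn] _ /=.
have -> : (n.+1 - 1 - p = (n - 1 - p).+1)%N by lia.
have -> : (n.+1 - p = (n - 1 - p).+2)%N by lia.
have -> : (n - p = (n - 1 - p).+1)%N by lia.
rewrite factS /= natrM !exprS expr0; ring.
Qed.

Lemma besP_rec n z : z != 0 ->
  besP n z = n.+1%:R * besP n.+1 z - z * besP n.+2 z + n.+1`!%:R^-1.
Proof.
move=> z0; rewrite {3}/besP big_ord_recr /= subSnn.
have -> : (n.+2 - 1 - n.+1 = 0)%N by lia.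
rewrite fact0 div1r expr1 mulrDr mulrCA mulfV// mulr1 opprD addrA addrNK.
rewrite {2}/besP mulr_sumr mulr_sumr -sumrB big_ord_recl /=.
have -> : (n.+1 - 1 - 0 = n)%N by lia.
have -> : (n.+2 - 1 - 0 = n.+1)%N by lia.
rewrite !subn0 factS natrM (exprS _ n.+1).
rewrite [X in _ = X + _](_ : _ = 0) ?add0r; last first.
  by rewrite fact0; field; rewrite ?z0 ?oner_eq0.
rewrite /besP; apply: eq_bigr => -[p pn] _ /=; rewrite /bump /= add1n.
have -> : (n.+1 - 1 - p.+1 = n - 1 - p)%N by lia.
have -> : (n.+2 - 1 - p.+1 = (n - 1 - p).+1)%N by lia.
have -> : (n.+2 - p.+1 = (n - p).+1)%N by lia.
have -> : n.+1%:R = (n - 1 - p)%:R + 2 + p%:R :> R.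
  by rewrite -!natrD; congr _%:R; lia.
rewrite !factS !natrM (exprS _ (n - p)).
have h : 0 <= p%:R :> R by [].
have -> : (n - p = (n - 1 - p).+1)%N by lia.
field.
rewrite z0 /= pnatr_eq0 -lt0n fact_gt0 /=; apply: lt0r_neq0; lra.
Qed.

Lemma is_derive_besQ n z : 0 < z -> is_derive z 1 (besQ n) (- besQ n.+1 z).
Proof.
move=> z0; have zn0 : z != 0 by rewrite lt0r_neq0.
have dl : is_derive z 1 (fun t : R => ln t + 2 * euler_gamma R) (z^-1 + 0).
  exact: (derD (is_derive1_ln z0) (derc _ _)).
apply: (is_derive_eq (derB (derB (derM dl (is_derive_besE n z))
  (is_derive_besP n zn0)) (is_derive_besF n zn0))).
by rewrite /besQ; ring.
Qed.

Lemma besQ_rec n z : z != 0 -> besQ n z = n.+1%:R * besQ n.+1 z - z * besQ n.+2 z.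
Proof.
by move=> z0; rewrite {1}/besQ besE_rec (besP_rec _ z0) besF_rec /besQ; ring.
Qed.

Lemma sum_exp_le n z : 0 <= z -> \sum_(p < n) z ^+ p / p`!%:R <= expR z.
Proof.
move=> z0; rewrite -(big_mkord xpredT (fun p => z ^+ p / p`!%:R)).
apply: (@nondecreasing_cvgn_le _ (series (exp_coeff z))).
  apply/nondecreasing_seqP => k; rewrite /series /= big_nat_recr//= lerDl.
  exact: exp_coeff_ge0.
exact: is_cvg_series_exp_coeff.
Qed.

Lemma besP_bounds n z : 0 < z -> 0 <= z ^+ n * besP n z <= n`!%:R * expR z.
Proof.
move=> z0; rewrite /besP mulr_sumr.
have E (i : 'I_n) : z ^+ n * ((n - 1 - i)`!%:R / i`!%:R * z^-1 ^+ (n - i)) =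
    (n - 1 - i)`!%:R * (z ^+ i / i`!%:R).
  have /(congr1 (GRing.exp z)) : (n = i + (n - i))%N by rewrite subnKC// ltnW.
  rewrite exprD => ->; rewrite exprVn; field.
  by rewrite expf_neq0 ?lt0r_neq0 ?fact_gt0r.
rewrite (eq_bigr _ (fun i _ => E i)); apply/andP; split.
  by apply: sumr_ge0 => i _; rewrite mulr_ge0// divr_ge0// exprn_ge0 ?ltW.
apply: le_trans (ler_wpM2l _ (sum_exp_le n (ltW z0))); last by [].
rewrite mulr_sumr; apply: ler_sum => i _; rewrite ler_wpM2r//.
  by rewrite divr_ge0// exprn_ge0 ?ltW.
by rewrite ler_nat; apply: leq_fact; lia.
Qed.

(** The term p = 0 alone contributes n!, and the others are nonnegative. *)
Lemma besP_lower n z : 0 < z -> n`!%:R <= z ^+ n.+1 * besP n.+1 z.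
Proof.
move=> z0; rewrite /besP big_ord_recl mulrDr.
rewrite [X in X + _](_ : _ = n`!%:R); last first.
  rewrite subn0 subn1 /= subn0 fact0 exprVn divr1 mulrCA mulfV ?mulr1//.
  by rewrite expf_neq0 ?lt0r_neq0.
rewrite lerDl mulr_ge0 ?exprn_ge0 ?(ltW z0)// sumr_ge0// => i _.
by rewrite mulr_ge0 ?divr_ge0// exprn_ge0// invr_ge0 ltW.
Qed.

(** The constant term of the series is 1/n!, and [psum_gcoef] bounds the rest by z e^z / (n+1)!. *)
Lemma besE_lower n z : 0 <= z ->
  (1 - z * expR z / n.+1%:R) / n`!%:R <= besE n z.
Proof.
move=> z0.
have gb : fact_bounded n.+1`!%:R^-1 (gcoef n).
  move=> p; rewrite /gcoef normrM ger0_norm ?invr_ge0//.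
  apply: le_trans (bcoef_bounded n.+1 p).
  by rewrite ler_piMl// invf_le1// ler1n.
have := psum_bound z gb; rewrite (ger0_norm z0) => /(ler_wpM2l z0).
rewrite -{1}(ger0_norm z0) -normrM psum_gcoef ler_norml => /andP[_].
rewrite factS natrM.
have -> : z * ((n.+1%:R * n`!%:R)^-1 * expR z) = z * expR z / n.+1%:R / n`!%:R.
  by field; rewrite nat1r !lt0r_neq0 ?fact_gt0r.
by move=> h; rewrite mulrBl mul1r lerBlDr addrC -lerBlDr.
Qed.

(* The Wronskian: [besV n z = z * besV n.+1 z], so that a common zero of [besE n]
   and [besQ n] makes all later ones vanish, while [besP] forces
   [z ^+ m.+1 * besV m z] away from [0] for large [m]. *)
Let besV n z := besE n.+1 z * besQ n z - besE n z * besQ n.+1 z.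

Let besV_rec n z : z != 0 -> besV n z = z * besV n.+1 z.
Proof. by move=> z0; rewrite /besV (besE_rec n) (besQ_rec n z0); ring. Qed.

Lemma bes_neq0 n z : 0 < z -> ~~ ((besE n z == 0) && (besQ n z == 0)).
Proof.
move=> z0; apply/negP => /andP[/eqP E0 /eqP Q0].
have zn0 : z != 0 by rewrite lt0r_neq0.
have V0 m : besV (n + m) z = 0.
  elim: m => [|m IH]; first by rewrite addn0 /besV E0 Q0; ring.
  by move: IH; rewrite (besV_rec _ zn0) addnS => /eqP; rewrite mulf_eq0 (negPf zn0) => /eqP.
have [X X0 XE] : exists2 X : R, 0 < X & expR z = X.
  by exists (expR z); rewrite ?expR_gt0.
pose L : R := `|ln z + 2 * euler_gamma R|.
have L0 : 0 <= L by exact: normr_ge0.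
(* Chosen so that z^m / m! <= e bounds z^(m+1) times the logarithmic and regular parts of [besQ] by
   m!/2, half of the lower bound for the [besP] part. *)
pose e := (2 * z * (L + 2) * X)^-1.
have e0 : 0 < e by rewrite invr_gt0 !mulr_gt0// ltr_wpDl.
near \oo => m.
have nm : (n <= m)%N by near: m; exact: nbhs_infty_ge.
have hb : z ^+ m / m`!%:R <= e.
  apply: le_trans (ler_norm _) _; near: m.
  by have := @cvg_exp_coeff R z => /cvgr0Pnorm_le /(_ _ e0).
have hd : 2 * (z * X) < m%:R by near: m; exact: nbhs_infty_gtr.
have hc : 4 * (X * (2^-1 + z * X)) < m%:R by near: m; exact: nbhs_infty_gtr.
have zX0 : 0 < z * X by exact: mulr_gt0.
have zXX0 : 0 < X * (z * X) by exact: mulr_gt0.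
have m1E : m.+1%:R = m%:R + 1 :> R by rewrite -natr1.
have ha : z * X / m.+1%:R <= 2^-1.
  by rewrite ler_pdivrMr// m1E; lra.
have hc' : X * (2^-1 + z * X) / m.+1%:R < 4^-1.
  by rewrite ltr_pdivrMr// m1E; lra.
have f0 : 0 < m`!%:R :> R by exact: fact_gt0r.
have hb' : z * (z ^+ m * ((L + 2) * X)) <= m`!%:R / 2.
  move: hb; rewrite ler_pdivrMr// => hb.
  have := ler_wpM2r (_ : 0 <= z * ((L + 2) * X)) hb => /(_ _) h.
  apply: le_trans (_ : _ <= z ^+ m * (z * ((L + 2) * X))) _; first by apply: eqle; ring.
  apply: le_trans (h _) _; first by rewrite !mulr_ge0 ?addr_ge0// ltW.
  by apply: eqle; rewrite /e; field; rewrite !lt0r_neq0// ltr_wpDl.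
have Vm : besV m z = 0 by rewrite -(subnKC nm) V0.
have zm0 : 0 < z ^+ m by rewrite exprn_gt0.
have bE k : `|besE k z| <= X / k`!%:R by have := besE_bound k z; rewrite (gtr0_norm z0) XE.
have bLF k : `|(ln z + 2 * euler_gamma R) * besE k z - besF k z| <= (L + 2) * X.
  apply: le_trans (ler_normB _ _) _; rewrite [leRHS]mulrDl lerD//.
    rewrite normrM ler_wpM2l//; apply: le_trans (bE k) _.
    by rewrite ler_piMr ?(ltW X0)// invf_le1 ?fact_gt0r// ler1n fact_gt0.
  by have := besF_bound k z; rewrite (gtr0_norm z0) XE.
have zz0 := exprn_gt0 m.+1 z0.
have zbLF k : `|z ^+ m.+1 * ((ln z + 2 * euler_gamma R) * besE k z - besF k z)| <= m`!%:R / 2.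
  rewrite normrM (gtr0_norm zz0); apply: le_trans hb'.
  by rewrite mulrA -exprS; apply: ler_wpM2l; [exact: ltW|exact: bLF].
have lowQ : m`!%:R / 2 <= - (z ^+ m.+1 * besQ m.+1 z).
  have h1 := besP_lower m z0.
  set u := z ^+ m.+1 * ((ln z + 2 * euler_gamma R) * besE m.+1 z - besF m.+1 z); have := zbLF m.+1; rewrite -/u ler_norml => /andP[_ h3].
  have -> : z ^+ m.+1 * besQ m.+1 z = u - z ^+ m.+1 * besP m.+1 z.
    by rewrite /u /besQ; ring.
  by lra.
have lowE : (2 * m`!%:R)^-1 <= besE m z.
  apply: le_trans (besE_lower m (ltW z0)); rewrite invfM ler_wpM2r ?invr_ge0// XE.
  by rewrite (_ : 2^-1 = 1 - 2^-1 :> R) ?lerB//; field.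
have upQ : `|z ^+ m.+1 * besQ m z| <= m`!%:R * (2^-1 + z * X).
  have -> : z ^+ m.+1 * besQ m z = z ^+ m.+1 * ((ln z + 2 * euler_gamma R) * besE m z - besF m z) - z * (z ^+ m * besP m z).
    by rewrite /besQ exprS; ring.
  apply: le_trans (ler_normB _ _) _; rewrite [leRHS]mulrDr lerD ?zbLF//.
  have /andP[P0 PX] := besP_bounds m z0.
  rewrite XE in PX; rewrite ger0_norm; last by rewrite mulr_ge0// ltW.
  by rewrite [leRHS]mulrCA ler_wpM2l// ltW.
have upE : `|besE m.+1 z| <= X / m.+1%:R / m`!%:R.
  apply: le_trans (bE m.+1) _; rewrite factS natrM; apply: eqle; field.
  by rewrite nat1r !lt0r_neq0.
(* Of the two terms of z^(m+1) [besV m z], this one stays above 1/4, while the other carries a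
   factor 1/(m+1) and is smaller than 1/4 in modulus; the sum cannot vanish. *)
have h1 : 4^-1 <= besE m z * - (z ^+ m.+1 * besQ m.+1 z).
  apply: le_trans (_ : _ <= (2 * m`!%:R)^-1 * (m`!%:R / 2)) _.
    by apply: eqle; field; rewrite lt0r_neq0.
  by apply: ler_pM lowE lowQ; rewrite ?invr_ge0 ?divr_ge0 ?mulr_ge0// ltW.
have h2 : `|besE m.+1 z * (z ^+ m.+1 * besQ m z)| < 4^-1.
  apply: le_lt_trans hc'; rewrite normrM.
  apply: le_trans (ler_pM _ _ upE upQ) _ => //.
  by apply: eqle; field; rewrite nat1r !lt0r_neq0.
have : besE m.+1 z * (z ^+ m.+1 * besQ m z) + besE m z * - (z ^+ m.+1 * besQ m.+1 z) = 0.
  by rewrite -[RHS](mulr0 (z ^+ m.+1)) -Vm /besV; ring.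
move: h2; rewrite ltr_norml => /andP[h2 _]; lra.
Unshelve. all: by end_near. Qed.

End BesselSeries.

(** * The real-valued modulus on complex numbers *)

Section ComplexModulus.
Variable R : realType.
Implicit Types (z w : R[i]).

Lemma normcE z : `|z| = (cabs z)%:C.
Proof. exact: normc_def. Qed.

Lemma cabs_ge0 z : 0 <= cabs z. Proof. exact: sqrtr_ge0. Qed.

Lemma cabsM z w : cabs (z * w) = cabs z * cabs w.
Proof. by apply: complexI; rewrite rmorphM /= -!normcE normrM. Qed.

Lemma cabsD z w : cabs (z + w) <= cabs z + cabs w.
Proof. by rewrite -lecR rmorphD /= -!normcE ler_normD. Qed.

Lemma cabsN z : cabs (- z) = cabs z.
Proof. by apply: complexI; rewrite -!normcE normrN. Qed.

Lemma cabsB z w : cabs (z - w) <= cabs z + cabs w.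
Proof. by rewrite (le_trans (cabsD _ _))// cabsN. Qed.

Lemma cabs0 : cabs (0 : R[i]) = 0.
Proof. by apply: complexI; rewrite -normcE normr0. Qed.

Lemma cabs1 : cabs (1 : R[i]) = 1.
Proof. by apply: complexI; rewrite -normcE normr1. Qed.

Lemma cabsX z n : cabs (z ^+ n) = cabs z ^+ n.
Proof. by apply: complexI; rewrite rmorphXn /= -!normcE normrX. Qed.

Lemma cabsV z : cabs z^-1 = (cabs z)^-1.
Proof. by apply: complexI; rewrite fmorphV /= -!normcE normfV. Qed.

Lemma cabs_conj z : cabs z^* = cabs z.
Proof. by case: z => a b; rewrite /cabs /= sqrrN. Qed.

Lemma cabs_real (a : R) : cabs a%:C = `|a|.
Proof. by rewrite /cabs /= expr0n addr0 sqrtr_sqr. Qed.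

Lemma cabs_nat n : cabs (n%:R : R[i]) = n%:R.
Proof. by rewrite -[n%:R](rmorph_nat (real_complex R)) cabs_real normr_nat. Qed.

Lemma cabs_eq0 z : (cabs z == 0) = (z == 0).
Proof. by rewrite -[RHS]normr_eq0 normcE -[RHS]/(_ == 0%:C) (inj_eq (@complexI R)). Qed.

Lemma cabs_sum (I : Type) (s : seq I) (P : pred I) (F : I -> R[i]) :
  cabs (\sum_(i <- s | P i) F i) <= \sum_(i <- s | P i) cabs (F i).
Proof.
elim/big_ind2: _ => [|x y a b xa yb|//]; first by rewrite cabs0.
by rewrite (le_trans (cabsD _ _))// lerD.
Qed.

Lemma sqr_cabs z : cabs z ^+ 2 = complex.Re z ^+ 2 + complex.Im z ^+ 2.
Proof. by rewrite sqr_sqrtr// addr_ge0// sqr_ge0. Qed.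

Lemma sqr_cabsE z : (cabs z ^+ 2)%:C = z * z^*.
Proof.
rewrite sqr_cabs; case: z => a b /=.
by apply/eqP; rewrite eq_complex /=; apply/andP; split; apply/eqP; ring.
Qed.

Lemma normRe_le z : `|complex.Re z| <= cabs z.
Proof. by rewrite -sqrtr_sqr ler_wsqrtr// lerDl sqr_ge0. Qed.

Lemma normIm_le z : `|complex.Im z| <= cabs z.
Proof. by rewrite -sqrtr_sqr ler_wsqrtr// lerDr sqr_ge0. Qed.

Lemma cabs_le z : cabs z <= `|complex.Re z| + `|complex.Im z|.
Proof.
rewrite -[leRHS]ger0_norm ?addr_ge0// -sqrtr_sqr ler_wsqrtr//.
rewrite sqrrD -!normrX !(ger0_norm (sqr_ge0 _)) addrAC lerDl.
by rewrite mulrn_wge0// mulr_ge0.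
Qed.

End ComplexModulus.

(** * Derivatives of complex functions of a real variable *)

Section ComplexDerivative.
Variable R : realType.
Implicit Types (f g : R -> R[i]) (t : R) (a b : R[i]).

Lemma cReD a b : complex.Re (a + b) = complex.Re a + complex.Re b.
Proof. by case: a; case: b. Qed.
Lemma cImD a b : complex.Im (a + b) = complex.Im a + complex.Im b.
Proof. by case: a; case: b. Qed.
Lemma cReN a : complex.Re (- a) = - complex.Re a. Proof. by case: a. Qed.
Lemma cImN a : complex.Im (- a) = - complex.Im a. Proof. by case: a. Qed.
Lemma cReM a b :
  complex.Re (a * b) = complex.Re a * complex.Re b - complex.Im a * complex.Im b.
Proof. by case: a; case: b. Qed.
Lemma cImM a b :
  complex.Im (a * b) = complex.Re a * complex.Im b + complex.Im a * complex.Re b.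
Proof. by case: a; case: b. Qed.

Definition cderiv f t a :=
  is_derive t 1 (fun s => complex.Re (f s) : R) (complex.Re a) /\
  is_derive t 1 (fun s => complex.Im (f s) : R) (complex.Im a).

Lemma cderiv_eq f t a b : cderiv f t a -> a = b -> cderiv f t b.
Proof. by move=> ? <-. Qed.

Lemma cderivD f g t a b : cderiv f t a -> cderiv g t b ->
  cderiv (fun s => f s + g s) t (a + b).
Proof.
move=> [f1 f2] [g1 g2]; split.
  by under eq_fun => s do rewrite cReD; rewrite cReD; exact: derD.
by under eq_fun => s do rewrite cImD; rewrite cImD; exact: derD.
Qed.

Lemma cderivc (c : R[i]) t : cderiv (fun _ => c) t 0.
Proof. by split; exact: derc. Qed.

Lemma cderivM f g t a b : cderiv f t a -> cderiv g t b ->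
  cderiv (fun s => f s * g s) t (a * g t + f t * b).
Proof.
move=> [f1 f2] [g1 g2]; split.
  under eq_fun => s do rewrite cReM.
  apply: (is_derive_eq (derB (derM f1 g1) (derM f2 g2))).
  by rewrite cReD !cReM; ring.
under eq_fun => s do rewrite cImM.
apply: (is_derive_eq (derD (derM f1 g2) (derM f2 g1))).
by rewrite cImD !cImM; ring.
Qed.

Lemma cderivZ (c : R[i]) f t a : cderiv f t a -> cderiv (fun s => c * f s) t (c * a).
Proof. by move=> fa; apply: (cderiv_eq (cderivM (cderivc c t) fa)); rewrite mul0r add0r. Qed.

Lemma cderivX f t a n : cderiv f t a ->
  cderiv (fun s => f s ^+ n) t (n%:R * f t ^+ n.-1 * a).
Proof.
move=> fa; elim: n => [|n IH].
  under eq_fun => s do rewrite expr0.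
  by rewrite mul0r mul0r; exact: cderivc.
under eq_fun => s do rewrite exprS.
apply: (cderiv_eq (cderivM fa IH)) => /=.
by case: n {IH} => [|n]; rewrite ?expr0 /= -?(natr1 n.+1) ?exprS; ring.
Qed.

Lemma cderiv_conj f t a : cderiv f t a -> cderiv (fun s => (f s)^*) t a^*.
Proof.
have Re_conj b : complex.Re b^* = complex.Re b by case: b.
have Im_conj b : complex.Im b^* = - 1 * complex.Im b by case: b => ? ?; rewrite mulN1r.
move=> [f1 f2]; split.
  by under eq_fun => s do rewrite Re_conj; rewrite Re_conj.
by under eq_fun => s do rewrite Im_conj; rewrite Im_conj; exact: derZ.
Qed.

Lemma cderiv_real (r : R -> R) t d : is_derive t 1 r d ->
  cderiv (fun s => (r s)%:C) t d%:C.
Proof. by move=> rd; split => //=; exact: derc. Qed.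

Lemma cderiv_comp f (r : R -> R) t a d : cderiv f (r t) a -> is_derive t 1 r d ->
  cderiv (fun s => f (r s)) t (d%:C * a).
Proof.
move=> [f1 f2] rd; split.
  by rewrite cReM /= mul0r subr0 mulrC; exact: (is_derive1_comp (f := fun s => _ (f s))).
by rewrite cImM /= mul0r addr0 mulrC; exact: (is_derive1_comp (f := fun s => _ (f s))).
Qed.

End ComplexDerivative.

(** * Cylindrical waves and their first derivatives *)

Section CylindricalWaves.
Variable R : realType.
Implicit Types (z k t : R) (w v : R[i]) (m : int) (n : nat).

(** The Hankel function of order n at t, divided by (t/2)^n, as a function of z = (t/2)^2; in this
    form differentiation only raises the order. *)
Definition cylZ n z : R[i] := besE n z +i* (besQ n z / pi).

Lemma cylZ_rec n z : z != 0 ->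
  cylZ n z = n.+1%:R * cylZ n.+1 z - z%:C * cylZ n.+2 z.
Proof.
move=> z0; rewrite /cylZ (besE_rec n) (besQ_rec n z0).
have -> : (n.+1%:R : R[i]) = (n.+1%:R : R)%:C by rewrite rmorph_nat.
by apply/eqP; rewrite eq_complex /=; apply/andP; split; apply/eqP; ring.
Qed.

Lemma cderiv_cylZ n z : 0 < z -> cderiv (cylZ n) z (- cylZ n.+1 z).
Proof.
move=> z0; split => /=; first exact: is_derive_besE.
apply: (is_derive_eq (derM (is_derive_besQ n z0) (derc _ _))); ring.
Qed.

Lemma cylZ_neq0 n z : 0 < z -> cylZ n z != 0.
Proof.
move=> z0; rewrite eq_complex /=; have := bes_neq0 n z0.
by rewrite mulf_eq0 invr_eq0 (gt_eqF (pi_gt0 R)) orbF.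
Qed.

(* With [w = k x / 2], these are the waves [H_m(k|x|) e^{i m theta}]. *)
Definition psi m w : R[i] :=
  match m with
  | Posz n => w ^+ n * cylZ n (cabs w ^+ 2)
  | Negz n => (- w^*) ^+ n.+1 * cylZ n.+1 (cabs w ^+ 2)
  end.

Lemma is_derive_sqr_cabs (w : R -> R[i]) t v : cderiv w t v ->
  exists2 d, is_derive t 1 (fun s => cabs (w s) ^+ 2) d & d%:C = v * (w t)^* + w t * v^*.
Proof.
move=> [w1 w2].
exists (2 * (complex.Re (w t) * complex.Re v + complex.Im (w t) * complex.Im v)).
  under eq_fun => s do rewrite sqr_cabs.
  by apply: (is_derive_eq (derD (derX 2 w1) (derX 2 w2))) => /=; rewrite !expr1; ring.
case: v (w t) {w1 w2} => a b [c d] /=.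
by apply/eqP; rewrite eq_complex /=; apply/andP; split; apply/eqP; ring.
Qed.

(** The Bessel relations in Wirtinger form: the derivative of psi_m in w is psi_(m-1), the one in
    the conjugate of w is - psi_(m+1). The recurrence [cylZ_rec] turns the product rule into
    this. *)
Lemma cderiv_psi m (w : R -> R[i]) t v : cderiv w t v -> 0 < cabs (w t) ->
  cderiv (fun s => psi m (w s)) t (v * psi (m - 1) (w t) - v^* * psi (m + 1) (w t)).
Proof.
move=> wv w0; have [d dr dE] := is_derive_sqr_cabs wv.
have z0 : 0 < cabs (w t) ^+ 2 by rewrite exprn_gt0.
have zn0 := lt0r_neq0 z0.
have cZ n := @cderiv_comp _ (cylZ n) (fun s => cabs (w s) ^+ 2) t _ d (cderiv_cylZ n z0) dr.
have rec n := cylZ_rec n zn0.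
have zE := sqr_cabsE (w t).
case: m => [[|n]|n].
- rewrite /psi /=; apply: (cderiv_eq (cderivM (cderivX 0 wv) (cZ 0))).
  by rewrite dE; ring.
- have -> : n.+1%:Z - 1 = n%:Z by lia.
  have -> : n.+1%:Z + 1 = n.+2%:Z by lia.
  rewrite /psi; apply: (cderiv_eq (cderivM (cderivX n.+1 wv) (cZ n.+1))).
  by rewrite dE (rec n) zE /= !exprS; ring.
- have wc := cderiv_conj wv.
  have wcN : cderiv (fun s => - (w s)^*) t (- v^*).
    under eq_fun => s do rewrite -mulN1r.
    by apply: (cderiv_eq (cderivZ (-1) wc)); rewrite mulN1r.
  have -> : Negz n - 1 = Negz n.+1 by lia.
  have -> : psi (Negz n + 1) (w t) = (- (w t)^*) ^+ n * cylZ n (cabs (w t) ^+ 2).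
    case: n => [|n]; first by have -> : Negz 0 + 1 = 0 :> int by [].
    by have -> : Negz n.+1 + 1 = Negz n by lia.
  rewrite /psi; apply: (cderiv_eq (cderivM (cderivX n.+1 wcN) (cZ n.+1))).
  by rewrite dE (rec n) zE /= !exprS; ring.
Qed.

End CylindricalWaves.

(** * Growth of the waves and of their iterated derivatives *)

Section WaveBounds.
Variable R : realType.
Implicit Types (z k t a b C : R) (w v : R[i]) (m : int) (n i j q : nat).

(** The growth rate of the waves in the order: |w|^-1 comes from the singularity of Y_n, and 1
    covers the regular part, since |w|^n <= n! e^|w|. *)
Definition sig w : R := Num.max 1 (cabs w)^-1.

Lemma sig_ge1 w : 1 <= sig w. Proof. by rewrite le_max lexx. Qed.

Lemma sig_gt0 w : 0 < sig w. Proof. exact: lt_le_trans ltr01 (sig_ge1 w). Qed.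

Definition psi_bounded C a b := forall m w, a <= cabs w <= b ->
  cabs (psi m w) <= C * `|m|%N`!%:R * sig w ^+ `|m|%N.

Lemma cabs_psi m w : cabs (psi m w) = cabs w ^+ `|m|%N * cabs (cylZ `|m|%N (cabs w ^+ 2)).
Proof. by case: m => n; rewrite /psi cabsM cabsX ?cabsN ?cabs_conj. Qed.

Lemma exprn_le_fact n z : 0 <= z -> z ^+ n <= n`!%:R * expR z.
Proof.
move=> z0; rewrite mulrC -ler_pdivrMr ?fact_gt0r//.
apply: le_trans (sum_exp_le n.+1 z0); rewrite big_ord_recr /= lerDr.
by apply: sumr_ge0 => p _; rewrite divr_ge0// exprn_ge0.
Qed.

(** On the annulus the logarithm and the exponential are bounded. The singular sum [besP]
    contributes n! |w|^-n, and all other parts at most |w|^n <= n! e^|w|. *)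
Lemma psi_bounded_ex a b : 0 < a -> a <= b -> exists2 C : R, 0 < C & psi_bounded C a b.
Proof.
move=> a0 ab; have b0 : 0 < b by exact: lt_le_trans ab.
pose X := expR (b ^+ 2); pose Y := expR b.
pose L := `|ln (a ^+ 2)| + `|ln (b ^+ 2)| + `|2 * euler_gamma R|.
have X0 : 0 < X by exact: expR_gt0.
have Y0 : 0 < Y by exact: expR_gt0.
have L0 : 0 <= L by rewrite !addr_ge0.
exists (Y * (X + L * X + 2 * X) + X).
  by rewrite ltr_wpDl// mulr_ge0 ?(ltW Y0)// !addr_ge0 ?mulr_ge0// ltW.
move=> m w /andP[aw wb]; rewrite cabs_psi; set n := `|m|%N; set s := cabs w in aw wb *.
have s0 : 0 < s by exact: lt_le_trans aw.
set z := s ^+ 2; have z0 : 0 < z by exact: exprn_gt0.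
have sg : sig w = Num.max 1 s^-1 by [].
have zX : expR z <= X by rewrite ler_expR /z lerXn2r ?nnegrE ?(ltW s0) ?(ltW b0).
have sY : expR s <= Y by rewrite ler_expR.
have LL : `|ln z + 2 * euler_gamma R| <= L.
  apply: le_trans (ler_normD _ _) _; rewrite lerD2r.
  have l1 : ln (a ^+ 2) <= ln z by rewrite ler_ln ?posrE ?exprn_gt0// lerXn2r ?nnegrE ?(ltW a0) ?(ltW b0) ?(ltW s0).
  have l2 : ln z <= ln (b ^+ 2) by rewrite ler_ln ?posrE ?exprn_gt0// lerXn2r ?nnegrE ?(ltW a0) ?(ltW b0) ?(ltW s0).
  rewrite ler_norml; apply/andP; split.
    rewrite lerNl; apply: le_trans (_ : _ <= `|ln (a ^+ 2)|) _.
      by rewrite -normrN (le_trans _ (ler_norm _))// lerN2.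
    by rewrite lerDl.
  by apply: le_trans l2 _; rewrite (le_trans (ler_norm _))// lerDr.
have EE : `|besE n z| <= X.
  apply: le_trans (besE_bound n z) _; rewrite (gtr0_norm z0).
  by apply: le_trans zX; rewrite ler_piMr ?expR_ge0// invf_le1 ?fact_gt0r// ler1n fact_gt0.
have FF : `|besF n z| <= 2 * X.
  by apply: le_trans (besF_bound n z) _; rewrite (gtr0_norm z0) ler_wpM2l.
have sn1 : 1 <= sig w ^+ n by rewrite exprn_ege1// sig_ge1.
have nf0 : 0 <= n`!%:R :> R by [].
have sn : s ^+ n <= n`!%:R * sig w ^+ n * Y.
  apply: le_trans (exprn_le_fact n (ltW s0)) _.
  rewrite -[n`!%:R * sig w ^+ n * Y]mulrA ler_wpM2l//.
  by apply: le_trans sY _; rewrite ler_peMl// ltW.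
have PP : `|s ^+ n * besP n z| <= n`!%:R * sig w ^+ n * X.
  have /andP[P0 P1] := besP_bounds n z0.
  have sp : 0 < s ^+ n by rewrite exprn_gt0.
  have -> : s ^+ n * besP n z = s^-1 ^+ n * (z ^+ n * besP n z).
    by rewrite /z -exprM mulnC exprM expr2 exprVn; field; rewrite lt0r_neq0.
  rewrite ger0_norm; last by rewrite mulr_ge0// exprn_ge0// invr_ge0 ltW.
  have -> : n`!%:R * sig w ^+ n * X = sig w ^+ n * (n`!%:R * X) by ring.
  rewrite ler_pM ?exprn_ge0 ?invr_ge0 ?(ltW s0)//.
    by rewrite lerXn2r ?nnegrE ?invr_ge0 ?(ltW s0) ?(ltW (sig_gt0 w))// sg le_max lexx orbT.
  by apply: le_trans P1 _; rewrite ler_wpM2l.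
have pi1 : pi^-1 <= 1 :> R.
  by rewrite invf_le1 ?pi_gt0// (le_trans _ (pi_ge2 R))// ler1n.
have QQ : cabs (cylZ n z) <= `|besE n z| + `|besQ n z|.
  apply: le_trans (cabs_le _) _; rewrite lerD2l normrM normrV ?unitfE ?gt_eqF ?pi_gt0//.
  by rewrite (gtr0_norm (pi_gt0 R)) ler_piMr.
apply: le_trans (ler_wpM2l _ QQ) _; first by rewrite exprn_ge0 ?ltW.
have -> : (Y * (X + L * X + 2 * X) + X) * n`!%:R * sig w ^+ n =
   n`!%:R * sig w ^+ n * Y * (X + L * X + 2 * X) + n`!%:R * sig w ^+ n * X by ring.
apply: le_trans (_ : _ <= s ^+ n * (X + L * X + 2 * X) + `|s ^+ n * besP n z|) _; last first.
  rewrite lerD// ler_wpM2r// !addr_ge0 ?mulr_ge0// ltW//.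
rewrite normrM (ger0_norm (exprn_ge0 n (ltW s0))) -mulrDr ler_wpM2l ?exprn_ge0 ?(ltW s0)//.
have hQ : `|besQ n z| <= L * X + `|besP n z| + 2 * X.
  apply: le_trans (ler_normB _ _) _; rewrite lerD//.
  apply: le_trans (ler_normB _ _) _; rewrite lerD//.
  by rewrite normrM ler_pM.
by apply: le_trans (lerD EE hQ) _; apply: eqle; ring.
Qed.

(** C(i,j) <= C(n+i,j), and C(n+i,j) (n+i-j)! divides (n+i)!. Thus the binomial weights in [jet] are
    absorbed by the factorials, and [jet_bound] loses only i+1 instead of 2^i. *)
Lemma bin_fact_le i j n d : (j <= i)%N -> (d <= n + maxn (i - j) j)%N ->
  ('C(i, j) * d`! <= (n + i)`!)%N.
Proof.
have key j' : (j' <= i)%N -> ('C(i, j') * (n + (i - j'))`! <= (n + i)`!)%N.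
  move=> ji; have le : (j' <= n + i)%N by rewrite (leq_trans ji)// leq_addl.
  rewrite -(bin_fact le) addnBA//; apply: leq_mul.
    by apply: leq_bin2l; rewrite leq_addl.
  by rewrite leq_pmull ?fact_gt0.
move=> ji; rewrite addn_maxr leq_max => /orP[] h.
  by apply: leq_trans (key _ ji); rewrite leq_mul2l leq_fact ?orbT.
rewrite -bin_sub//; apply: leq_trans (key (i - j)%N (leq_subr _ _)).
by rewrite leq_mul2l leq_fact ?orbT// subKn.
Qed.

Definition shift i j m : int := m + (i - j)%N%:Z - j%:Z.

Lemma shift_le i j m : (j <= i)%N -> (`|shift i j m|%N <= `|m|%N + maxn (i - j) j)%N.
Proof. by rewrite /shift; lia. Qed.

Lemma shift_le' i j m : (j <= i)%N -> (`|shift i j m|%N <= `|m|%N + i)%N.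
Proof. by rewrite /shift; lia. Qed.

(* The [i]-th derivative of [psi m] at [w] in the direction [v]: each
   differentiation acts as [v] times a decrease of the order minus [v^*] times an
   increase. *)
Definition jet v i m w : R[i] := \sum_(j < i.+1)
  'C(i, j)%:R * (v ^+ j * (- v^*) ^+ (i - j)) * psi (shift i j m) w.

Lemma cderiv_sum n (f : 'I_n -> R -> R[i]) t (d : 'I_n -> R[i]) :
  (forall l, cderiv (f l) t (d l)) ->
  cderiv (fun s => \sum_(l < n) f l s) t (\sum_(l < n) d l).
Proof.
elim: n f d => [|n IH] f d fd.
  under eq_fun => s do rewrite big_ord0.
  by rewrite big_ord0; exact: cderivc.
under eq_fun => s do rewrite big_ord_recr /=.
rewrite big_ord_recr /=; apply: cderivD; last exact: fd.
exact: IH.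
Qed.

Lemma cderiv_jet v i m (w : R -> R[i]) t : cderiv w t v -> 0 < cabs (w t) ->
  cderiv (fun s => jet v i m (w s)) t (jet v i.+1 m (w t)).
Proof.
move=> wv w0; rewrite /jet.
apply: (cderiv_eq (cderiv_sum (fun j : 'I_i.+1 => cderivZ _ (cderiv_psi _ wv w0)))).
pose G j := v ^+ j * (- v^*) ^+ (i.+1 - j) * psi (shift i.+1 j m) (w t).
(* Lowering the order sends the index j to j+1, raising it keeps j; Pascal's rule then recombines
   the two sums. *)
transitivity (\sum_(j < i.+1) 'C(i, j)%:R * G j.+1 + \sum_(j < i.+1) 'C(i, j)%:R * G j).
  rewrite -big_split; apply: eq_bigr => -[j ji] _ /=; rewrite /G.
  have -> : shift i.+1 j.+1 m = shift i j m - 1 by rewrite /shift; lia.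
  have -> : shift i.+1 j m = shift i j m + 1 by rewrite /shift; lia.
  have -> : (i.+1 - j.+1 = i - j)%N by lia.
  have -> : (i.+1 - j = (i - j).+1)%N by lia.
  by rewrite !exprS; ring.
rewrite [RHS](_ : _ = \sum_(j < i.+2) 'C(i.+1, j)%:R * G j); last first.
  by apply: eq_bigr => j _; rewrite /G; ring.
rewrite [RHS]big_ord_recl /= bin0 [X in _ + X]big_ord_recl /= bin0.
rewrite addrC -addrA; congr (_ + _).
have -> : \sum_(j < i) 'C(i, bump 0 j)%:R * G (bump 0 j) =
    \sum_(j < i.+1) 'C(i, j.+1)%:R * G j.+1.
  by rewrite big_ord_recr /= bin_small// mul0r addr0.
rewrite -big_split; apply: eq_bigr => j _ /=.
by rewrite /bump /= add1n binS natrD mulrDl.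
Qed.

Lemma jet_bound C a b v i m w : 0 <= C -> psi_bounded C a b -> a <= cabs w <= b ->
  cabs (jet v i m w) <=
  C * i.+1%:R * (`|m|%N + i)`!%:R * cabs v ^+ i * sig w ^+ (`|m|%N + i).
Proof.
move=> C0 bC wab; apply: le_trans (cabs_sum _ _ _) _.
have -> : C * i.+1%:R * (`|m|%N + i)`!%:R * cabs v ^+ i * sig w ^+ (`|m|%N + i) =
  \sum_(j < i.+1) (C * (`|m|%N + i)`!%:R * cabs v ^+ i * sig w ^+ (`|m|%N + i)).
  by rewrite sumr_const card_ord -mulr_natl; ring.
apply: ler_sum => -[j ji] _ /=; rewrite ltnS in ji.
rewrite !cabsM !cabsX cabsN cabs_conj cabs_nat -exprD subnKC//.
apply: le_trans (ler_wpM2l _ (bC (shift i j m) w wab)) _.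
  by rewrite mulr_ge0// exprn_ge0// cabs_ge0.
have s1 : sig w ^+ `|shift i j m|%N <= sig w ^+ (`|m|%N + i).
  by rewrite ler_weXn2l ?sig_ge1// shift_le'.
have s2 : 'C(i, j)%:R * `|shift i j m|%N`!%:R <= (`|m|%N + i)`!%:R :> R.
  by rewrite -natrM ler_nat (bin_fact_le ji)// shift_le.
have -> : 'C(i, j)%:R * cabs v ^+ i * (C * `|shift i j m|%N`!%:R * sig w ^+ `|shift i j m|%N) =
  C * cabs v ^+ i * (('C(i, j)%:R * `|shift i j m|%N`!%:R) * sig w ^+ `|shift i j m|%N) by ring.
have -> : C * (`|m|%N + i)`!%:R * cabs v ^+ i * sig w ^+ (`|m|%N + i) =
  C * cabs v ^+ i * ((`|m|%N + i)`!%:R * sig w ^+ (`|m|%N + i)) by ring.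
rewrite ler_wpM2l ?mulr_ge0 ?exprn_ge0 ?cabs_ge0// ler_pM ?mulr_ge0//.
by rewrite exprn_ge0 ?(ltW (sig_gt0 w)).
Qed.

End WaveBounds.

(** * Taylor expansion of the waves with remainder *)

Section Taylor.
Variable R : realType.
Implicit Types (a b s t k C B : R) (w v : R[i]) (m : int) (n i j q : nat).

Lemma real_mean (f d : R -> R) B :
  (forall s, 0 <= s <= 1 -> is_derive s 1 f (d s)) ->
  (forall s, 0 <= s <= 1 -> `|d s| <= B) -> `|f 1 - f 0| <= B.
Proof.
move=> fd dB.
have fd' s : s \in `]0, 1[%R -> is_derive s 1 f (d s).
  by rewrite in_itv /= => /andP[s0 s1]; apply: fd; rewrite !ltW.
have cf : {within `[0, 1], continuous f}.
  apply: derivable_within_continuous => s; rewrite in_itv /= => s01.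
  by have [] := fd s s01.
have [c] := MVT_segment (ler01 : (0 : R) <= 1) fd' cf.
by rewrite in_itv /= => /dB dc ->; rewrite subr0 mulr1.
Qed.

Lemma complex_mean (f d : R -> R[i]) B :
  (forall s, 0 <= s <= 1 -> cderiv f s (d s)) ->
  (forall s, 0 <= s <= 1 -> cabs (d s) <= B) -> cabs (f 1 - f 0) <= 2 * B.
Proof.
move=> fd dB; apply: le_trans (cabs_le _) _.
rewrite cReD cImD cReN cImN mulr_natl mulr2n; apply: lerD.
  apply: (@real_mean (fun s => complex.Re (f s)) (fun s => complex.Re (d s))).
    by move=> s /fd [].
  by move=> s /dB; apply: le_trans; exact: normRe_le.
apply: (@real_mean (fun s => complex.Im (f s)) (fun s => complex.Im (d s))).
  by move=> s /fd [].
by move=> s /dB; apply: le_trans; exact: normIm_le.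
Qed.

Lemma jet0 v m w : jet v 0 m w = psi m w.
Proof.
rewrite /jet big_ord_recl big_ord0 addr0 bin0 !expr0 !mul1r.
by rewrite /shift /= subnn addr0 subr0.
Qed.

Definition psi_jet q v m w : R[i] := \sum_(i < q.+1) (i`!%:R^-1)%:C * jet v i m w.

(** The sum runs from the Taylor polynomial at s = 0 to the function itself at s = 1. Its derivative
    telescopes, leaving the top term. *)
Lemma cderiv_remainder q v m (w : R -> R[i]) t :
  cderiv w t v -> 0 < cabs (w t) ->
  cderiv (fun s => \sum_(i < q.+1) ((1 - s) ^+ i / i`!%:R)%:C * jet v i m (w s)) t
    (((1 - t) ^+ q / q`!%:R)%:C * jet v q.+1 m (w t)).
Proof.
move=> wv w0.
have d1 : is_derive t 1 (fun s : R => 1 - s) (- 1).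
  by apply: (is_derive_eq (derB (derc _ _) (is_derive_id _ _))); rewrite sub0r.
have dp n : cderiv (fun s => ((1 - s) ^+ n / n`!%:R)%:C) t
    (n%:R * (1 - t) ^+ n.-1 * -1 * n`!%:R^-1)%:C.
  apply: cderiv_real; apply: (is_derive_eq (derM (derX n d1) (derc _ _))).
  by rewrite mulr0 addr0.
elim: q => [|q IH].
  under eq_fun => s do rewrite big_ord_recl big_ord0 addr0.
  apply: (cderiv_eq (cderivM (dp 0) (cderiv_jet _ _ wv w0))).
  by rewrite !mul0r add0r.
under eq_fun => s do rewrite big_ord_recr /=.
apply: (cderiv_eq (cderivD IH (cderivM (dp q.+1) (cderiv_jet _ _ wv w0)))) => /=.
rewrite addrA -mulrDl -rmorphD /= (_ : _ + _ = 0) ?mul0r ?add0r//.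
rewrite factS natrM; field.
by rewrite nat1r !lt0r_neq0 ?fact_gt0r.
Qed.

Lemma psi_taylor C a b w v m q : 0 <= C -> psi_bounded C a b -> 0 < a ->
  a <= cabs w - cabs v -> cabs w + cabs v <= b ->
  cabs (psi m (w + v) - psi_jet q v m w) <=
  2 * (C * q.+2%:R * ((`|m| + q.+1)`!%:R / q`!%:R) * cabs v *
       Num.max 1 a^-1 ^+ `|m|.+1 * (cabs v * sig w) ^+ q).
Proof.
move=> C0 bC a0 aw wb; set B := (X in _ <= 2 * X).
pose W s := w + s%:C * v.
have dW s : cderiv W s v.
  apply: (cderiv_eq (cderivD (cderivc w s) (cderivM (cderiv_real (is_derive_id s 1)) (cderivc v s)))).
  by rewrite mulr0 addr0 add0r mul1r.
have v0 := cabs_ge0 v.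
have Wlo s : 0 <= s <= 1 -> cabs w - s * cabs v <= cabs (W s).
  move=> /andP[s0 s1]; rewrite lerBlDr.
  have -> : w = W s - s%:C * v by rewrite /W addrK.
  by apply: le_trans (cabsB _ _) _; rewrite cabsM cabs_real (ger0_norm s0).
have Wab s : 0 <= s <= 1 -> a <= cabs (W s) <= b.
  move=> s01; have /andP[s0 s1] := s01.
  have sv : s * cabs v <= cabs v by rewrite ler_piMl.
  apply/andP; split; first by apply: le_trans (Wlo s s01); lra.
  apply: le_trans wb; apply: le_trans (cabsD _ _) _.
  by rewrite lerD2l cabsM cabs_real ger0_norm.
have W0 s : 0 <= s <= 1 -> 0 < cabs (W s).
  by move=> /Wab/andP[h _]; exact: lt_le_trans h.
pose f s := \sum_(i < q.+1) ((1 - s) ^+ i / i`!%:R)%:C * jet v i m (W s).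
have f1 : f 1 = psi m (w + v).
  rewrite /f big_ord_recl /= expr0 fact0 divr1 mul1r jet0 big1 ?addr0.
    by rewrite /W mul1r.
  by move=> i _; rewrite subrr expr0n /= mul0r mul0r.
have f0 : f 0 = psi_jet q v m w.
  rewrite /f /psi_jet; apply: eq_bigr => i _.
  by rewrite subr0 expr1n div1r /W mul0r addr0.
rewrite -f1 -f0.
apply: (@complex_mean _ (fun s => ((1 - s) ^+ q / q`!%:R)%:C * jet v q.+1 m (W s))).
  by move=> s s01; apply: cderiv_remainder; [exact: dW|exact: W0].
move=> s s01; have /andP[s0 s1] := s01.
have s1' : 0 <= 1 - s by lra.
rewrite cabsM cabs_real ger0_norm; last by rewrite divr_ge0// exprn_ge0.
apply: le_trans (ler_wpM2l _ (jet_bound v q.+1 m C0 bC (Wab s s01))) _.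
  by rewrite divr_ge0// exprn_ge0.
have -> : (1 - s) ^+ q / q`!%:R *
   (C * q.+2%:R * (`|m|%N + q.+1)`!%:R * cabs v ^+ q.+1 * sig (W s) ^+ (`|m|%N + q.+1)) =
  C * q.+2%:R * ((`|m|%N + q.+1)`!%:R / q`!%:R) * cabs v *
    (sig (W s) ^+ `|m|%N.+1 * (cabs v * ((1 - s) * sig (W s))) ^+ q).
  by rewrite !exprMn addnS !exprS exprD; ring.
rewrite /B -[leRHS]mulrA; apply: ler_wpM2l.
  by rewrite !mulr_ge0// invr_ge0.
have sg0 := sig_gt0 (W s).
apply: ler_pM.
- by rewrite exprn_ge0// ltW.
- by rewrite exprn_ge0// !mulr_ge0// ltW.
- have M0 : 0 <= Num.max 1 a^-1 by rewrite le_max ler01.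
  rewrite lerXn2r ?nnegrE ?(ltW sg0)//.
  have /andP[aW _] := Wab s s01.
  rewrite /sig ge_max le_max lexx /= le_max; apply/orP; right.
  by rewrite lef_pV2 ?posrE// W0.
(* Since |v| <= |w|, one has (1-s)|w| <= |w| - s|v| <= |w + s v|. The weight 1-s thus compensates
   for the approach to the singularity, and the ratio is the one at the base point w. *)
rewrite lerXn2r ?nnegrE ?mulr_ge0 ?(ltW sg0) ?(ltW (sig_gt0 w))//.
rewrite ler_wpM2l// /sig maxr_pMr// ge_max !le_max; apply/andP; split.
  by rewrite mulr1 lerBlDr lerDl s0.
have w0 : 0 < cabs w by lra.
apply/orP; right; rewrite ler_pdivrMr ?W0// mulrC ler_pdivlMr//.
apply: le_trans (Wlo s s01); rewrite mulrBl mul1r lerD2l lerN2.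
by rewrite ler_wpM2l//; lra.
Qed.

End Taylor.

(** * The Hankel functions of the statement as waves *)

Section HankelWaves.
Variable R : realType.
Implicit Types (k t : R) (x : R * R) (m : int) (n : nat).

Lemma besselJE n t : besselJ n t = (t / 2) ^+ n * besE n ((t / 2) ^+ 2).
Proof.
rewrite /besselJ /besE /psum /pseries -[RHS]/(_ *: limn _).
rewrite -lim_seriesZ; last exact: (@is_cvg_pseries _ _ _ _ (bcoef_bounded R n)).
congr (limn (series _)); apply/funext => p.
rewrite -[RHS]/(_ * (bcoef R n p * _)) -exprM exprD /bcoef; ring.
Qed.

Lemma besselYE n t : 0 < t ->
  besselY n t = (t / 2) ^+ n * (besQ n ((t / 2) ^+ 2) / pi).
Proof.
move=> t0; have s0 : 0 < t / 2 by rewrite divr_gt0.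
rewrite /besselY besselJE /besQ lnXn//.
set s := t / 2 in s0 *.
have -> : limn (series (fun p : nat =>
      (-1) ^+ p / (p`!%:R * (n + p)`!%:R) * s ^+ (n + 2 * p)
        * (harmonic_sum R (p + n) + harmonic_sum R p))) = s ^+ n * besF n (s ^+ 2).
  rewrite /besF /psum /pseries -[RHS]/(_ *: limn _).
  rewrite -lim_seriesZ; last exact: (@is_cvg_pseries _ _ _ _ (fcoef_bounded R n)).
  congr (limn (series _)); apply/funext => p.
  by rewrite -[RHS]/(_ * (fcoef R n p * _)) -exprM exprD /fcoef /bcoef; ring.
have -> : \sum_(p < n) (n - 1 - p)`!%:R / p`!%:R * (2 / t) ^ (n%:Z - (2 * p)%N%:Z) =
    s ^+ n * besP n (s ^+ 2).
  rewrite /besP mulr_sumr; apply: eq_bigr => -[p pn] _ /=.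
  rewrite mulrCA; congr (_ * _).
  have -> : 2 / t = s^-1 by rewrite /s invf_div.
  have sn0 : s != 0 by rewrite lt0r_neq0.
  rewrite exprz_inv opprB expfzDr// -exprnN -exprnP.
  have [d dE nE] : exists2 d, (n - p)%N = d & n = (d + p)%N by exists (n - p)%N; lia.
  rewrite dE nE exprVn -exprM !mul2n -!addnn !exprD; field.
  by rewrite !expf_neq0.
have := lt0r_neq0 (pi_gt0 R); move: (pi : R) => c c0.
by rewrite mulr2n; field.
Qed.

Lemma hankel1E n t : 0 < t ->
  besselJ n t +i* besselY n t = ((t / 2) ^+ n)%:C * cylZ n ((t / 2) ^+ 2).
Proof.
move=> t0; rewrite besselJE besselYE//.
by apply/eqP; rewrite eq_complex /=; apply/andP; split; apply/eqP; ring.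
Qed.

Lemma hankel1_neq0 m t : 0 < t -> hankel1 m t != 0.
Proof.
move=> t0; have s0 : 0 < t / 2 by rewrite divr_gt0.
have key n : besselJ n t +i* besselY n t != 0.
  rewrite hankel1E// mulf_neq0 ?cylZ_neq0 ?exprn_gt0//.
  by rewrite -cabs_eq0 cabs_real normr_eq0 expf_neq0 ?lt0r_neq0.
rewrite /hankel1; case: ifP => _ //; rewrite mulf_neq0// expf_neq0//.
Qed.

Definition toC (x : R * R) : R[i] := x.1 +i* x.2.

Lemma cabs_toC x : cabs (toC x) = enorm x. Proof. by []. Qed.

Lemma hankel1_psi k x m : 0 < k -> 0 < enorm x ->
  hankel1 m (k * enorm x) * cis_angle m x = psi m ((k / 2)%:C * toC x).
Proof.
move=> k0 x0; set r := enorm x in x0 *; pose u : R[i] := (x.1 / r) +i* (x.2 / r).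
have s0 : 0 < k * r / 2 by rewrite divr_gt0 ?mulr_gt0.
have wE : (k / 2)%:C * toC x = (k * r / 2)%:C * u.
  apply/eqP; rewrite eq_complex /= !mul0r !subr0 !addr0; apply/andP.
  by split; apply/eqP; field; rewrite lt0r_neq0.
have cu : cabs u = 1.
  have uE : u = (r^-1)%:C * toC x.
    by apply/eqP; rewrite eq_complex /= !mul0r subr0 addr0 !(mulrC r^-1) !eqxx.
  by rewrite uE cabsM cabs_real cabs_toC ger0_norm ?invr_ge0 ?ltW// mulVf// lt0r_neq0.
have uV : u^-1 = u^*.
  have uu : u * u^* = 1 by rewrite -sqr_cabsE cu expr1n.
  have u0 : u != 0 by rewrite -cabs_eq0 cu oner_eq0.
  by apply: (mulfI u0); rewrite divff.
have cw : cabs ((k * r / 2)%:C * u) = k * r / 2.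
  by rewrite cabsM cabs_real cu mulr1 gtr0_norm.
rewrite wE /cis_angle -/r -/u; case: m => n; rewrite /psi /hankel1 cw.
  rewrite ltNge lez_nat leq0n /= hankel1E ?mulr_gt0//; move: (k * r / 2) => s.
  by rewrite exprMn (rmorphXn (real_complex R)) /= -exprnP; ring.
have -> : (Negz n < 0) = true by [].
have -> : `|Negz n|%N = n.+1 by [].
rewrite hankel1E ?mulr_gt0//; move: (k * r / 2) => s.
have -> : u ^ Negz n = u^* ^+ n.+1 by rewrite NegzE -exprnN -exprVn uV.
have -> : - (s%:C * u)^* = s%:C * (-1 * u^*).
  by rewrite rmorphM mulN1r mulrN; congr (- (_ * _)); exact: conjc_real.
by rewrite !exprMn (rmorphXn (real_complex R)); ring.
Qed.

End HankelWaves.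

(** * Recentring of waves with controlled error and coefficients *)

Section SourceMoving.
Variables (R : realType) (k sgm : R) (X : set (R * R)).
Implicit Types (x y : R * R) (g : R * R -> R[i]) (s : seq (R[i] * int)).
Implicit Types (v w : R[i]) (m : int) (N n q J : nat).

Definition scal x : R[i] := (k / 2)%:C * toC x.

Lemma scalB x y : scal (x - y) = scal x - scal y.
Proof. by rewrite /scal -mulrBr. Qed.

(** Division by the growth in the order makes l^1 norms of coefficients comparable across orders.
    Along the path [sgm] will dominate [sig]. *)
Definition psih m w : R[i] := (`|m|%N`!%:R * sgm ^+ `|m|%N)^-1%:C * psi m w.

(** An order may occur several times in the list, so that adding approximations is concatenation;
    equal orders are collected only at the end. *)
Definition wave_sum s x : R[i] := \sum_(p <- s) p.1 * psih p.2 (scal x).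

(* [g] is approximated on [X] within [e] by waves of order at most [N] centred at
   the origin, with coefficients of l^1 norm at most [L]. *)
Definition apx N (L e : R) g := exists s,
  [/\ all (fun p => `|p.2| <= N)%N s, \sum_(p <- s) cabs p.1 <= L &
      forall x, X x -> cabs (g x - wave_sum s x) <= e].

Lemma apx_mono N N' (L L' e e' : R) g : apx N L e g ->
  (N <= N')%N -> L <= L' -> e <= e' -> apx N' L' e' g.
Proof.
move=> [s [sN sL se]] NN LL ee; exists s; split.
- by apply: sub_all sN => p; move/leq_trans; apply.
- exact: le_trans LL.
- by move=> x /se; move/le_trans; apply.
Qed.

Lemma apx_near N (L e d : R) g g' : apx N L e g ->
  (forall x, X x -> cabs (g' x - g x) <= d) -> apx N L (d + e) g'.
Proof.
move=> [s [sN sL se]] gd; exists s; split => // x Xx.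
rewrite -(subrKA (g x)); apply: le_trans (cabsD _ _) _.
by rewrite lerD ?gd ?se.
Qed.

Lemma apx_ext N (L e : R) g g' : apx N L e g ->
  (forall x, X x -> g' x = g x) -> apx N L e g'.
Proof.
move=> h gg; rewrite -[e]add0r; apply: apx_near h _ => x Xx.
by rewrite gg// subrr cabs0.
Qed.

Lemma apxZ N (L e : R) g (c : R[i]) : apx N L e g ->
  apx N (cabs c * L) (cabs c * e) (fun x => c * g x).
Proof.
move=> [s [sN sL se]]; exists [seq (c * p.1, p.2) | p <- s]; split.
- by rewrite all_map.
- rewrite big_map; under eq_bigr => p _ do rewrite cabsM.
  by rewrite -mulr_sumr ler_wpM2l// cabs_ge0.
- move=> x Xx; rewrite /wave_sum big_map.
  under eq_bigr => p _ do rewrite -mulrA.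
  by rewrite -mulr_sumr -mulrBr cabsM ler_wpM2l ?cabs_ge0// se.
Qed.

Lemma apx0 N : apx N 0 0 (fun=> 0).
Proof.
exists [::]; split => //; first by rewrite big_nil.
by move=> x _; rewrite /wave_sum big_nil subrr cabs0.
Qed.

Lemma apxD N (L e L' e' : R) g g' : apx N L e g -> apx N L' e' g' ->
  apx N (L + L') (e + e') (fun x => g x + g' x).
Proof.
move=> [s [sN sL se]] [s' [sN' sL' se']]; exists (s ++ s'); split.
- by rewrite all_cat sN.
- by rewrite big_cat lerD.
- move=> x Xx; rewrite /wave_sum big_cat /= opprD addrACA.
  by rewrite (le_trans (cabsD _ _))// lerD ?se ?se'.
Qed.

Lemma apx_sum (I : Type) (r : seq I) (P : pred I) N (L e : I -> R) (g : I -> R * R -> R[i]) :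
  (forall i, P i -> apx N (L i) (e i) (g i)) ->
  apx N (\sum_(i <- r | P i) L i) (\sum_(i <- r | P i) e i)
    (fun x => \sum_(i <- r | P i) g i x).
Proof.
move=> h; elim: r => [|i r IH].
  rewrite !big_nil; apply: apx_ext (apx0 N) _ => x _; by rewrite big_nil.
rewrite !big_cons; case: ifP => Pi.
  by apply: apx_ext (apxD (h i Pi) IH) _ => x _; rewrite big_cons Pi.
by apply: apx_ext IH _ => x _; rewrite big_cons Pi.
Qed.

Hypothesis sgm1 : 1 <= sgm.
Let sgm0 : 0 < sgm. Proof. exact: lt_le_trans sgm1. Qed.

Lemma psihE m w : psi m w = (`|m|%N`!%:R * sgm ^+ `|m|%N)%:C * psih m w.
Proof.
rewrite /psih mulrA -rmorphM mulfV ?mul1r//.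
by rewrite mulf_neq0 ?expf_neq0 ?lt0r_neq0 ?fact_gt0r.
Qed.

Lemma fact_add_le n i : ((n + i)`! <= 2 ^ (n + i) * (n`! * i`!))%N.
Proof.
have h : (i <= n + i)%N by rewrite leq_addl.
rewrite -(bin_fact h) addnK [(i`! * _)%N]mulnC leq_mul2r.
apply/orP; right; rewrite (expnDn 1 1) (bigD1 (inord i)) //= inordK//.
by rewrite !exp1n !muln1 leq_addr.
Qed.

(* The coefficients of a Taylor polynomial in the source position, with the
   displacement [v] replaced by a bound [V] on its modulus. *)
Lemma apx_jet (V I : R) (c : nat -> nat -> R[i]) (w : R * R -> R[i]) m n q N (L e : R) :
  0 <= V -> 0 <= I -> 0 <= L -> 0 <= e ->
  (forall i j, (j <= i <= q)%N -> cabs (c i j) <= I * ('C(i, j)%:R * V ^+ i / i`!%:R)) ->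
  (`|m| <= n)%N ->
  (forall m', (`|m'| <= n + q)%N -> apx N L e (fun x => psih m' (w x))) ->
  let T := I * (`|m|%N`!%:R * sgm ^+ `|m|%N) * 2 ^+ n *
           \sum_(i < q.+1) (4 * V * sgm) ^+ i in
  apx N (T * L) (T * e)
    (fun x => \sum_(i < q.+1) \sum_(j < i.+1) c i j * psi (shift i j m) (w x)).
Proof.
move=> V0 I0 L0 e0 cb mn h; cbv zeta.
set A := I * (`|m|%N`!%:R * sgm ^+ `|m|%N).
have A0 : 0 <= A by rewrite !mulr_ge0// exprn_ge0// ltW.
(* C(i,j) |m'|! <= (|m|+i)! <= 2^(n+i) |m|! i!, so the division by i! leaves 2^n 2^i. The i+1 values
   of j cost another 2^i, whence the ratio 4 V sgm. *)
pose u i : R := A * 2 ^+ n * (2 * V * sgm) ^+ i.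
have V2 : 0 <= 2 * V * sgm by rewrite mulr_ge0 ?mulr_ge0// ltW.
have p0 : 0 <= 2 ^+ n :> R by exact: exprn_ge0.
have u0 i : 0 <= u i by exact: mulr_ge0 (mulr_ge0 A0 p0) (exprn_ge0 i V2).
have ub i : i.+1%:R * u i <= A * 2 ^+ n * (4 * V * sgm) ^+ i.
  rewrite /u mulrCA ler_wpM2l//; first exact: mulr_ge0.
  rewrite (_ : 4 * V * sgm = 2 * (2 * V * sgm)); last by ring.
  rewrite [leRHS]exprMn ler_wpM2r ?exprn_ge0//.
  by rewrite -natrX ler_nat ltn_expl.
have term i (j : 'I_i.+1) : (i < q.+1)%N ->
    apx N (u i * L) (u i * e) (fun x => c i j * psi (shift i j m) (w x)).
  move=> iq; have ji : (j <= i)%N by rewrite -ltnS.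
  set m' := shift i j m; have m'le : (`|m'| <= `|m| + i)%N by exact: shift_le'.
  have hm' : (`|m'| <= n + q)%N by rewrite (leq_trans m'le)// leq_add.
  have := apxZ (c i j * (`|m'|%N`!%:R * sgm ^+ `|m'|%N)%:C) (h m' hm').
  set B := cabs _; move=> hB.
  have Bu : B <= u i.
    rewrite /B cabsM cabs_real ger0_norm; last by rewrite mulr_ge0// exprn_ge0// ltW.
    apply: le_trans (ler_wpM2r _ (cb i j _)) _.
    - by rewrite mulr_ge0// exprn_ge0// ltW.
    - by rewrite ji -ltnS.
    have f1 : 'C(i, j)%:R * `|m'|%N`!%:R <= (2 ^+ n * 2 ^+ i) * (`|m|%N`!%:R * i`!%:R) :> R.
      apply: (@le_trans _ _ (2 ^+ (`|m|%N + i) * (`|m|%N`!%:R * i`!%:R))).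
        rewrite -natrX -!natrM ler_nat; apply: leq_trans (fact_add_le _ _).
        by apply: bin_fact_le => //; exact: shift_le.
      rewrite -exprD ler_wpM2r ?mulr_ge0// ler_weXn2l ?ler1n// leq_add2r//.
    have f2 : sgm ^+ `|m'|%N <= sgm ^+ `|m|%N * sgm ^+ i.
      by rewrite -exprD ler_weXn2l.
    rewrite [leLHS](_ : _ = I * V ^+ i / i`!%:R * (('C(i, j)%:R * `|m'|%N`!%:R) * sgm ^+ `|m'|%N)); last by ring.
    apply: (@le_trans _ _ (I * V ^+ i / i`!%:R * (((2 ^+ n * 2 ^+ i) * (`|m|%N`!%:R * i`!%:R)) * (sgm ^+ `|m|%N * sgm ^+ i)))).
      rewrite ler_wpM2l ?divr_ge0 ?mulr_ge0 ?exprn_ge0//.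
      by rewrite ler_pM ?mulr_ge0 ?exprn_ge0 ?(ltW sgm0).
    apply: eqle; rewrite /u /A !exprMn; field.
    by rewrite lt0r_neq0 ?fact_gt0r.
  apply: (apx_mono (apx_ext hB _) (leqnn _)).
  - by move=> x Xx; rewrite psihE mulrA.
  - by rewrite ler_wpM2r.
  - by rewrite ler_wpM2r.
apply: (apx_mono (apx_sum (index_enum _) (fun i : 'I_q.+1 => fun _ => apx_sum (index_enum _) (fun (j : 'I_i.+1) _ => term i j (ltn_ord i)))) (leqnn _)).
  rewrite mulr_sumr mulr_suml; apply: ler_sum => i _.
  by rewrite sumr_const card_ord -(mulr_natl (u i * L)) mulrA ler_wpM2r.
rewrite mulr_sumr mulr_suml; apply: ler_sum => i _.
by rewrite sumr_const card_ord -(mulr_natl (u i * e)) mulrA ler_wpM2r.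
Qed.

(* The waves centred at [y] can be recentred at the origin in [J] steps, each of
   which doubles the order of the expansion. *)
Definition good (K : R) J y := forall q m, (`|m| <= q)%N ->
  apx (2 ^ J * q) (K * 3 ^+ J * 2 ^+ ((2 ^ J).-1 * q)) (K * 3 ^+ J * 4^-1 ^+ q)
    (fun x => psih m (scal x - scal y)).

Lemma good0 (K : R) : 1 <= K -> good K 0 (0, 0).
Proof.
move=> K1 q m mq; exists [:: (1, m)]; split.
- by rewrite /= andbT mul1n.
- by rewrite big_cons big_nil cabs1 expn0 mul0n expr0 !mulr1 addr0.
move=> x _; rewrite /wave_sum big_cons big_nil addr0 mul1r.
rewrite (_ : scal (0, 0) = 0) ?subr0; last by rewrite /scal /toC /= mulr0.
by rewrite subrr cabs0 !mulr_ge0 ?exprn_ge0// (le_trans ler01).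
Qed.

(** The Taylor polynomial about y' has orders up to 2q and coefficients of size 2 * 2^q. Applying
    [good] at y' with 2q in place of q, the error 4^-(2q) absorbs this growth, and the exponents add
    up since 1 + 2 (2^J - 1) = 2^(J+1) - 1. The Taylor remainder and the error from y' together
    account for the factor 3 = 1 + 2. *)
Lemma good_step (C a b K : R) J y y' : 0 < a -> sgm = Num.max 1 a^-1 ->
  0 <= C -> psi_bounded C a b -> C <= K -> 1 <= K ->
  let v := scal y' - scal y in
  cabs v * sgm <= 64^-1 ->
  (forall x, X x -> a <= cabs (scal x - scal y') - cabs v /\
                    cabs (scal x - scal y') + cabs v <= b) ->
  good K J y' -> good K J.+1 y.
Proof.
move=> a0 sE C0 bC CK K1 v vs hX gy q m mq.
pose w x := scal x - scal y'.
have wv x : scal x - scal y = w x + v by rewrite /w /v subrKA.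
have v0 := cabs_ge0 v.
have K0 : 0 <= K by exact: le_trans ler01 K1.
pose f : R := (`|m|%N`!%:R * sgm ^+ `|m|%N)^-1.
have f0 : 0 < f by rewrite invr_gt0 mulr_gt0 ?fact_gt0r ?exprn_gt0.
set A := K * 3 ^+ J.
have A0 : 0 <= A by rewrite mulr_ge0// exprn_ge0.
have jetE x : f%:C * psi_jet q v m (w x) =
    \sum_(i < q.+1) \sum_(j < i.+1)
      f%:C * (i`!%:R^-1)%:C * ('C(i, j)%:R * (v ^+ j * (- v^*) ^+ (i - j))) * psi (shift i j m) (w x).
  rewrite /psi_jet /jet mulr_sumr; apply: eq_bigr => i _.
  by rewrite mulrA mulr_sumr; apply: eq_bigr => j _; rewrite mulrA.
have step1 : apx (2 ^ J.+1 * q) (A * 2 * 2 ^+ q * 2 ^+ ((2 ^ J).-1 * (q + q)))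
    (A * 2 * 2 ^+ q * 4^-1 ^+ (q + q)) (fun x => f%:C * psi_jet q v m (w x)).
  have e0 : 0 <= A * 4^-1 ^+ (q + q) by rewrite mulr_ge0// exprn_ge0.
  have L0 : 0 <= A * 2 ^+ ((2 ^ J).-1 * (q + q)) by rewrite mulr_ge0// exprn_ge0.
  have hc i j : (j <= i <= q)%N ->
      cabs (f%:C * (i`!%:R^-1)%:C * ('C(i, j)%:R * (v ^+ j * (- v^*) ^+ (i - j)))) <=
      f * ('C(i, j)%:R * cabs v ^+ i / i`!%:R).
    move=> /andP[ji _]; rewrite !cabsM !cabs_real cabs_nat !cabsX cabsN cabs_conj.
    rewrite -exprD subnKC// (gtr0_norm f0) ger0_norm ?invr_ge0//.
    by apply: eqle; ring.
  have hg m' : (`|m'| <= q + q)%N ->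
      apx (2 ^ J.+1 * q) (A * 2 ^+ ((2 ^ J).-1 * (q + q))) (A * 4^-1 ^+ (q + q))
       (fun x => psih m' (w x)).
    have -> : (2 ^ J.+1 * q = 2 ^ J * (q + q))%N.
      by rewrite expnS [(2 * _)%N]mulnC -mulnA mul2n addnn.
    exact: gy.
  have := apx_jet v0 (ltW f0) L0 e0 hc mq hg; cbv zeta.
  set T := (X in X * _) => h.
  have fE : f * (`|m|%N`!%:R * sgm ^+ `|m|%N) = 1.
    by rewrite /f mulVf// mulf_neq0 ?expf_neq0 ?lt0r_neq0 ?fact_gt0r.
  have geo : \sum_(i < q.+1) (4 * cabs v * sgm) ^+ i <= 2.
    have g0 : 0 <= 4 * cabs v * sgm by rewrite !mulr_ge0// ltW.
    have g1 : 4 * cabs v * sgm <= 2^-1 by rewrite -mulrA; lra.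
    have : forall n, \sum_(i < n) (4 * cabs v * sgm) ^+ i <= 2 - 2 * 2^-1 ^+ n.
      elim=> [|n IH]; first by rewrite big_ord0 expr0; lra.
      rewrite big_ord_recr /=; have : (4 * cabs v * sgm) ^+ n <= 2^-1 ^+ n.
        by rewrite lerXn2r ?nnegrE.
      by rewrite exprS; lra.
    move=> /(_ q.+1) h2; apply: le_trans h2 _.
    by rewrite gerBl mulr_ge0// exprn_ge0.
  have T2 : T <= 2 * 2 ^+ q.
    by rewrite /T fE mul1r mulrC ler_wpM2r ?exprn_ge0.
  have jetE' x : X x -> f%:C * psi_jet q v m (w x) =
    \sum_(i < q.+1) \sum_(j < i.+1)
      f%:C * (i`!%:R^-1)%:C * ('C(i, j)%:R * (v ^+ j * (- v^*) ^+ (i - j))) * psi (shift i j m) (w x).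
    by move=> _; exact: jetE.
  apply: (apx_mono (apx_ext h jetE') (leqnn _)).
    apply: le_trans (ler_wpM2r L0 T2) _; apply: eqle; ring.
  by apply: le_trans (ler_wpM2r e0 T2) _; apply: eqle; ring.
have tay x : X x -> cabs (psih m (scal x - scal y) - f%:C * psi_jet q v m (w x)) <= K * 4^-1 ^+ q.
  move=> Xx; have [aw wb] := hX x Xx.
  rewrite wv /psih -mulrBr cabsM cabs_real (gtr0_norm f0).
  apply: le_trans (ler_wpM2l (ltW f0) (psi_taylor m q C0 bC a0 aw wb)) _.
  rewrite -sE; set F := (_ + _)`!%:R / _.
  have Fb : F <= 4 ^+ q * 2 * (q.+1%:R * `|m|%N`!%:R).
    rewrite /F ler_pdivrMr ?fact_gt0r//.
    apply: (@le_trans _ _ (2 ^+ (`|m|%N + q.+1) * (`|m|%N`!%:R * q.+1`!%:R))).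
      by rewrite -natrX -!natrM ler_nat fact_add_le.
    apply: (@le_trans _ _ (2 ^+ (q + q.+1) * (`|m|%N`!%:R * q.+1`!%:R))).
      by rewrite ler_wpM2r ?mulr_ge0// ler_weXn2l ?ler1n// leq_add2r.
    have -> : 2 ^+ (q + q.+1) = 4 ^+ q * 2 :> R.
      by rewrite addnS exprSr exprD -exprMn; congr (_ ^+ _ * _); ring.
    by rewrite factS natrM; apply: eqle; ring.
  have sw : cabs v * sig (w x) <= 64^-1.
    apply: le_trans vs; rewrite ler_wpM2l// sE /sig ge_max !le_max lexx /=.
    have aw' : a <= cabs (w x) by apply: le_trans aw _; rewrite lerBlDr lerDl.
    by rewrite lef_pV2 ?posrE ?aw' ?orbT// (lt_le_trans a0 aw').
  have swq : (cabs v * sig (w x)) ^+ q <= 64^-1 ^+ q.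
    by rewrite lerXn2r ?nnegrE ?mulr_ge0 ?(ltW (sig_gt0 _)).
  have q1 : q.+1%:R <= 2 ^+ q :> R by rewrite -natrX ler_nat ltn_expl.
  have q2 : q.+2%:R <= 2 * 2 ^+ q :> R.
    by rewrite -exprS -natrX ler_nat ltn_expl.
  have q0 : 0 <= (2 : R) ^+ q by exact: exprn_ge0.
  have sm0 : 0 < sgm ^+ `|m|%N by exact: exprn_gt0.
  have mf0 := fact_gt0r R `|m|%N.
  have F1 : F <= 4 ^+ q * 2 * (2 ^+ q * `|m|%N`!%:R).
    apply: le_trans Fb _; rewrite ler_wpM2l ?mulr_ge0 ?exprn_ge0//.
    by rewrite ler_wpM2r// ltW.
  have F0 : 0 <= F by rewrite divr_ge0.
  apply: (@le_trans _ _ (f * (2 * (C * (2 * 2 ^+ q) * (4 ^+ q * 2 * (2 ^+ q * `|m|%N`!%:R)) * (cabs v) * (sgm * sgm ^+ `|m|%N) * 64^-1 ^+ q)))).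
    rewrite ler_wpM2l ?(ltW f0)// ler_wpM2l// exprS.
    apply: ler_pM => //; rewrite ?exprn_ge0 ?mulr_ge0 ?(ltW (sig_gt0 _)) ?(ltW sgm0) ?(ltW sm0)//.
    rewrite ler_wpM2r ?mulr_ge0 ?(ltW sgm0) ?(ltW sm0)// ler_wpM2r//.
    by rewrite ler_pM ?mulr_ge0// ler_wpM2l.
  rewrite (_ : f * _ = C * 8 * (cabs v * sgm) * (2 ^+ q * 2 ^+ q * 4 ^+ q * 64^-1 ^+ q)); last first.
    by rewrite /f; field; rewrite !lt0r_neq0.
  (* Origin of 64: the factors q+2, q+1 and (|m|+q+1)!/q! cost 16^q in all, and 16/64 is the decay
     rate demanded by [good]. *)
  rewrite -!exprMn (_ : 2 * 2 * 4 / 64 = 4^-1 :> R); last by field.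
  rewrite ler_wpM2r ?exprn_ge0//; apply: le_trans CK.
  by rewrite -mulrA ler_piMr//; lra.
apply: (apx_mono (apx_near step1 tay) (leqnn _)).
  rewrite exprS (_ : _ * (3 * 3 ^+ J) = A * 3); last by rewrite /A; ring.
  have -> : 2 ^+ ((2 ^ J.+1).-1 * q) = 2 ^+ q * 2 ^+ ((2 ^ J).-1 * (q + q)) :> R.
    rewrite -exprD; congr (_ ^+ _).
    have : (0 < 2 ^ J)%N by rewrite expn_gt0.
    rewrite expnS; case: (2 ^ J)%N => // p _; lia.
  rewrite mulrA ler_wpM2r ?exprn_ge0// ler_wpM2r ?exprn_ge0//.
  by rewrite ler_wpM2l// ler_nat.
have t1 : 1 <= 3 ^+ J :> R by rewrite exprn_ege1// ler1n.
have A1 : K <= A by rewrite /A ler_peMr.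
rewrite exprS (_ : _ * (3 * 3 ^+ J) = A + A * 2); last by rewrite /A; ring.
rewrite mulrDl lerD// ?ler_wpM2r ?exprn_ge0//.
rewrite -mulrA ler_wpM2l ?mulr_ge0// exprD mulrA ler_piMl ?exprn_ge0//.
by rewrite -exprMn exprn_ile1 ?mulr_ge0 ?invr_ge0//; lra.
Qed.

End SourceMoving.

(** * The Euclidean norm of the plane *)

Section EuclideanNorm.
Variable R : realType.
Implicit Types (x y p : R * R) (t : R).

Lemma toCD x y : toC (x + y) = toC x + toC y. Proof. by []. Qed.
Lemma toCN x : toC (- x) = - toC x. Proof. by []. Qed.
Lemma toCZ t x : toC (t *: x) = t%:C * toC x.
Proof. by rewrite /toC; apply/eqP; rewrite eq_complex /= !mul0r subr0 addr0 !eqxx. Qed.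

Lemma enorm_ge0 x : 0 <= enorm x. Proof. exact: sqrtr_ge0. Qed.
Lemma enormD x y : enorm (x + y) <= enorm x + enorm y.
Proof. by rewrite -!cabs_toC toCD cabsD. Qed.
Lemma enormN x : enorm (- x) = enorm x.
Proof. by rewrite -!cabs_toC toCN cabsN. Qed.
Lemma enormB x y : enorm (x - y) = enorm (y - x).
Proof. by rewrite -enormN opprB. Qed.
Lemma enormZ t x : enorm (t *: x) = `|t| * enorm x.
Proof. by rewrite -!cabs_toC toCZ cabsM cabs_real. Qed.
Lemma enorm0 : enorm (0 : R * R) = 0.
Proof. by rewrite -cabs_toC (_ : toC 0 = 0) ?cabs0. Qed.
Lemma enorm_eq0 x : (enorm x == 0) = (x == 0).
Proof.
rewrite -cabs_toC cabs_eq0; case: x => a b.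
by rewrite /toC eq_complex.
Qed.
Lemma sqr_enorm x : enorm x ^+ 2 = x.1 ^+ 2 + x.2 ^+ 2.
Proof. by rewrite sqr_sqrtr// addr_ge0// sqr_ge0. Qed.
Lemma enorm_le x : enorm x <= `|x.1| + `|x.2|.
Proof. exact: (cabs_le (toC x)). Qed.
Lemma norm1_le x : `|x.1| <= enorm x. Proof. exact: (normRe_le (toC x)). Qed.
Lemma norm2_le x : `|x.2| <= enorm x. Proof. exact: (normIm_le (toC x)). Qed.

Lemma cabs_scal (k : R) x y : 0 < k ->
  cabs (scal k x - scal k y) = k / 2 * enorm (x - y).
Proof.
move=> k0; rewrite -scalB /scal cabsM cabs_real cabs_toC ger0_norm//.
by rewrite divr_ge0// ltW.
Qed.

End EuclideanNorm.

(** * Moving a centre along a segment *)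

Section Path.
Variables (R : realType) (k sgm r1 eta D C b K : R) (X : set (R * R)).
Hypotheses (k0 : 0 < k) (r10 : 0 < r1) (sgmE : sgm = Num.max 1 (k * r1 / 4)^-1).
Hypotheses (C0 : 0 <= C) (bC : psi_bounded C (k * r1 / 4) b) (CK : C <= K) (K1 : 1 <= K).
Hypotheses (eta_r1 : eta <= r1 / 2) (eta_sgm : k / 2 * eta * sgm <= 64^-1).
Hypothesis Db : k / 2 * (D + eta) <= b.

(** The segment is cut into n moves of length at most eta. As eta <= r1/2, each move keeps the
    scaled distance to X above k/2 (r1 - eta) >= k r1/4, the inner radius for which [sgm] is
    defined. *)
Lemma good_segment (y0 y1 : R * R) J n : (0 < n)%N -> enorm (y1 - y0) <= eta * n%:R ->
  (forall (t : R) x, 0 <= t <= 1 -> X x -> r1 <= enorm (x - (y0 + t *: (y1 - y0))) <= D) ->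
  good k sgm X K J y0 -> good k sgm X K (J + n) y1.
Proof.
move=> n0 y01 hX gy0.
have sgm1 : 1 <= sgm by rewrite sgmE le_max lexx.
have nR : 0 < n%:R :> R by rewrite ltr0n.
pose y i : R * R := y0 + (i%:R / n%:R) *: (y1 - y0).
suff h i : (i <= n)%N -> good k sgm X K (J + i) (y i).
  have -> : y1 = y n by rewrite /y divff ?lt0r_neq0// scale1r addrC subrK.
  exact: h.
elim: i => [_|i IH i1n]; first by rewrite addn0 /y mul0r scale0r addr0.
have a0 : 0 < k * r1 / 4 by rewrite divr_gt0// mulr_gt0.
have st : enorm (y i - y i.+1) <= eta.
  rewrite (_ : y i - y i.+1 = (- n%:R^-1) *: (y1 - y0)); last first.
    rewrite /y opprD addrACA subrr add0r -scalerBl; congr (_ *: _).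
    by rewrite -mulrBl -[i.+1%:R]natr1 opprD addrA subrr sub0r mulN1r.
  rewrite enormZ normrN ger0_norm ?invr_ge0// mulrC ler_pdivrMr//.
have vE : cabs (scal k (y i) - scal k (y i.+1)) <= k / 2 * eta.
  by rewrite cabs_scal// ler_wpM2l// divr_ge0// ltW.
rewrite addnS; apply: (good_step sgm1 a0 sgmE C0 bC CK K1 (y' := y i)) (IH (ltnW i1n)).
  by apply: le_trans eta_sgm; rewrite ler_wpM2r// (le_trans ler01).
move=> x Xx.
have t01 : 0 <= (i%:R : R) / n%:R <= 1.
  by rewrite divr_ge0//= ler_pdivrMr// mul1r ler_nat ltnW.
have := hX _ x t01 Xx; rewrite -/(y i) => /andP[lo hi].
have k2 : 0 <= k / 2 by rewrite divr_ge0// ltW.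
have := ler_wpM2l k2 lo; have := ler_wpM2l k2 hi; have := ler_wpM2l k2 eta_r1.
rewrite (cabs_scal x)// => h1 h2 h3; split.
  rewrite lerBrDr; apply: le_trans (lerD (lexx _) vE) _; apply: le_trans h3.
  by apply: le_trans (lerD (lexx _) h1) _; apply: eqle; field.
by apply: le_trans Db; rewrite mulrDr lerD.
Qed.

End Path.

(** * Bounds for smooth functions of one variable *)

Section SmoothFunctions.
Variable R : realType.
Implicit Types (f : R -> R) (a b s t : R).

Lemma smooth_is_derive f n t : smooth_fun f ->
  is_derive t 1 (derive1n n f) (derive1n n.+1 f t).
Proof. by move=> sf; rewrite derive1nS derive1E; apply/derivableP/sf. Qed.

Lemma is_derive_continuous f (f1 : R -> R) : (forall t, is_derive t 1 f (f1 t)) -> continuous f.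
Proof.
by move=> fd t; apply/differentiable_continuous/derivable1_diffP; have [] := fd t.
Qed.

Lemma smooth_continuous f n : smooth_fun f -> continuous (derive1n n f).
Proof.
by move=> sf; apply: is_derive_continuous => t; exact: smooth_is_derive.
Qed.

Lemma continuous_bounded_itv f a b : continuous f ->
  exists2 B : R, 0 <= B & forall t, a <= t <= b -> `|f t| <= B.
Proof.
move=> cf; have [ab|ba] := leP a b; last first.
  by exists 0 => // t /andP[ta tb]; have := le_trans ta tb; rewrite leNgt ba.
have cn : {within `[a, b], continuous (fun t => `|f t|)}.
  by apply: continuous_subspaceT => t; apply: continuous_comp (cf t) _; exact: norm_continuous.
have [c cab cM] := EVT_max ab cn.
by exists `|f c| => // t tab; apply: cM; rewrite in_itv.
Qed.

Lemma compact_pos_min (T : topologicalType) (f : T -> R) (A : set T) :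
  compact A -> continuous f -> (forall x, A x -> 0 < f x) ->
  exists2 c : R, 0 < c & forall x, A x -> c <= f x.
Proof.
move=> cA cf fA; have [A0|A0] := pselect (A !=set0); last first.
  by exists 1 => // x Ax; exfalso; apply: A0; exists x.
have [c] := compact_EVT_min A0 cA (continuous_subspaceT cf).
rewrite inE => Ac cm; exists (f c); first exact: fA.
by move=> x Ax; apply: cm; rewrite inE.
Qed.

Lemma taylor2 f (f1 f2 : R -> R) a b (L : R) s t : (forall t, is_derive t 1 f (f1 t)) ->
  (forall t, is_derive t 1 f1 (f2 t)) -> (forall t, a <= t <= b -> `|f2 t| <= L) ->
  a <= s <= b -> a <= t <= b -> `|f s - f t - (s - t) * f1 t| <= L * (s - t) ^+ 2.
Proof.
move=> fd f1d f2L /andP[as_ sb] /andP[at_ tb].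
pose d := s - t.
have line (u : R) : 0 <= u <= 1 -> a <= t + u * d <= b.
  move=> /andP[u0 u1]; rewrite /d; have -> : t + u * (s - t) = (1 - u) * t + u * s by ring.
  have h1 := ler_wpM2l u0 as_; have h2 := ler_wpM2l u0 sb.
  have v0 : 0 <= 1 - u by lra.
  have h3 := ler_wpM2l v0 at_; have h4 := ler_wpM2l v0 tb; lra.
have dl (u : R) : is_derive u 1 (fun u : R => t + u * d) d.
  apply: (is_derive_eq (derD (derc _ t) (derM (is_derive_id u (1 : R)) (derc _ d)))).
  by rewrite mulr0 addr0 mul1r add0r.
have f1L (u : R) : 0 <= u <= 1 -> `|f1 (t + u * d) - f1 t| <= L * `|d|.
  move=> u01; have /andP[u0 u1] := u01.
  have := @real_mean _ (fun w => f1 (t + (w * u) * d)) (fun w => f2 (t + (w * u) * d) * (u * d)) (L * `|d|).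
  rewrite mul1r mul0r mul0r addr0; apply.
    move=> w w01; apply: (@is_derive1_comp _ f1 (fun w => t + (w * u) * d)).
    apply: (is_derive_eq (derD (derc _ t) (derM (derM (is_derive_id w (1 : R)) (derc _ u)) (derc _ d)))).
    by rewrite !mulr0 !addr0 mul1r add0r.
  move=> w /andP[w0 w1]; rewrite normrM ler_pM//.
    apply: f2L; apply: line; rewrite mulr_ge0//=.
    by rewrite -[leRHS]mulr1 ler_pM.
  by rewrite normrM ger0_norm// ler_piMl.
have := @real_mean _ (fun u => f (t + u * d) - u * (d * f1 t)) (fun u => (f1 (t + u * d) - f1 t) * d) (L * d ^+ 2).
rewrite mul1r mul0r mul0r addr0 subr0 mul1r {1}/d (addrC t) subrK => h.
rewrite -/d addrAC; apply: h.
  move=> u u01; apply: (is_derive_eq (derB (@is_derive1_comp _ f (fun u => t + u * d) u _ _ (fd _) (dl u)) (derM (is_derive_id u (1 : R)) (derc _ (d * f1 t))))).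
  by rewrite mulr0 addr0 mul1r; ring.
move=> u /f1L hu; rewrite normrM.
apply: le_trans (ler_wpM2r (normr_ge0 d) hu) _.
by rewrite -mulrA -expr2 real_normK ?num_real.
Qed.

End SmoothFunctions.

(** * Smooth curves and the chord bound *)

Section Curves.
Variable R : realType.
Implicit Types (g h : R -> R * R) (s t a b c : R) (x y z : R * R).

Definition smooth_curve g := smooth_fun (xcoord g) /\ smooth_fun (ycoord g).

Definition vel g t : R * R := (derive1 (xcoord g) t, derive1 (ycoord g) t).

Definition cross x y : R := x.1 * y.2 - x.2 * y.1.

Lemma cross_le x y : `|cross x y| <= enorm x * (`|y.1| + `|y.2|).
Proof.
rewrite /cross; apply: le_trans (ler_normB _ _) _; rewrite !normrM mulrDr addrC.
by rewrite lerD// ler_wpM2r// ?norm1_le ?norm2_le.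
Qed.

Lemma cross_shift c x y : cross x (c *: x + y) = cross x y.
Proof.
case: x y => x1 x2 [y1 y2].
change (x1 * (c * x2 + y2) - x2 * (c * x1 + y1) = x1 * y2 - x2 * y1); ring.
Qed.

Lemma curve_continuous g : smooth_curve g ->
  continuous (xcoord g) /\ continuous (ycoord g).
Proof. by move=> [g1 g2]; split; exact: (@smooth_continuous _ _ 0). Qed.

Lemma vel_continuous g : smooth_curve g ->
  continuous (fun t => (vel g t).1) /\ continuous (fun t => (vel g t).2).
Proof. by move=> [g1 g2]; split; exact: (@smooth_continuous _ _ 1). Qed.

Lemma enorm_continuous (T : topologicalType) (f1 f2 : T -> R) :
  continuous f1 -> continuous f2 -> continuous (fun u => enorm (f1 u, f2 u)).
Proof.
move=> c1 c2 u; rewrite /enorm /=.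
apply: (@continuous_comp _ _ _ (fun u => f1 u ^+ 2 + f2 u ^+ 2) (@Num.sqrt R)).
  by apply: cvgD; apply: (@continuous_comp _ _ _ _ (fun r : R => r ^+ 2));
    [exact: c1|exact: exprn_continuous|exact: c2|exact: exprn_continuous].
exact: sqrt_continuous.
Qed.

Lemma fst_cont (p : R * R) : {for p, continuous (@fst R R)}.
Proof. by case: p => a b; exact: cvg_fst. Qed.

Lemma snd_cont (p : R * R) : {for p, continuous (@snd R R)}.
Proof. by case: p => a b; exact: cvg_snd. Qed.

Lemma speed_continuous g : smooth_curve g -> continuous (speed g).
Proof.
by move=> /vel_continuous[v1 v2]; exact: (enorm_continuous v1 v2).
Qed.

Lemma curve_taylor g a b : smooth_curve g -> exists2 L : R, 0 <= L &
  forall s t, a <= s <= b -> a <= t <= b ->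
  let r := g s - g t - (s - t) *: vel g t in `|r.1| + `|r.2| <= L * (s - t) ^+ 2.
Proof.
move=> [g1 g2].
have [L1 L10 h1] := continuous_bounded_itv a b (@smooth_continuous _ _ 2 g1).
have [L2 L20 h2] := continuous_bounded_itv a b (@smooth_continuous _ _ 2 g2).
exists (L1 + L2); first by rewrite addr_ge0.
have d10 t := smooth_is_derive 0 t g1; have d11 t := smooth_is_derive 1 t g1.
have d20 t := smooth_is_derive 0 t g2; have d21 t := smooth_is_derive 1 t g2.
move=> s t sab tab; cbv zeta; rewrite mulrDl; apply: lerD.
  exact: (taylor2 d10 d11 h1 sab tab).
exact: (taylor2 d20 d21 h2 sab tab).
Qed.

Lemma periodicz g t (n : int) : (forall t, g (t + 1) = g t) -> g (t + n%:~R) = g t.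
Proof.
move=> per; have nat_per k u : g (u + k%:R) = g u.
  by elim: k => [|k IH]; rewrite ?addr0// -natr1 addrA per.
case: n => n; first exact: nat_per.
by rewrite NegzE rmorphN /= -(nat_per n.+1) -addrA addNr addr0.
Qed.

Lemma curve_param01 g x : (forall t, g (t + 1) = g t) -> (exists t, g t = x) ->
  exists2 t, 0 <= t < 1 & g t = x.
Proof.
move=> per [t <-]; exists (t - (Num.floor t)%:~R).
  have /andP[h1 h2] := floor_itv t.
  by rewrite subr_ge0 h1 /= ltrBlDl -[X in _ + X]/(1%:~R) -rmorphD.
by rewrite -rmorphN /= periodicz.
Qed.

Lemma curve_param_near g x t : (forall t, g (t + 1) = g t) -> (exists t, g t = x) ->
  exists2 s, g s = x & t - 2^-1 <= s <= t + 2^-1.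
Proof.
move=> per [u <-]; pose n := Num.floor (u - t + 2^-1).
exists (u - n%:~R); first by rewrite -rmorphN /= periodicz.
have /andP[] := floor_itv (u - t + 2^-1); rewrite -/n rmorphD /= => h1 h2.
have h3 : (1%:~R : R) = 1 by []. rewrite h3 in h2.
by apply/andP; split; lra.
Qed.

(* Both open discs tangent to the curve [g] at [g t] with radius of order [1/K]
   avoid the curve [h]. *)
Definition chord_bound g h K := forall s t, 0 <= t <= 1 ->
  `|cross (vel g t) (h s - g t)| <= K * enorm (h s - g t) ^+ 2.

Lemma enormE x : enorm x = enorm (x.1, x.2). Proof. by case: x. Qed.

(** Away from the base point a linear bound is already quadratic, because |y| <= |y|^2 / c. *)
Lemma far_cross_le x y G c : 0 <= G -> 0 < c -> enorm x <= G -> c <= enorm y ->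
  `|cross x y| <= 2 * G / c * enorm y ^+ 2.
Proof.
move=> G0 c0 xG cy; have y0 := enorm_ge0 y.
apply: le_trans (cross_le x y) _.
apply: (@le_trans _ _ (G * (enorm y + enorm y))).
  by rewrite ler_pM ?enorm_ge0 ?addr_ge0// lerD ?norm1_le ?norm2_le.
have -> : 2 * G / c * enorm y ^+ 2 = G * (enorm y + enorm y) * (enorm y / c).
  by field; rewrite lt0r_neq0.
by rewrite ler_peMr ?mulr_ge0 ?addr_ge0// ler_pdivlMr// mul1r.
Qed.

Lemma speed_bounded g a b : smooth_curve g ->
  exists2 G : R, 0 <= G & forall t, a <= t <= b -> enorm (vel g t) <= G.
Proof.
move=> sg; have [G G0 GP] := continuous_bounded_itv a b (speed_continuous sg).
by exists G => // t tab; apply: le_trans (ler_norm _) (GP t tab).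
Qed.

Lemma chord_bound_disjoint g h : smooth_curve g -> smooth_curve h ->
  (forall t, h (t + 1) = h t) -> (forall s t, h s <> g t) ->
  exists2 K : R, 0 <= K & chord_bound g h K.
Proof.
move=> sg sh perh dis.
have [G G0 GP] := speed_bounded 0 1 sg.
have [cg1 cg2] := curve_continuous sg; have [ch1 ch2] := curve_continuous sh.
pose F (p : R * R) := enorm ((h p.2).1 - (g p.1).1, (h p.2).2 - (g p.1).2).
have cF : continuous F.
  apply: enorm_continuous => p.
    apply: cvgB; [exact: (continuous_comp (@snd_cont p) (ch1 _))|].
    exact: (continuous_comp (@fst_cont p) (cg1 _)).
  apply: cvgB; [exact: (continuous_comp (@snd_cont p) (ch2 _))|].
  exact: (continuous_comp (@fst_cont p) (cg2 _)).
have FE t s : F (t, s) = enorm (h s - g t) by rewrite [RHS]enormE.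
have Fpos p : (`[0, 1]%classic `*` `[0, 1]%classic) p -> 0 < F p.
  case: p => t s _; rewrite FE lt0r enorm_ge0 andbT enorm_eq0 subr_eq0.
  by apply/eqP/dis.
have [c c0 cP] := compact_pos_min
  (compact_setX (@segment_compact R 0 1) (@segment_compact R 0 1)) cF Fpos.
exists (2 * G / c); first by rewrite divr_ge0 ?mulr_ge0// ltW.
move=> s t t01; have [s' /andP[s0 s1] <-] := curve_param01 perh (ex_intro _ s erefl).
apply: far_cross_le => //; first exact: GP.
rewrite -FE; apply: cP; split; rewrite /= in_itv //=.
by rewrite s0 ltW.
Qed.

(** For close parameters the cross product with the velocity removes the linear term of the chord
    and leaves O((s-t)^2), while the chord itself is at least of order |s-t|. For other parameters
    simplicity and compactness bound the chord from below. *)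
Lemma chord_bound_self g : smooth_curve g -> (forall t, speed g t != 0) ->
  (forall t, g (t + 1) = g t) ->
  (forall s t, 0 <= s < 1 -> 0 <= t < 1 -> g s = g t -> s = t) ->
  exists2 K : R, 0 <= K & chord_bound g g K.
Proof.
move=> sg reg per simple.
have [G G0 GP] := speed_bounded 0 1 sg.
have [L L0 LP] := curve_taylor (-1) 2 sg.
have [cg1 cg2] := curve_continuous sg.
have spos t : `[-1, 2]%classic t -> 0 < speed g t by rewrite lt0r reg enorm_ge0.
(* With t in [0,1], periodicity brings s within 1/2 of t. Either of them may serve as base point,
   and [-1,2] contains both. *)
have [v v0 vP] := compact_pos_min (@segment_compact R (-1) 2) (speed_continuous sg) spos.
(* For |s-t| <= eta the remainder L (s-t)^2 is at most half of v |s-t|. *)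
pose eta := v / (2 * (L + 1)).
have eta0 : 0 < eta by rewrite divr_gt0// mulr_gt0// ltr_wpDl.
pose F (p : R * R) := enorm ((g (p.1 + p.2)).1 - (g p.1).1, (g (p.1 + p.2)).2 - (g p.1).2).
have cF : continuous F.
  have cD p : {for p, continuous (fun p : R * R => p.1 + p.2)}.
    by apply: cvgD; [exact: fst_cont|exact: snd_cont].
  apply: enorm_continuous => p.
    apply: cvgB; [exact: (continuous_comp (cD p) (cg1 _))|].
    exact: (continuous_comp (@fst_cont p) (cg1 _)).
  apply: cvgB; [exact: (continuous_comp (cD p) (cg2 _))|].
  exact: (continuous_comp (@fst_cont p) (cg2 _)).
have FE t s : F (t, s) = enorm (g (t + s) - g t) by rewrite [RHS]enormE.
have Fpos p : (`[-1, 2]%classic `*` `[eta, 2^-1]%classic) p -> 0 < F p.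
  case: p => t s [_ /=]; rewrite in_itv /= => /andP[s1 s2].
  have s0 : 0 < s by exact: lt_le_trans s1.
  rewrite FE lt0r enorm_ge0 andbT enorm_eq0 subr_eq0; apply/eqP.
  pose n := Num.floor t; pose t' := t - n%:~R.
  have /andP[t0 t1] : 0 <= t' < 1.
    have /andP[h1 h2] := floor_itv t.
    by rewrite subr_ge0 h1 /= ltrBlDl -[X in _ + X]/(1%:~R) -rmorphD.
  have tE : g t' = g t by rewrite -(periodicz t' n per) subrK.
  have tsE : g (t' + s) = g (t + s).
    by rewrite -(periodicz (t' + s) n per) addrAC subrK.
  rewrite -tsE -tE => e; have [ts|ts] := ltP (t' + s) 1.
    by have := simple (t' + s) t' _ _ e; lra.
  have e' : g (t' + s - 1) = g t' by rewrite -e -[in RHS](subrK 1 (t' + s)) per.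
  by have := simple (t' + s - 1) t' _ _ e'; lra.
have [c c0 cP] := compact_pos_min
  (compact_setX (@segment_compact R (-1) 2) (@segment_compact R eta (2^-1))) cF Fpos.
exists (4 * G * L / v ^+ 2 + 2 * G / c).
  by rewrite addr_ge0 ?divr_ge0 ?mulr_ge0 ?exprn_ge0// ltW.
move=> s0 t t01; have [s <- /andP[s1 s2]] := curve_param_near t per (ex_intro _ s0 erefl).
have /andP[t0 t1] := t01.
have far : c <= enorm (g s - g t) -> `|cross (vel g t) (g s - g t)| <=
    (4 * G * L / v ^+ 2 + 2 * G / c) * enorm (g s - g t) ^+ 2.
  move=> cd; apply: le_trans (far_cross_le G0 c0 (GP t t01) cd) _.
  by rewrite ler_wpM2r ?exprn_ge0 ?enorm_ge0// lerDr divr_ge0 ?mulr_ge0 ?exprn_ge0// ltW.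
have [hs|hs] := leP (s - t) (- eta).
  apply: far; rewrite enormB (_ : g t = g (s + (t - s))); last by rewrite addrC subrK.
  rewrite -FE; apply: cP; split; rewrite /= in_itv /=; lra.
have [hs'|hs'] := leP eta (s - t).
  apply: far; rewrite (_ : g s = g (t + (s - t))); last by rewrite addrC subrK.
  rewrite -FE; apply: cP; split; rewrite /= in_itv /=; lra.
have st : `|s - t| <= eta by rewrite ler_norml; lra.
have s12 : -1 <= s <= 2 by lra.
have t12 : -1 <= t <= 2 by lra.
have := LP s t s12 t12; cbv zeta; set r := _ - _ - _ => rL.
have gE : g s - g t = (s - t) *: vel g t + r by rewrite /r [RHS]addrC subrK.
have sv : v <= enorm (vel g t) by apply: vP; rewrite /= in_itv.
have st2 : L * (s - t) ^+ 2 <= v / 2 * `|s - t|.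
  rewrite -(real_normK (num_real (s - t))) expr2 mulrA.
  rewrite ler_wpM2r//; apply: le_trans (ler_wpM2l L0 st) _.
  rewrite /eta mulrA ler_pdivrMr ?mulr_gt0 ?ltr_wpDl//.
  have -> : v / 2 * (2 * (L + 1)) = L * v + v by field.
  by rewrite lerDl ltW.
have lower : v / 2 * `|s - t| <= enorm (g s - g t).
  have h1 : `|s - t| * enorm (vel g t) <= enorm (g s - g t) + enorm r.
    rewrite -enormZ -(enormN r) (_ : _ *: _ = (g s - g t) - r); last by rewrite gE addrK.
    exact: enormD.
  have h2 : enorm r <= v / 2 * `|s - t|.
    by apply: le_trans (enorm_le r) _; apply: le_trans rL st2.
  have h3 := ler_wpM2l (normr_ge0 (s - t)) sv; lra.
have crE : cross (vel g t) (g s - g t) = cross (vel g t) r.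
  by rewrite gE cross_shift.
rewrite crE; apply: le_trans (cross_le _ _) _.
apply: (@le_trans _ _ (G * (L * (s - t) ^+ 2))).
  by rewrite ler_pM ?enorm_ge0 ?addr_ge0// GP.
apply: (@le_trans _ _ (4 * G * L / v ^+ 2 * enorm (g s - g t) ^+ 2)); last first.
  by rewrite ler_wpM2r ?exprn_ge0 ?enorm_ge0// lerDl divr_ge0 ?mulr_ge0// ltW.
have l2 : (v / 2 * `|s - t|) ^+ 2 <= enorm (g s - g t) ^+ 2.
  by rewrite lerXn2r ?nnegrE ?enorm_ge0// mulr_ge0// divr_ge0// ltW.
apply: le_trans (ler_wpM2l _ l2); last by rewrite divr_ge0 ?mulr_ge0 ?exprn_ge0// ltW.
rewrite exprMn real_normK ?num_real//; apply: eqle; field.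
by rewrite lt0r_neq0.
Qed.

End Curves.

(** * Discs inside the domain that reach its boundary *)

Section InteriorBall.
Variable R : realType.
Implicit Types (A B Om : set (R * R)) (x y z w : R * R) (t r e : R).

Lemma nbhs_enorm x A : nbhs x A -> exists2 e, 0 < e & forall y, enorm (y - x) < e -> A y.
Proof.
move=> /nbhs_ballP[e /= e0 eA]; exists e => // y yx; apply: eA; split => /=.
  by rewrite /ball /= distrC; apply: le_lt_trans (norm1_le (y - x)) yx.
by rewrite /ball /= distrC; apply: le_lt_trans (norm2_le (y - x)) yx.
Qed.

Lemma open_enorm A x : open A -> A x -> exists2 e, 0 < e & forall y, enorm (y - x) < e -> A y.
Proof. by move=> oA Ax; apply: nbhs_enorm; exact: open_nbhs_nbhs. Qed.

Lemma enorm_nbhs x e : 0 < e -> nbhs x [set y | enorm (y - x) < e].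
Proof.
move=> e0; apply/nbhs_ballP; exists (e / 2) => /=; first by rewrite divr_gt0.
move=> y [/= y1 y2]; apply: le_lt_trans (enorm_le _) _.
have -> : e = e / 2 + e / 2 by field.
by apply: ltrD; [move: y1|move: y2]; rewrite /ball /= distrC.
Qed.

Lemma closure_enorm A x e : closure A x -> 0 < e -> exists2 y, A y & enorm (y - x) < e.
Proof. by move=> cA e0; have [y [Ay yx]] := cA _ (enorm_nbhs x e0); exists y. Qed.

(** On such a segment Om and its closure have the same trace, which is therefore both open and
    closed in a connected set. *)
Lemma segment_avoids_frontier Om z w : open Om -> Om z ->
  (forall t, 0 <= t <= 1 -> ~ frontier Om (z + t *: (w - z))) -> Om w.
Proof.
move=> oOm Oz avoid; pose h t := z + t *: (w - z).
have ch : continuous h.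
  move=> t; apply: cvgD; first exact: cvg_cst.
  exact: scalel_continuous.
have cS : connected (h @` `[0, 1]%classic).
  apply: connected_continuous_connected; first exact: segment_connected.
  exact: continuous_subspaceT.
set S := h @` _ in cS.
have h0 : h 0 = z by rewrite /h scale0r addr0.
have h1 : h 1 = w by rewrite /h scale1r addrC subrK.
have S0 : S z by exists 0 => //=; rewrite in_itv /= lexx ler01.
have S1 : S w by exists 1 => //=; rewrite in_itv /= lexx ler01.
have SE : S `&` Om = S `&` closure Om.
  apply/seteqP; split=> q [Sq Oq]; split=> //; first exact: subset_closure.
  have [t /=] := Sq; rewrite in_itv /= => t01 tq; apply: contrapT => nOq.
  apply: (avoid t t01); rewrite -/(h t) tq; split=> //.
  by move: oOm; rewrite openE => oOm /interior_subset.
have E : S `&` Om = S.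
  apply: cS.
  - by exists z.
  - by exists Om.
  - by exists (closure Om) => //; exact: closed_closure.
by move: S1; rewrite -E => -[].
Qed.

Lemma frontier_open_disjoint Om x : open Om -> Om x -> ~ frontier Om x.
Proof. by move=> oOm Ox [_]; apply; rewrite openE in oOm; exact: oOm. Qed.

Lemma disc_convex x z w r t : enorm (z - x) < r -> enorm (w - x) < r -> 0 <= t <= 1 ->
  enorm (z + t *: (w - z) - x) < r.
Proof.
move=> zr wr /andP[t0 t1].
have -> : z + t *: (w - z) - x = (1 - t) *: (z - x) + t *: (w - x).
  by rewrite scalerBl scale1r !scalerBr; ring.
have s0 : 0 <= 1 - t by lra.
apply: le_lt_trans (enormD _ _) _; rewrite !enormZ (ger0_norm t0) (ger0_norm s0).
have [->|tn] := eqVneq t 0; first by rewrite subr0 mul1r mul0r addr0.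
have tp : 0 < t by rewrite lt0r tn.
have h1 := ler_wpM2l s0 (ltW zr).
have h2 : t * enorm (w - x) < t * r by rewrite ltr_pM2l.
lra.
Qed.

Lemma nearest_point (m : nat) (gam : 'I_m -> R -> R * R) z :
  (forall j, smooth_curve (gam j)) -> (forall j t, gam j (t + 1) = gam j t) ->
  'I_m -> exists j t, [/\ 0 <= t <= 1, forall i s, enorm (z - gam j t) <= enorm (z - gam i s) &
    (z - gam j t).1 * (vel (gam j) t).1 + (z - gam j t).2 * (vel (gam j) t).2 = 0].
Proof.
move=> sg per j0.
pose phi j t := ((z.1 - xcoord (gam j) t) ^+ 2 + (z.2 - ycoord (gam j) t) ^+ 2).
have phiE j t : phi j t = enorm (z - gam j t) ^+ 2 by rewrite sqr_enorm.
pose dphi j t := - 2 * ((z - gam j t).1 * (vel (gam j) t).1 + (z - gam j t).2 * (vel (gam j) t).2).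
have phid j t : is_derive t 1 (phi j) (dphi j t).
  have [s1 s2] := sg j.
  have d1 : is_derive t 1 (xcoord (gam j)) (vel (gam j) t).1 := smooth_is_derive 0 t s1.
  have d2 : is_derive t 1 (ycoord (gam j)) (vel (gam j) t).2 := smooth_is_derive 0 t s2.
  apply: (is_derive_eq (derD (derX 2 (derB (derc t z.1) d1)) (derX 2 (derB (derc t z.2) d2)))).
  rewrite /dphi !expr1 -[(z - gam j t).1]/(z.1 - xcoord (gam j) t).
  by rewrite -[(z - gam j t).2]/(z.2 - ycoord (gam j) t); ring.
have cphi j : continuous (phi j) by apply: is_derive_continuous (phid j).
have tmin j : exists2 t, 0 <= t <= 1 & forall s, 0 <= s <= 1 -> phi j t <= phi j s.
  have [t t01 tm] := EVT_min (ler01 : 0 <= 1 :> R) (continuous_subspaceT (cphi j)).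
  by exists t => // s s01; apply: tm; rewrite in_itv.
have [T TP] := choice (fun j => let: ex_intro2 t a b := tmin j in ex_intro _ t (conj a b)).
pose j := [arg min_(i < j0) phi i (T i)]%O.
have jmin i : phi j (T j) <= phi i (T i).
  by rewrite /j; case: arg_minP => // l _; apply.
have glob i s : phi j (T j) <= phi i s.
  apply: le_trans (jmin i) _; have [s' /andP[h0 h1] hs] := curve_param01 (per i) (ex_intro _ s erefl).
  by rewrite (phiE i s) -hs -phiE; apply: (TP i).2; rewrite h0 ltW.
exists j, (T j); split; first exact: (TP j).1.
  move=> i s; have := glob i s; rewrite !phiE.
  by rewrite ler_pXn2r ?nnegrE ?enorm_ge0.
have Tj := phid j (T j).
(* By periodicity the minimum over [0,1] is one over the whole line, so the derivative vanishes even
   if it is attained at an end of [0,1]. *)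
have [] := @derive1_at_min _ (phi j) (T j - 1) (T j + 1) (T j).
- lra.
- by move=> t _; have [] := phid j t.
- by rewrite in_itv /=; lra.
- by move=> t _; exact: glob.
move=> _; have [_ ->] := Tj; rewrite /dphi => /eqP.
by rewrite mulf_eq0 oppr_eq0 pnatr_eq0 /= => /eqP.
Qed.

Lemma chord_bound_all Om (m : nat) (gam : 'I_m -> R -> R * R) : smooth_domain Om gam ->
  exists2 K : R, 0 <= K & forall i j, chord_bound (gam j) (gam i) K.
Proof.
move=> sd.
have sg j : smooth_curve (gam j) by exact: (sd_smooth sd).
have per j := sd_periodic sd j.
have pair (p : 'I_m * 'I_m) : exists K, 0 <= K /\ chord_bound (gam p.2) (gam p.1) K.
  case: p => i j /=; have [<-|ij] := eqVneq i j.
    have [] // := chord_bound_self (sg i) (sd_regular sd i) (per i); last by move=> K ? ?; exists K.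
    by move=> s t s01 t01 /(sd_simple sd s01 t01)[].
  have [] // := chord_bound_disjoint (sg j) (sg i) (per i); last by move=> K ? ?; exists K.
  move=> s t st.
  have [s' s01 sE] := curve_param01 (per i) (ex_intro _ s erefl).
  have [t' t01 tE] := curve_param01 (per j) (ex_intro _ t erefl).
  have [] := sd_simple sd s01 t01 (_ : gam i s' = gam j t'); first by rewrite sE tE.
  by move=> e; rewrite e eqxx in ij.
have [K KP] := choice pair.
exists (\sum_p K p); first by apply: sumr_ge0 => p _; exact: (KP p).1.
move=> i j s t t01; apply: le_trans ((KP (i, j)).2 s t t01) _.
rewrite ler_wpM2r ?exprn_ge0 ?enorm_ge0// (bigD1 (i, j))//= lerDl.
by apply: sumr_ge0 => p _; exact: (KP p).1.
Qed.

(* Take [z] in [Om] near [y] and its nearest frontier point [y1].  The disc tangent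
   at [y1] on the side of [z] contains [z] and, by [chord_bound], misses the
   frontier, hence lies in [Om]. *)
Lemma interior_ball Om (m : nat) (gam : 'I_m -> R -> R * R) : smooth_domain Om gam ->
  exists2 r0 : R, 0 < r0 & forall r e y, 0 < r <= r0 -> 0 < e -> frontier Om y ->
  exists2 y', enorm (y - y') < r + e & forall w, enorm (w - y') < r -> Om w.
Proof.
move=> sd; have [K K0 KP] := chord_bound_all sd.
have sg j : smooth_curve (gam j) by exact: (sd_smooth sd).
have [v v0 vP] : exists2 v : R, 0 < v & forall j t, 0 <= t <= 1 -> v <= speed (gam j) t.
  have spos j t : `[0, 1]%classic t -> 0 < speed (gam j) t.
    by rewrite lt0r (sd_regular sd) enorm_ge0.
  have ex j : exists v, 0 < v /\ forall t, 0 <= t <= 1 -> v <= speed (gam j) t.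
    have [v v0 vP] := compact_pos_min (@segment_compact R 0 1) (speed_continuous (sg j)) (spos j).
    by exists v; split => // t t01; apply: vP; rewrite /= in_itv.
  have [V VP] := choice ex.
  exists (\big[Num.min/1]_j V j).
    by elim/big_ind: _ => // [a b a0 b0|j _]; [rewrite lt_min a0|exact: (VP j).1].
  move=> j t t01; apply: le_trans ((VP j).2 t t01).
  exact: bigmin_le_cond.
(* This radius gives 2 r K / v <= 1, the inequality [rK] that keeps the tangent disc free of
   frontier points. *)
exists (v / (2 * (K + 1))); first by rewrite divr_gt0// mulr_gt0// ltr_wpDl.
move=> r e y /andP[r0 rr] e0 fy.
have oOm := sd_open sd.
(* Closeness e puts the disc near y; closeness r makes the nearest frontier point lie at distance d
   < r, so that z itself belongs to the disc about y'. *)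
have [z Oz zy] : exists2 z, Om z & enorm (z - y) < Num.min e r.
  by apply: closure_enorm fy.1 _; rewrite lt_min e0.
have [j0 _] : exists j0 : 'I_m, True.
  by have := fy; rewrite (sd_frontier sd) => -[j _]; exists j.
have [j [t [t01 near orth]]] := nearest_point z sg (sd_periodic sd) j0.
set y1 := gam j t in near orth; set d := enorm (z - y1) in near.
have fr i s : frontier Om (gam i s) by rewrite (sd_frontier sd); exists i, s.
have d0 : 0 < d.
  rewrite lt0r enorm_ge0 andbT enorm_eq0 subr_eq0; apply/eqP => zy1.
  by apply: (frontier_open_disjoint oOm Oz); rewrite zy1; exact: fr.
have dr : d < r.
  have [i [s ys]] : exists i s, gam i s = y by have := fy; rewrite (sd_frontier sd).
  by have := near i s; rewrite ys enormB => h; move: zy; rewrite lt_min enormB => /andP[_]; apply: le_lt_trans.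
have ze : enorm (z - y) < e by move: zy; rewrite lt_min => /andP[].
pose n := d^-1 *: (z - y1).
have n1 : enorm n = 1 by rewrite enormZ ger0_norm ?invr_ge0 ?(ltW d0)// mulVf// lt0r_neq0.
pose y' := y1 + r *: n.
have zE : z - y1 = d *: n by rewrite /n scalerA divff ?lt0r_neq0// scale1r.
have zy' : enorm (z - y') < r.
  rewrite /y' opprD addrA zE -scalerBl enormZ n1 mulr1 ltr0_norm ?subr_lt0//; lra.
exists y'.
  rewrite -(subrKA z); apply: le_lt_trans (enormD _ _) _.
  by rewrite addrC ltrD// enormB.
have ball w : enorm (w - y') < r -> ~ frontier Om w.
  rewrite (sd_frontier sd) => wr [i [s ws]]; move: wr; apply/negP; rewrite -leNgt.
  pose b := w - y1.
  have wE : w - y' = b - r *: n by rewrite /y' opprD addrA.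
  have cb : `|cross (vel (gam j) t) b| <= K * enorm b ^+ 2.
    by rewrite /b -ws; exact: KP.
  have vt : v <= enorm (vel (gam j) t) by exact: vP.
  set V := vel (gam j) t in cb vt orth.
  have nV : n.1 * V.1 + n.2 * V.2 = 0.
    rewrite /n -[_.1]/(d^-1 * (z - y1).1) -[_.2]/(d^-1 * (z - y1).2).
    by rewrite -!mulrA -mulrDr orth mulr0.
  have n2 : n.1 ^+ 2 + n.2 ^+ 2 = 1 by rewrite -sqr_enorm n1 expr1n.
  pose q := n.1 * b.1 + n.2 * b.2.
  (* n is a unit normal to V, so Lagrange's identity expresses the normal component q of b by the
     cross product that [chord_bound] controls. *)
  have qV : (q * enorm V) ^+ 2 = cross V b ^+ 2.
    rewrite exprMn sqr_enorm /q /cross.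
    have : (n.1 * V.2 - n.2 * V.1) ^+ 2 = (n.1 ^+ 2 + n.2 ^+ 2) * (V.1 ^+ 2 + V.2 ^+ 2) - (n.1 * V.1 + n.2 * V.2) ^+ 2 by ring.
    rewrite n2 nV expr0n subr0 mul1r => <-.
    have -> : (n.1 * b.1 + n.2 * b.2) ^+ 2 * (n.1 * V.2 - n.2 * V.1) ^+ 2 =
      ((n.1 * b.1 + n.2 * b.2) * (n.1 * V.2 - n.2 * V.1)) ^+ 2 by rewrite exprMn.
    have -> : (n.1 * b.1 + n.2 * b.2) * (n.1 * V.2 - n.2 * V.1) =
      (n.1 ^+ 2 + n.2 ^+ 2) * (b.1 * V.2 - b.2 * V.1) - (n.1 * V.1 + n.2 * V.2) * (n.2 * b.1 - n.1 * b.2) by ring.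
    by rewrite n2 nV; ring.
  have qb : q <= K / v * enorm b ^+ 2.
    have h1 : `|q| * enorm V <= K * enorm b ^+ 2.
      apply: le_trans cb; rewrite -(ger0_norm (enorm_ge0 V)) -normrM.
      by rewrite -(ler_pXn2r (n := 2)) ?nnegrE// !real_normK ?num_real// qV.
    have h2 : `|q| * v <= K * enorm b ^+ 2 by apply: le_trans h1; rewrite ler_wpM2l.
    by apply: le_trans (ler_norm q) _; rewrite mulrAC ler_pdivlMr.
  have rK : 2 * r * (K / v) <= 1.
    rewrite mulrA ler_pdivrMr// mul1r.
    move: rr; rewrite ler_pdivlMr ?mulr_gt0 ?ltr_wpDl// => rr; nra.
  have b20 : 0 <= enorm b ^+ 2 by exact: sqr_ge0.
  (* |b - r n|^2 = |b|^2 - 2 r q + r^2, and 2 r q <= |b|^2 by [qb] and [rK]. *)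
  have sq : r ^+ 2 <= enorm (b - r *: n) ^+ 2.
    have -> : enorm (b - r *: n) ^+ 2 = enorm b ^+ 2 - 2 * r * q + r ^+ 2 * (n.1 ^+ 2 + n.2 ^+ 2).
      rewrite !sqr_enorm -[(_ - _).1]/(b.1 - r * n.1) -[(_ - _).2]/(b.2 - r * n.2) /q; ring.
    rewrite n2 mulr1 lerDr subr_ge0.
    have h : 2 * r * q <= 2 * r * (K / v * enorm b ^+ 2) by rewrite ler_wpM2l// mulr_ge0// ltW.
    by apply: le_trans h _; rewrite mulrA ler_piMl.
  rewrite wE; move: sq; rewrite ler_pXn2r ?nnegrE ?enorm_ge0//; exact: ltW.
move=> w wr; apply: (segment_avoids_frontier oOm Oz) => u u01; apply: ball.
exact: disc_convex.
Qed.

End InteriorBall.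

(** * Integrals of complex functions over the unit interval *)

Section ComplexIntegral.
Variable R : realType.
Implicit Types (f g : R -> R[i]) (nu : R -> R) (B : R).

Local Notation D := (`[0%R, 1%R]%classic : set (measurableTypeR R)).
Local Notation mu := (@lebesgue_measure R).

Definition cint f : R[i] :=
  (\int[mu]_(t in D) complex.Re (f t))%R +i* (\int[mu]_(t in D) complex.Im (f t))%R.

Definition cmeas f : Prop :=
  measurable_fun D (fun t : measurableTypeR R => complex.Re (f t) : R) /\
  measurable_fun D (fun t : measurableTypeR R => complex.Im (f t) : R).

Definition rint nu : Prop := mu.-integrable D (EFin \o nu).

Lemma measurableD01 : measurable D. Proof. exact: measurable_itv. Qed.
Hint Resolve measurableD01 : core.

Lemma rint_dom (h nu : R -> R) : measurable_fun D (h : measurableTypeR R -> R) -> rint nu ->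
  (forall t, D t -> `|h t| <= nu t) -> rint h.
Proof.
move=> mh inu hn; apply: (le_integrable _ _ _ inu) => //.
  exact/measurable_EFinP.
by move=> t Dt; rewrite /= lee_fin (le_trans (hn t Dt)) ?ler_norm.
Qed.

Lemma rintZ B nu : rint nu -> rint (fun t => B * nu t).
Proof. by move=> h; have := integrableZl measurableD01 B h. Qed.

Lemma cint_dom f nu B : cmeas f -> rint nu -> (forall t, D t -> cabs (f t) <= B * nu t) ->
  rint (fun t => complex.Re (f t)) /\ rint (fun t => complex.Im (f t)).
Proof.
move=> [m1 m2] inu fn; split; apply: (rint_dom _ (rintZ B inu)) => // t Dt.
  exact: le_trans (normRe_le _) (fn t Dt).
exact: le_trans (normIm_le _) (fn t Dt).
Qed.

Lemma cint_le f nu B : cmeas f -> rint nu -> (forall t, D t -> cabs (f t) <= B * nu t) ->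
  cabs (cint f) <= 2 * (B * \int[mu]_(t in D) nu t).
Proof.
move=> mf inu fn; have [i1 i2] := cint_dom mf inu fn.
apply: le_trans (cabs_le _) _; rewrite mulr_natl mulr2n /=.
rewrite -RintegralZl//; have iB := rintZ B inu.
have key (h : R -> R) : rint h -> (forall t, D t -> `|h t| <= B * nu t) ->
    `|\int[mu]_(t in D) h t| <= \int[mu]_(t in D) (B * nu t).
  move=> ih hn; apply: le_trans (le_normr_Rintegral _ ih) _ => //.
  by apply: le_Rintegral => //; exact: integrable_norm.
apply: lerD; apply: key => // t Dt.
  exact: le_trans (normRe_le _) (fn t Dt).
exact: le_trans (normIm_le _) (fn t Dt).
Qed.

Lemma cmeasD f g : cmeas f -> cmeas g -> cmeas (fun t => f t + g t).
Proof.
move=> [f1 f2] [g1 g2]; split.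
  rewrite [X in measurable_fun _ X](_ : _ =
    (fun t => complex.Re (f t) + complex.Re (g t))); first exact: measurable_funD.
  by apply/funext => t; rewrite cReD.
rewrite [X in measurable_fun _ X](_ : _ =
  (fun t => complex.Im (f t) + complex.Im (g t))); first exact: measurable_funD.
by apply/funext => t; rewrite cImD.
Qed.

Lemma cmeasM f g : cmeas f -> cmeas g -> cmeas (fun t => f t * g t).
Proof.
move=> [f1 f2] [g1 g2]; split.
  rewrite [X in measurable_fun _ X](_ : _ =
    (fun t => complex.Re (f t) * complex.Re (g t) - complex.Im (f t) * complex.Im (g t))).
    by apply: measurable_funB; exact: measurable_funM.
  by apply/funext => t; rewrite cReM.
rewrite [X in measurable_fun _ X](_ : _ =
  (fun t => complex.Re (f t) * complex.Im (g t) + complex.Im (f t) * complex.Re (g t))).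
  by apply: measurable_funD; exact: measurable_funM.
by apply/funext => t; rewrite cImM.
Qed.

Lemma cmeas_cst (c : R[i]) : cmeas (fun=> c).
Proof. by split; exact: measurable_cst. Qed.

Lemma cmeasX f n : cmeas f -> cmeas (fun t => f t ^+ n).
Proof.
move=> mf; elim: n => [|n IH].
  by under eq_fun => s do rewrite expr0; exact: cmeas_cst.
by under eq_fun => s do rewrite exprS; exact: cmeasM.
Qed.

Lemma cmeas_real (h : R -> R) : measurable_fun D (h : measurableTypeR R -> R) -> cmeas (fun t => (h t)%:C).
Proof. by move=> mh; split => //=; exact: measurable_cst. Qed.

Lemma cmeas_sum (I : Type) (r : seq I) (f : I -> R -> R[i]) :
  (forall i, cmeas (f i)) -> cmeas (fun t => \sum_(i <- r) f i t).
Proof.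
move=> mf; elim: r => [|i r IH].
  by under eq_fun => s do rewrite big_nil; exact: cmeas_cst.
by under eq_fun => s do rewrite big_cons; exact: cmeasD.
Qed.

Lemma cmeas_continuous (h1 h2 : R -> R) : continuous h1 -> continuous h2 ->
  cmeas (fun t => h1 t +i* h2 t).
Proof.
move=> c1 c2; split => /=; apply: measurable_funTS; exact: continuous_measurable_fun.
Qed.

Lemma cintD f g nu B B' : cmeas f -> cmeas g -> rint nu ->
  (forall t, D t -> cabs (f t) <= B * nu t) -> (forall t, D t -> cabs (g t) <= B' * nu t) ->
  cint (fun t => f t + g t) = cint f + cint g.
Proof.
move=> mf mg inu fn gn; have [f1 f2] := cint_dom mf inu fn.
have [g1 g2] := cint_dom mg inu gn; rewrite /cint.
under eq_Rintegral => t _ do rewrite cReD.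
rewrite RintegralD//.
under [in X in _ +i* X]eq_Rintegral => t _ do rewrite cImD.
by rewrite RintegralD.
Qed.

Lemma cintZ (c : R[i]) f nu B : cmeas f -> rint nu ->
  (forall t, D t -> cabs (f t) <= B * nu t) -> cint (fun t => c * f t) = c * cint f.
Proof.
move=> mf inu fn; have [f1 f2] := cint_dom mf inu fn.
have Z a (h : R -> R) : rint h -> rint (fun t => a * h t) by exact: rintZ.
rewrite /cint; under eq_Rintegral => t _ do rewrite cReM.
rewrite RintegralB ?RintegralZl//; try exact: Z.
under [in X in _ +i* X]eq_Rintegral => t _ do rewrite cImM.
rewrite RintegralD ?RintegralZl//; try exact: Z.
by case: c.
Qed.

Lemma cint_sum (I : Type) (r : seq I) (f : I -> R -> R[i]) nu (B : I -> R) :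
  rint nu -> (forall i, cmeas (f i)) ->
  (forall i t, D t -> cabs (f i t) <= B i * nu t) ->
  cint (fun t => \sum_(i <- r) f i t) = \sum_(i <- r) cint (f i).
Proof.
move=> inu mf fB; elim: r => [|i r IH].
  rewrite big_nil; under eq_fun => s do rewrite big_nil.
  by rewrite /cint /= !Rintegral_cst// !mul0r.
rewrite big_cons -IH; under eq_fun => s do rewrite big_cons.
apply: (cintD (mf i) (cmeas_sum r mf) inu (fB i) (B' := \sum_(i <- r) B i)).
move=> t Dt; apply: le_trans (cabs_sum _ _ _) _.
by rewrite mulr_suml; apply: ler_sum => l _; exact: fB.
Qed.

(* Integrating a kernel expansion [phi t ~ \sum_e kap e t * G e] against a density [d]. *)
Lemma cint_expansion (I : Type) (r : seq I) (phi d : R -> R[i]) nu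
    (kap : I -> R -> R[i]) (G : I -> R[i]) (B : I -> R) (e : R) :
  rint nu -> cmeas d -> (forall t, D t -> cabs (d t) <= nu t) ->
  cmeas phi -> (forall i, cmeas (kap i)) ->
  (forall i t, D t -> cabs (kap i t) <= B i) ->
  (forall t, D t -> cabs (phi t - \sum_(i <- r) kap i t * G i) <= e) ->
  cabs (cint (fun t => phi t * d t) - \sum_(i <- r) cint (fun t => kap i t * d t) * G i)
    <= 2 * (e * \int[mu]_(t in D) nu t).
Proof.
move=> inu md dnu mphi mk kB he.
have cM (a b : R[i]) (A A' : R) : cabs a <= A -> cabs b <= A' -> cabs (a * b) <= A * A'.
  by move=> aA bA; rewrite cabsM ler_pM ?cabs_ge0.
pose S t := \sum_(i <- r) kap i t * G i.
have mkG i : cmeas (fun t => kap i t * G i) by apply: cmeasM => //; exact: cmeas_cst.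
have mS : cmeas S by exact: cmeas_sum.
have mdiff : cmeas (fun t => phi t - S t).
  apply: cmeasD => //; under eq_fun => t do rewrite -mulN1r.
  by apply: cmeasM => //; exact: cmeas_cst.
have h1 t : D t -> cabs ((phi t - S t) * d t) <= e * nu t by move=> Dt; apply: (cM _ _ _ _); [exact: he|exact: dnu].
have h2 i t : D t -> cabs (kap i t * G i * d t) <= B i * cabs (G i) * nu t.
  by move=> Dt; apply: (cM _ _ _ _); [apply: (cM _ _ _ _); [exact: kB|]|exact: dnu].
have h3 i t : D t -> cabs (kap i t * d t) <= B i * nu t.
  by move=> Dt; apply: (cM _ _ _ _); [exact: kB|exact: dnu].
have h4 t : D t -> cabs (S t * d t) <= (\sum_(i <- r) B i * cabs (G i)) * nu t.
  move=> Dt; rewrite /S mulr_suml mulr_suml; apply: le_trans (cabs_sum _ _ _) _.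
  by apply: ler_sum => i _; exact: h2.
have -> : (fun t => phi t * d t) = (fun t => (phi t - S t) * d t + S t * d t).
  by apply/funext => t; rewrite -mulrDl subrK.
rewrite (cintD (cmeasM mdiff md) (cmeasM mS md) inu h1 h4).
have -> : cint (fun t => S t * d t) = \sum_(i <- r) cint (fun t => kap i t * d t) * G i.
  under eq_fun => t do rewrite /S mulr_suml.
  rewrite (cint_sum r inu (fun i => cmeasM (mkG i) md) h2).
  apply: eq_bigr => i _; rewrite mulrC -(cintZ _ (cmeasM (mk i) md) inu (h3 i)).
  by congr cint; apply/funext => t; ring.
rewrite addrK; apply: cint_le => //; exact: cmeasM.
Qed.

End ComplexIntegral.

(** * Expansion of the potential of one boundary curve *)

Section CurveExpansion.
Variable R : realType.
Local Notation D := (`[0%R, 1%R]%classic : set (measurableTypeR R)).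
Local Notation mu := (@lebesgue_measure R).

(** Walking from y towards x by any s < r stays in Om, whence delta <= |x - y| - s; then s tends to
    r. *)
Lemma ball_dist (Om : set (R * R)) (x y : R * R) (r delta : R) :
  0 < r -> 0 < delta -> (forall w, enorm (w - y) < r -> Om w) ->
  (forall w, Om w -> delta <= enorm (x - w)) -> r + delta <= enorm (x - y).
Proof.
move=> r0 d0 ball far; set d := enorm (x - y).
have dr : r <= d.
  rewrite leNgt; apply/negP => dr.
  by have := far x (ball x dr); rewrite subrr enorm0 leNgt d0.
have dp : 0 < d by exact: lt_le_trans dr.
have step s : 0 <= s -> s < r -> s + delta <= d.
  move=> s0 sr; pose w := y + (s / d) *: (x - y).
  have wr : enorm (w - y) < r.
    rewrite /w addrC addKr enormZ ger0_norm ?divr_ge0 ?(ltW dp)// -/d divfK//.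
    exact: lt0r_neq0.
  have := far w (ball w wr).
  have -> : x - w = (1 - s / d) *: (x - y) by rewrite scalerBl scale1r /w opprD addrA.
  rewrite enormZ -/d ger0_norm; last by rewrite subr_ge0 ler_pdivrMr// mul1r (le_trans (ltW sr)).
  by rewrite mulrBl mul1r divfK ?lt0r_neq0// lerBrDl.
apply/ler_addgt0Pr => e e0; have [er|re] := ltP e r.
  by have := step (r - e); rewrite subr_ge0 ltrBlDr ltrDl e0 (ltW er) => /(_ isT isT); lra.
by have := step 0 (lexx _) r0; lra.
Qed.

Lemma curve_lipschitz (g : R -> R * R) : smooth_curve g ->
  exists2 L : R, 0 <= L & forall s t, 0 <= s <= 1 -> 0 <= t <= 1 ->
    enorm (g s - g t) <= L * `|s - t|.
Proof.
move=> sg; have [G G0 GP] := speed_bounded 0 1 sg.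
have [L L0 LP] := curve_taylor 0 1 sg.
exists (G + L); first exact: addr_ge0.
move=> s t s01 t01; have := LP s t s01 t01; cbv zeta; set r := _ - _ - _ => rL.
have -> : g s - g t = (s - t) *: vel g t + r by rewrite /r [RHS]addrC subrK.
apply: le_trans (enormD _ _) _; rewrite mulrDl enormZ; apply: lerD.
  by rewrite mulrC ler_wpM2r// GP.
apply: le_trans (enorm_le r) _; apply: le_trans rL _; apply: ler_wpM2l => //.
rewrite -(real_normK (num_real (s - t))) expr2 ler_piMl// ler_norml.
by move: s01 t01 => /andP[? ?] /andP[? ?]; apply/andP; split; lra.
Qed.

Lemma cmeas_conj (f : R -> R[i]) : cmeas f -> cmeas (fun t => (f t)^*).
Proof.
have Re_conj (b : R[i]) : complex.Re b^* = complex.Re b by case: b.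
have Im_conj (b : R[i]) : complex.Im b^* = - 1 * complex.Im b by case: b => ? ?; rewrite mulN1r.
move=> [f1 f2]; split.
  by rewrite [X in measurable_fun _ X](_ : _ = (fun t => complex.Re (f t)))//;
    apply/funext => t; exact: Re_conj.
rewrite [X in measurable_fun _ X](_ : _ = (fun t => -1 * complex.Im (f t)));
  last by apply/funext => t; exact: Im_conj.
by apply: measurable_funM => //; exact: measurable_cst.
Qed.

Lemma cmeas_curve (k : R) (y : R * R) (g : R -> R * R) : smooth_curve g ->
  cmeas (fun t => scal k y - scal k (g t)).
Proof.
move=> sg; have [c1 c2] := curve_continuous sg.
under eq_fun => t do rewrite -scalB /scal.
apply: cmeasM; first exact: cmeas_cst.
apply: cmeas_continuous => t.
  by apply: cvgB; [exact: cvg_cst|exact: c1].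
by apply: cvgB; [exact: cvg_cst|exact: c2].
Qed.

Lemma first_radius_le (k r0 dl : R) : 0 < k -> k * r0 <= 2^-1 -> dl <= r0 ->
  k / 2 * (r0 + dl / 2) <= 2^-1.
Proof.
move=> k0 kr0 dlr0; have h : k * dl <= k * r0 by rewrite ler_wpM2l// ltW.
have -> : k / 2 * (r0 + dl / 2) = k * r0 / 2 + k * dl / 4 by field.
lra.
Qed.

Lemma first_rate_bound (r0 dl : R) : 0 < r0 -> 0 < dl -> dl <= r0 ->
  0 < dl / (4 * r0) <= 4^-1.
Proof.
move=> r00 dl0 dlr0; rewrite divr_gt0 ?mulr_gt0//=.
by rewrite ler_pdivrMr ?mulr_gt0// mulrA mulVf ?mul1r.
Qed.

(** With c = dl/(4 r0), (1-c)(r0+dl) >= r0 + dl - dl/4 - dl/4, which bounds the ratio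
    (r0+dl/2)/(r0+dl). The entry 1 of the maximum is harmless because k r0 <= 1/2 keeps v below 1/2
    <= 1-c. *)
Lemma first_ratio_le (k r0 dl v w : R) :
  0 < k -> k * r0 <= 2^-1 -> 0 < r0 -> 0 < dl -> dl <= r0 ->
  0 <= v -> v <= k / 2 * (r0 + dl / 2) -> k / 2 * (r0 + dl) <= w ->
  v * Num.max 1 w^-1 <= 1 - dl / (4 * r0).
Proof.
move=> k0 kr0 r00 dl0 dlr0 v0 vV wl; have V2 := first_radius_le k0 kr0 dlr0.
have /andP[] := first_rate_bound r00 dl0 dlr0; set c := dl / (4 * r0) => c0 c4.
have rd0 : 0 < k / 2 * (r0 + dl) by rewrite mulr_gt0 ?divr_gt0 ?addr_gt0.
have w0 : 0 < w by exact: lt_le_trans wl.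
rewrite maxr_pMr// ge_max mulr1; apply/andP; split; first by lra.
rewrite ler_pdivrMr//; apply: le_trans vV _.
apply: le_trans (_ : _ <= (1 - c) * (k / 2 * (r0 + dl))) _; last by rewrite ler_wpM2l//; lra.
rewrite mulrCA ler_wpM2l ?divr_ge0 ?(ltW k0)//.
have cE : c * r0 = dl / 4 by rewrite /c; field; rewrite lt0r_neq0.
have : c * dl <= c * r0 by rewrite ler_wpM2l// ltW.
by rewrite mulrBl mul1r mulrDr cE; lra.
Qed.

(** The first move of the source. [C1] depends on dl and Dx, which is admissible because only the
    rate has to be uniform. The square of q+1 comes from q+2 and (q+1)!/q!. *)
Lemma piece_taylor (k r0 dl Dx : R) (X Om : set (R * R)) :
  0 < k -> k * r0 <= 2^-1 -> 0 < r0 -> 0 < dl -> dl <= r0 ->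
  (forall x y, X x -> Om y -> dl <= enorm (x - y) <= Dx) -> exists2 C1 : R, 0 < C1 & forall x y z q,
  X x -> (forall w, enorm (w - y) < r0 -> Om w) -> enorm (z - y) <= r0 + dl / 2 ->
  cabs (psi 0 (scal k x - scal k z) - psi_jet q (scal k y - scal k z) 0 (scal k x - scal k y))
   <= C1 * (q.+1%:R ^+ 2 * (1 - dl / (4 * r0)) ^+ q).
Proof.
move=> k0 kr0 r00 dl0 dlr0 far; set c := dl / (4 * r0).
have /andP[c0 c4] : 0 < c <= 4^-1 by exact: first_rate_bound.
have V2 := first_radius_le k0 kr0 dlr0; set V := k / 2 * _ in V2.
have c1 : 0 <= 1 - c by lra.
(* What remains of the scaled distance r0 + dl to the centre after a displacement of r0 + dl/2. *)
pose a := k / 2 * (dl / 2); pose b := Num.max a (k / 2 * (Dx + (r0 + dl / 2))).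
have k2 : 0 < k / 2 by rewrite divr_gt0.
have a0 : 0 < a by rewrite mulr_gt0// divr_gt0.
have ab : a <= b by rewrite le_max lexx.
have [C C0 bC] := psi_bounded_ex a0 ab.
pose M := Num.max 1 a^-1; have M0 : 0 < M by rewrite lt_max ltr01.
exists (4 * C * M); first by rewrite !mulr_gt0.
move=> x y z q Xx ball zy.
have Omy : Om y by apply: ball; rewrite subrr enorm0.
have xy : r0 + dl <= enorm (x - y).
  by apply: (ball_dist r00 dl0 ball) => w Ow; have /andP[] := far _ _ Xx Ow.
have /andP[_ xD] := far _ _ Xx Omy.
pose w := scal k x - scal k y; pose v := scal k y - scal k z.
have vE : cabs v = k / 2 * enorm (z - y) by rewrite /v cabs_scal// enormB.
have wE : cabs w = k / 2 * enorm (x - y) by rewrite /w cabs_scal.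
have vV : cabs v <= V by rewrite vE /V ler_wpM2l// ltW.
have aw : a <= cabs w - cabs v.
  have h1 := ler_wpM2l (ltW k2) xy; have h2 := vV; rewrite /V in h2.
  by rewrite /a wE; lra.
have wb : cabs w + cabs v <= b.
  rewrite le_max; apply/orP; right; rewrite wE vE -mulrDr ler_wpM2l ?(ltW k2)//.
  exact: lerD.
have := psi_taylor 0 q (ltW C0) bC a0 aw wb.
rewrite {1}/w {1}/v subrKA -/w -/v => h; apply: le_trans h _.
have th : (cabs v * sig w) ^+ q <= (1 - c) ^+ q.
  rewrite lerXn2r ?nnegrE ?mulr_ge0 ?cabs_ge0 ?(ltW (sig_gt0 w)) //.
  by apply: (first_ratio_le k0) => //; rewrite ?cabs_ge0// wE ler_wpM2l// ltW.
rewrite add0n factS natrM mulfK; last by rewrite lt0r_neq0 ?fact_gt0r.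
rewrite expr1 -/M.
have q2 : q.+2%:R <= 2 * q.+1%:R :> R by rewrite mulr_natl mulr2n -natr1 lerD2l ler1n.
have cv1 : cabs v <= 1 by apply: le_trans vV _; lra.
apply: (@le_trans _ _ (2 * (C * (2 * q.+1%:R) * q.+1%:R * 1 * M * (1 - c) ^+ q))); last first.
  by apply: eqle; ring.
rewrite ler_wpM2l//.
apply: ler_pM th; rewrite ?exprn_ge0 ?mulr_ge0 ?cabs_ge0 ?(ltW C0) ?(ltW M0) ?(ltW (sig_gt0 w))//.
apply: ler_wpM2r; first exact: ltW.
apply: ler_pM => //; rewrite ?mulr_ge0 ?cabs_ge0 ?(ltW C0)//.
by apply: ler_wpM2r => //; apply: ler_wpM2l => //; exact: ltW.
Qed.

Lemma psi_curve_cmeas (k : R) (x : R * R) (g : R -> R * R) m :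
  0 < k -> smooth_curve g -> (forall t, x <> g t) ->
  cmeas (fun t => psi m (scal k x - scal k (g t))).
Proof.
move=> k0 [g1 g2] xg; pose w t := scal k x - scal k (g t).
have dg t : cderiv (fun t => toC (g t)) t (toC (vel g t)).
  by split; [exact: (smooth_is_derive 0 t g1)|exact: (smooth_is_derive 0 t g2)].
have dw t : cderiv w t (- (k / 2)%:C * toC (vel g t)).
  have -> : w = fun t => scal k x + - (k / 2)%:C * toC (g t).
    by apply/funext => u; rewrite /w mulNr.
  by apply: (cderiv_eq (cderivD (cderivc _ t) (cderivZ _ (dg t)))); rewrite add0r.
have w0 t : 0 < cabs (w t).
  rewrite /w cabs_scal// mulr_gt0 ?divr_gt0// lt0r enorm_ge0 andbT enorm_eq0 subr_eq0.
  exact/eqP/xg.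
have dp t := cderiv_psi m (dw t) (w0 t).
have c1 := is_derive_continuous (fun t => (dp t).1).
have c2 := is_derive_continuous (fun t => (dp t).2).
have := cmeas_continuous c1 c2.
by rewrite [X in cmeas X](_ : _ = (fun t => psi m (w t)))//; apply/funext => t; case: (psi m (w t)).
Qed.

(* [l] is the piece of the curve, [(i, j)] the term of [jet] in the Taylor
   polynomial about the disc centre chosen for that piece. *)
Definition jet_index P q : seq (nat * (nat * nat)) :=
  [seq (l, p) | l <- index_iota 0 P, p <- [seq (i, j) | i <- index_iota 0 q.+1, j <- index_iota 0 i.+1]].

Lemma sum_jet_index P q (F : nat -> nat -> nat -> R[i]) :
  \sum_(e <- jet_index P q) F e.1 e.2.1 e.2.2 =
  \sum_(l < P) \sum_(i < q.+1) \sum_(j < i.+1) F l i j.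
Proof.
rewrite /jet_index big_allpairs_dep big_mkord; apply: eq_bigr => l _.
rewrite big_allpairs_dep big_mkord; apply: eq_bigr => i _.
by rewrite big_mkord.
Qed.

(** The coefficients must be integrated in t, so the disc centre may not vary freely with t:
    finitely many centres, constant on pieces of the curve, make them measurable. The Taylor
    polynomial of order q about a centre is recentred with E q in place of q, where E makes up for
    coefficients growing like (4 sgm)^q. *)
Lemma curve_expansion (k sgm KG r0 dl Dx : R) (X Om : set (R * R)) (J E : nat)
    (g : R -> R * R) (d : R -> R[i]) (nu : R -> R) :
  0 < k -> 1 <= sgm -> 1 <= KG -> k * r0 <= 2^-1 -> 0 < r0 -> 0 < dl -> dl <= r0 ->
  8 * sgm <= 4 ^+ E -> (0 < E)%N ->
  (forall x y, X x -> Om y -> dl <= enorm (x - y) <= Dx) ->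
  (forall y, (forall w, enorm (w - y) < r0 -> Om w) -> good k sgm X KG J y) ->
  smooth_curve g ->
  (forall t e, 0 <= t <= 1 -> 0 < e ->
     exists2 y, enorm (g t - y) < r0 + e & forall w, enorm (w - y) < r0 -> Om w) ->
  (forall x t, X x -> x <> g t) ->
  rint nu -> cmeas d -> (forall t, D t -> cabs (d t) <= nu t) ->
  exists2 K : R, 0 <= K & forall q,
    apx k sgm X (2 ^ J * (E * q)) (K * (4 * sgm * 2 ^+ ((2 ^ J).-1 * E)) ^+ q)
      (K * (q.+1%:R ^+ 2 * (1 - dl / (4 * r0)) ^+ q))
      (fun x => cint (fun t => psi 0 (scal k x - scal k (g t)) * d t)).
Proof.
move=> k0 sgm1 KG1 kr0 r00 dl0 dlr0 E8 E0 far HG sg centers Xg inu md dnu.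
have sgm0 : 0 < sgm by exact: lt_le_trans sgm1.
set c := dl / (4 * r0).
have /andP[c0 c4] : 0 < c <= 4^-1 by exact: first_rate_bound.
have [C1 C10 C1P] := piece_taylor k0 kr0 r00 dl0 dlr0 far.
have V2 := first_radius_le k0 kr0 dlr0; set V := k / 2 * _ in V2.
have V0 : 0 < V by rewrite mulr_gt0 ?divr_gt0 ?addr_gt0 ?divr_gt0.
have [Lg Lg0 LgP] := curve_lipschitz sg.
(* Over a parameter length 1/P the curve moves by at most dl/4. The centre is chosen at the left end
   with slack dl/4, so it serves the whole piece within r0 + dl/2. *)
have [P P0 LP] : exists2 P : nat, (0 < P)%N & Lg <= dl / 4 * P%:R.
  exists (Num.bound (Lg / (dl / 4))).+1 => //.
  rewrite mulrC -ler_pdivrMr ?divr_gt0//.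
  have := archi_boundP (_ : 0 <= Lg / (dl / 4)); rewrite divr_ge0 ?divr_ge0 ?(ltW dl0)// => /(_ isT).
  by move=> h; apply: le_trans (ltW h) _; rewrite ler_nat.
have PR : 0 < P%:R :> R by rewrite ltr0n.
have dl40 : 0 < dl / 4 by rewrite divr_gt0.
have cen (l : nat) : exists y, (l <= P)%N ->
    enorm (g (l%:R / P%:R) - y) < r0 + dl / 4 /\ forall w, enorm (w - y) < r0 -> Om w.
  have [lP|_] := leqP l P; last by exists 0.
  have l01 : 0 <= (l%:R : R) / P%:R <= 1.
    by rewrite divr_ge0//= ler_pdivrMr// mul1r ler_nat.
  by have [y yl yb] := centers _ _ l01 dl40; exists y.
have [yc ycP] := choice cen.
(* Half-open pieces with l from 0 to P: the last one starts at 1 and catches t = 1, so each t in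
   [0,1] lies in exactly one. *)
pose A l : set (measurableTypeR R) := [set` `[l%:R / P%:R, l.+1%:R / P%:R[%R].
pose ind l t : R := \1_(A l) t.
have loc t : D t -> exists2 l0, (l0 <= P)%N & (forall l, ind l t = (l == l0)%:R) /\
    enorm (g t - yc l0) <= r0 + dl / 2.
  rewrite /= in_itv /= => /andP[t0 t1].
  have tP0 : 0 <= t * P%:R by rewrite mulr_ge0.
  have /andP[h1 h2] := truncn_itv tP0; set l0 := Num.truncn _ in h1 h2.
  have l0P : (l0 <= P)%N by rewrite -(ler_nat R); apply: le_trans h1 _; rewrite ler_piMl.
  exists l0 => //; split.
    move=> l; rewrite /ind indicE; congr (nat_of_bool _)%:R.
    apply/idP/eqP.
      rewrite inE /A /= in_itv /= => /andP[]; rewrite ler_pdivrMr// ltr_pdivlMr// => a1 a2.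
      have := le_lt_trans a1 h2; have := le_lt_trans h1 a2; rewrite !ltr_nat !ltnS => b1 b2.
      by apply/eqP; rewrite eqn_leq b1 b2.
    by move=> ->; rewrite inE /A /= in_itv /= ler_pdivrMr// ltr_pdivlMr// h1 h2.
  have [yd _] := ycP l0 l0P.
  have l01 : 0 <= (l0%:R : R) / P%:R <= 1.
    by rewrite divr_ge0//= ler_pdivrMr// mul1r ler_nat.
  have t01 : 0 <= t <= 1 by rewrite t0.
  have := LgP t _ t01 l01 => gl.
  have tl : `|t - l0%:R / P%:R| <= P%:R^-1.
    rewrite ger0_norm; last by rewrite subr_ge0 ler_pdivrMr.
    rewrite -(ler_pM2r PR) mulVf ?lt0r_neq0// mulrBl divfK ?lt0r_neq0//.
    by rewrite lerBlDl natr1 ltW.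
  have gl4 : enorm (g t - g (l0%:R / P%:R)) <= dl / 4.
    apply: le_trans gl _; apply: le_trans (ler_wpM2l Lg0 tl) _.
    by rewrite ler_pdivrMr.
  rewrite -(subrKA (g (l0%:R / P%:R))); apply: le_trans (enormD _ _) _.
  by apply: le_trans (lerD gl4 (ltW yd)) _; apply: eqle; field.
pose vl l t := scal k (yc l) - scal k (g t).
have vlV l t : enorm (g t - yc l) <= r0 + dl / 2 -> cabs (vl l t) <= V.
  by move=> h; rewrite /vl cabs_scal// enormB ler_wpM2l// divr_ge0// ltW.
pose kp l i j t : R[i] := (ind l t)%:C *
  ((i`!%:R^-1)%:C * ('C(i, j)%:R * (vl l t ^+ j * (- (vl l t)^*) ^+ (i - j)))).
pose kap (e : nat * (nat * nat)) t := kp e.1 e.2.1 e.2.2 t.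
pose B (i j : nat) : R := 'C(i, j)%:R * V ^+ i / i`!%:R.
have B0 i j : 0 <= B i j by rewrite divr_ge0// mulr_ge0// exprn_ge0// ltW.
have mkap e : cmeas (kap e).
  have mA : measurable (A e.1) by exact: measurable_itv.
  apply: cmeasM; first by apply: cmeas_real; exact: (measurable_indic mA).
  apply: cmeasM; first exact: cmeas_cst.
  apply: cmeasM; first exact: cmeas_cst.
  have mv : cmeas (vl e.1) by exact: cmeas_curve.
  apply: cmeasM; apply: cmeasX => //.
  under eq_fun => t do rewrite -mulN1r.
  by apply: cmeasM; [exact: cmeas_cst|exact: cmeas_conj].
have kB l i j t : D t -> cabs (kp l i j t) <= B i j.
  move=> Dt; have [l0 _ [indE gy]] := loc t Dt.
  rewrite /kp indE; have [->|_] := eqVneq l l0; last by rewrite mul0r cabs0 B0.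
  rewrite mul1r !cabsM cabs_real ger0_norm ?invr_ge0// cabs_nat !cabsX cabsN cabs_conj.
  have [ji|ij] := leqP j i; last by rewrite /B bin_small// !mul0r mulr0.
  rewrite -exprD subnKC// /B mulrC ler_wpM2r ?invr_ge0// ler_wpM2l//.
  by rewrite lerXn2r ?nnegrE ?cabs_ge0 ?(ltW V0)// vlV.
pose Iv : R := (\int[mu]_(t in D) nu t)%R.
have nu0 t : D t -> 0 <= nu t by move=> /dnu; apply: le_trans; exact: cabs_ge0.
have Iv0 : 0 <= Iv by apply: Rintegral_ge0.
pose KL := P.+1%:R * (2 * Iv) * (KG * 3 ^+ J).
have KL0 : 0 <= KL by rewrite !mulr_ge0 ?exprn_ge0// (le_trans ler01).
exists (2 * Iv * C1 + KL); first by rewrite addr_ge0// !mulr_ge0// ltW.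
move=> q.
pose co l i j := cint (fun t => kp l i j t * d t).
have coB l i j : cabs (co l i j) <= 2 * Iv * ('C(i, j)%:R * V ^+ i / i`!%:R).
  have h t : D t -> cabs (kp l i j t * d t) <= B i j * nu t.
    by move=> Dt; rewrite cabsM ler_pM ?cabs_ge0 ?kB ?dnu.
  apply: le_trans (cint_le (cmeasM (mkap (l, (i, j))) md) inu h) _.
  by apply: eqle; rewrite -/Iv /B; ring.
have gd (l : 'I_P.+1) m' : (`|m'| <= 0 + q)%N ->
    apx k sgm X (2 ^ J * (E * q)) (KG * 3 ^+ J * 2 ^+ ((2 ^ J).-1 * (E * q)))
      (KG * 3 ^+ J * 4^-1 ^+ (E * q)) (fun x => psih sgm m' (scal k x - scal k (yc l))).
  move=> m'q; have lP : (l <= P)%N by rewrite -ltnS.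
  have [_ ball] := ycP l lP; apply: (HG _ ball).
  by rewrite add0n in m'q; apply: leq_trans m'q _; rewrite leq_pmull.
have KGJ0 : 0 <= KG * 3 ^+ J by rewrite mulr_ge0 ?exprn_ge0// (le_trans ler01).
pose LL : R := KG * 3 ^+ J * 2 ^+ ((2 ^ J).-1 * (E * q)).
pose ee : R := KG * 3 ^+ J * 4^-1 ^+ (E * q).
have LL0 : 0 <= LL by rewrite mulr_ge0// exprn_ge0.
have ee0 : 0 <= ee by rewrite mulr_ge0// exprn_ge0.
have Iv20 : 0 <= 2 * Iv by rewrite mulr_ge0.
pose T : R := 2 * Iv * (4 * sgm) ^+ q.
have T0 : 0 <= T by rewrite mulr_ge0// exprn_ge0// mulr_ge0// ltW.
have geo : \sum_(i < q.+1) (4 * V * sgm) ^+ i <= (4 * sgm) ^+ q.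
  have b0 : 0 <= 4 * V * sgm by exact: mulr_ge0 (mulr_ge0 (ler0n R 4) (ltW V0)) (ltW sgm0).
  have b2 : 4 * V * sgm <= 2 * sgm.
    by rewrite ler_wpM2r ?(ltW sgm0)//; lra.
  have b1 : 1 <= 2 * sgm by lra.
  apply: (@le_trans _ _ (\sum_(i < q.+1) (2 * sgm) ^+ q)).
    apply: ler_sum => i _; apply: (@le_trans _ _ ((2 * sgm) ^+ i)).
      by rewrite lerXn2r ?nnegrE// (le_trans _ b2).
    by rewrite ler_weXn2l// -ltnS.
  rewrite sumr_const card_ord -(mulr_natl ((2 * sgm) ^+ q)).
  rewrite (_ : 4 * sgm = 2 * (2 * sgm)); last by ring.
  rewrite [leRHS]exprMn ler_wpM2r ?exprn_ge0 ?(le_trans ler01 b1)//.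
  by rewrite -natrX ler_nat ltn_expl.
have ap (l : 'I_P.+1) : apx k sgm X (2 ^ J * (E * q)) (T * LL) (T * ee)
    (fun x => \sum_(i < q.+1) \sum_(j < i.+1) co l i j * psi (shift i j 0) (scal k x - scal k (yc l))).
  have h := @apx_jet _ k sgm X sgm1 V (2 * Iv) (co l) (fun x => scal k x - scal k (yc l)) 0 0 q
    (2 ^ J * (E * q)) LL ee (ltW V0) Iv20 LL0 ee0 (fun i j _ => coB l i j) (leqnn 0) (gd l).
  move: h; cbv zeta; set T' := (X in apx _ _ _ _ (X * _) _ _).
  have TT : T' <= T.
    by rewrite /T' /T fact0 !expr0 mulr1 mulr1 mulr1 ler_wpM2l.
  by move=> h; apply: (apx_mono h (leqnn _)); rewrite ler_wpM2r.
have key x : X x -> cabs (cint (fun t => psi 0 (scal k x - scal k (g t)) * d t) -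
    \sum_(l < P.+1) \sum_(i < q.+1) \sum_(j < i.+1)
      co l i j * psi (shift i j 0) (scal k x - scal k (yc l))) <=
    2 * (C1 * (q.+1%:R ^+ 2 * (1 - c) ^+ q) * Iv).
  move=> Xx; rewrite -(sum_jet_index P.+1 q (fun l i j =>
    co l i j * psi (shift i j 0) (scal k x - scal k (yc l)))).
  apply: (cint_expansion (kap := kap) (B := fun e => B e.2.1 e.2.2)
    (G := fun e => psi (shift e.2.1 e.2.2 0) (scal k x - scal k (yc e.1))) inu md dnu _ mkap) => //.
  - by apply: psi_curve_cmeas => // t; exact: Xg.
  - by move=> e t Dt; exact: kB.
  move=> t Dt; have [l0 l0P [indE gy]] := loc t Dt.
  have [_ ball] := ycP l0 l0P.
  (* At a given t the indicators select one piece, and the triple sum collapses to a single Taylor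
     polynomial. *)
  rewrite (_ : \sum_(e <- _) _ = psi_jet q (scal k (yc l0) - scal k (g t)) 0 (scal k x - scal k (yc l0))).
    exact: C1P Xx ball gy.
  rewrite (sum_jet_index P.+1 q (fun l i j => kp l i j t * psi (shift i j 0) (scal k x - scal k (yc l)))).
  have l0lt : (l0 < P.+1)%N by [].
  rewrite (bigD1 (Ordinal l0lt))//= [X in _ + X]big1 ?addr0; last first.
    move=> l ll; rewrite big1// => i _; rewrite big1// => j _.
    rewrite /kp indE (_ : (l == l0 :> nat) = false) ?mul0r//.
    by apply/negbTE; apply: contra ll => /eqP e; apply/eqP/val_inj.
  apply: eq_bigr => i _; rewrite /jet mulr_sumr; apply: eq_bigr => j _.
  by rewrite /kp indE eqxx mul1r -mulrA.
have ap2 := @apx_sum R k sgm X 'I_P.+1 (index_enum _) xpredT (2 ^ J * (E * q))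
  (fun=> T * LL) (fun=> T * ee) _ (fun l _ => ap l).
have ap3 := @apx_near R k sgm X _ _ _ _ _
  (fun x => cint (fun t => psi 0 (scal k x - scal k (g t)) * d t)) ap2 key.
apply: (apx_mono ap3 (leqnn _)).
  rewrite sumr_const card_ord -(mulr_natl (T * LL)).
  have -> : P.+1%:R * (T * LL) = KL * (4 * sgm * 2 ^+ ((2 ^ J).-1 * E)) ^+ q.
    by rewrite /T /LL /KL mulnA exprM [in RHS]exprMn; ring.
  rewrite ler_wpM2r ?exprn_ge0 ?mulr_ge0 ?(ltW sgm0)//.
  by rewrite lerDr; exact: mulr_ge0 Iv20 (ltW C10).
rewrite sumr_const card_ord -(mulr_natl (T * ee)) [leRHS]mulrDl lerD//.
  by apply: eqle; ring.
have -> : P.+1%:R * (T * ee) = KL * (4 * sgm * 4^-1 ^+ E) ^+ q.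
  by rewrite /T /ee /KL exprM [in RHS]exprMn; ring.
(* 4 sgm 4^-E <= 1/2 <= 1-c: the recentring error decays faster than the Taylor error, which alone
   decides the rate. *)
rewrite ler_wpM2l//; apply: (@le_trans _ _ ((1 - c) ^+ q)).
  have u0 : 0 <= 4 * sgm * 4^-1 ^+ E by rewrite mulr_ge0 ?mulr_ge0 ?exprn_ge0// ltW.
  have u1 : 0 <= 1 - c by lra.
  rewrite lerXn2r ?nnegrE//.
  apply: (@le_trans _ _ 2^-1); last by lra.
  rewrite exprVn ler_pdivrMr ?exprn_gt0//.
  apply: (@le_trans _ _ (2^-1 * (8 * sgm))); first by apply: eqle; field.
  by rewrite ler_wpM2l.
rewrite ler_peMl ?exprn_ge0//; first by lra.
by rewrite exprn_ege1// ler1n.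
Qed.

End CurveExpansion.

(** * Norms along the boundary curves *)

Section ArcNorm.
Variable R : realType.
Local Notation D := (`[0%R, 1%R]%classic : set (measurableTypeR R)).
Local Notation mu := (@lebesgue_measure R).

(** The integral of a nonnegative function is a supremum over simple functions below it, hence
    monotone for arbitrary integrands. This lets [L2norm_le] hold for any f. *)
Lemma ge0_le_integral_nonmeas (f1 f2 : R -> \bar R) :
  (forall t, D t -> (0 <= f1 t)%E) -> (forall t, D t -> (f1 t <= f2 t)%E) ->
  (\int[mu]_(t in D) f1 t <= \int[mu]_(t in D) f2 t)%E.
Proof.
move=> f10 f12; rewrite !ge0_integralE//; last first.
  by move=> t Dt; apply: le_trans (f10 t Dt) (f12 t Dt).
apply: ereal_sup_le => _ [h hf <-]; exists h => // t; apply: le_trans (hf t) _.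
by rewrite !patchE; case: ifPn => //; rewrite inE => /f12.
Qed.

Lemma integral_cst01 (a : R) : (\int[mu]_(t in D) a%:E = a%:E)%E.
Proof.
rewrite integral_cst /=; last exact: measurableD01.
by rewrite lebesgue_measure_itv /= lte_fin ltr01 oppr0 adde0 mule1.
Qed.

Lemma L2norm_le (m : nat) (gam : 'I_m -> R -> R * R) :
  (forall j, smooth_curve (gam j)) ->
  exists2 L : R, 0 <= L & forall (f : R * R -> R[i]) (e : R), 0 <= e ->
    (forall j t, cabs (f (gam j t)) <= e) -> (L2norm gam f <= (e * L)%:E)%E.
Proof.
move=> sg.
have ex j : exists G : R, 0 <= G /\ forall t, 0 <= t <= 1 -> enorm (vel (gam j) t) <= G.
  by have [G G0 GP] := speed_bounded 0 1 (sg j); exists G.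
have [G GP] := choice ex.
have S0 : 0 <= \sum_j G j by apply: sumr_ge0 => j _; exact: (GP j).1.
exists (Num.sqrt (\sum_j G j)); first exact: sqrtr_ge0.
move=> f e e0 fe.
have -> : ((e * Num.sqrt (\sum_j G j))%:E = sqrte (e ^+ 2 * \sum_j G j)%:E)%E.
  by rewrite /sqrte sqrtrM ?sqr_ge0// sqrtr_sqr ger0_norm.
rewrite /L2norm lee_sqrt; last by rewrite lee_fin mulr_ge0// sqr_ge0.
rewrite /arc_integral mulr_sumr -sumEFin; apply: lee_sum => j _.
rewrite -[leRHS]integral_cst01; apply: ge0_le_integral_nonmeas => t Dt.
  by rewrite -EFinM lee_fin mulr_ge0 ?sqr_ge0 ?enorm_ge0.
rewrite -EFinM lee_fin ler_pM ?sqr_ge0 ?enorm_ge0//.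
  by rewrite lerXn2r ?nnegrE ?cabs_ge0.
by apply: (GP j).2; move: Dt; rewrite /= in_itv.
Qed.

Lemma in_L2_density (m : nat) (gam : 'I_m -> R -> R * R) (f : R * R -> R[i]) j :
  smooth_curve (gam j) -> in_L2 gam f ->
  exists nu : R -> R, [/\ rint nu,
    cmeas (fun t => f (gam j t) * (speed (gam j) t)%:C) &
    forall t, D t -> cabs (f (gam j t) * (speed (gam j) t)%:C) <= nu t].
Proof.
move=> sg [mf nf]; have [m1 m2] := mf j.
have cs := speed_continuous sg.
have ms : measurable_fun D (speed (gam j) : measurableTypeR R -> R).
  by apply: measurable_funTS; exact: continuous_measurable_fun.
pose a t := cabs (f (gam j t)).
have ma2 : measurable_fun D (fun t : measurableTypeR R => a t ^+ 2 : R).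
  rewrite [X in measurable_fun _ X](_ : _ = (fun t =>
    complex.Re (f (gam j t)) ^+ 2 + complex.Im (f (gam j t)) ^+ 2)).
    by apply: measurable_funD; apply: measurable_funX.
  by apply/funext => t; rewrite /a sqr_cabs.
have i1 : rint (speed (gam j)).
  apply: continuous_compact_integrable; first exact: segment_compact.
  exact: continuous_subspaceT.
have i2 : rint (fun t => a t ^+ 2 * speed (gam j) t).
  apply/integrableP; split; first by apply/measurable_EFinP; exact: measurable_funM.
  have : (arc_integral gam (fun x => ((cabs (f x)) ^+ 2)%:E) < +oo)%E.
    by move: nf; rewrite /L2norm; case: (arc_integral _ _) => [r _| |_] //; rewrite ltry.
  rewrite /arc_integral (bigD1 j)//= => h; apply: le_lt_trans h.
  apply: (@le_trans _ _ (\int[mu]_(t in D) ((a t ^+ 2)%:E * (speed (gam j) t)%:E)))%E.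
    apply: ge0_le_integral_nonmeas => t Dt; first by rewrite /= lee_fin.
    by rewrite -EFinM /= lee_fin ger0_norm// mulr_ge0 ?sqr_ge0 ?enorm_ge0.
  rewrite leeDl// sume_ge0// => i _; apply: integral_ge0 => t _.
  by rewrite -EFinM lee_fin mulr_ge0 ?sqr_ge0 ?enorm_ge0.
(* Square integrability yields an integrable majorant through a <= 1 + a^2. *)
exists (fun t => speed (gam j) t + a t ^+ 2 * speed (gam j) t); split.
- exact: (integrableD _ i1 i2).
- by apply: cmeasM; [split|exact: cmeas_real].
move=> t Dt; rewrite cabsM cabs_real ger0_norm ?enorm_ge0//.
rewrite -[X in X + _]mul1r -mulrDl ler_wpM2r ?enorm_ge0// -/(a t).
have := sqr_ge0 (a t - 1); rewrite sqrrB expr1n => h.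
have a0 : 0 <= a t by exact: cabs_ge0.
lra.
Qed.

End ArcNorm.

(** * From lists of waves to the normalised Hankel sum *)

Section HankelSum.
Variable R : realType.
Implicit Types (k rho sgm : R).

Lemma sqrt_le_sqr (x y : R) : 0 <= y -> x <= y ^+ 2 -> Num.sqrt x <= y.
Proof. by move=> y0 xy; rewrite -(ger0_norm y0) -sqrtr_sqr ler_wsqrtr. Qed.

Lemma hankel1_bound k rho : 0 < k -> 0 < rho ->
  exists2 H : R, 0 <= H & forall n : int,
    cabs (hankel1 n (k * rho)) <= H * `|n|%N`!%:R * Num.max 1 (k / 2 * rho)^-1 ^+ `|n|%N.
Proof.
move=> k0 rho0; have a0 : 0 < k / 2 * rho by rewrite mulr_gt0// divr_gt0.
have [H H0 HP] := psi_bounded_ex a0 (lexx _).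
exists H; first exact: ltW.
move=> n; have er : enorm (rho, 0 : R) = rho.
  by rewrite /enorm /= expr0n addr0 sqrtr_sqr gtr0_norm.
have e0 : 0 < enorm (rho, 0 : R) by rewrite er.
have := hankel1_psi n k0 e0; rewrite er => hE.
have cw : cabs ((k / 2)%:C * toC (rho, 0 : R)) = k / 2 * rho.
  by rewrite cabsM cabs_real cabs_toC er gtr0_norm// divr_gt0.
have ci : cis_angle n (rho, 0 : R) = 1.
  rewrite /cis_angle er /= divff ?lt0r_neq0// mul0r -[1 +i* 0]/(1 : R[i]).
  exact: exp1rz.
rewrite -[hankel1 _ _]mulr1 -ci hE.
by apply: le_trans (HP _ _ _) _; rewrite /sig cw ?lexx.
Qed.

(** Collecting equal orders and multiplying by H_n(k rho) gives c_n; by [hankel1_neq0] the quotient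
    in [hankel_sum] cancels. The factor n! in the growth of H_n(k rho) cancels against the
    normalisation of [psih], leaving only S^n. *)
Lemma apx_hankel_sum k sgm (X : set (R * R)) N (L e H S rho : R) (g : R * R -> R[i]) N' :
  0 < k -> 0 < rho -> 1 <= sgm -> 0 <= H -> 1 <= S ->
  (forall n : int, cabs (hankel1 n (k * rho)) <= H * `|n|%N`!%:R * S ^+ `|n|%N) ->
  (forall x, X x -> 0 < enorm x) -> (N <= N')%N ->
  apx k sgm X N L e g ->
  exists c : int -> R[i],
    (forall x, X x -> cabs (g x - hankel_sum k rho N' c x) <= e) /\
    weighted_coef_norm N' c <= 2 * N'.+1%:R * (H * S ^+ N * L).
Proof.
move=> k0 rho0 sgm1 H0 S1 HP X0 NN [s [sN sL se]].
have sgm0 : 0 < sgm by exact: lt_le_trans sgm1.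
have h0 n : hankel1 n (k * rho) != 0 by apply: hankel1_neq0; exact: mulr_gt0.
pose b (n : int) : R[i] := \sum_(p <- s | p.2 == n) p.1 * (`|n|%N`!%:R * sgm ^+ `|n|%N)^-1%:C.
pose idx (j : 'I_(2 * N').+1) : int := j%:Z - N'%:Z.
exists (fun n => hankel1 n (k * rho) * b n); split.
  move=> x Xx; apply: le_trans (se x Xx); apply: eqle; congr (cabs (_ - _)).
  rewrite /hankel_sum /wave_sum.
  transitivity (\sum_(j < (2 * N').+1) \sum_(p <- s | p.2 == idx j) p.1 * psih sgm p.2 (scal k x)).
    apply: eq_bigr => j _; rewrite -/(idx j).
    have -> : hankel1 (idx j) (k * rho) * b (idx j) *
       (hankel1 (idx j) (k * enorm x) / hankel1 (idx j) (k * rho)) * cis_angle (idx j) x =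
       b (idx j) * (hankel1 (idx j) (k * enorm x) * cis_angle (idx j) x).
      by field; exact: h0.
    rewrite hankel1_psi ?X0// -/(scal k x) /b mulr_suml; apply: eq_bigr => p /eqP pj.
    by rewrite /psih pj mulrA.
  (* Each entry of the list has order at most N' in modulus, hence is counted for exactly one index
     j. *)
  rewrite (exchange_big_dep xpredT)//= big_seq [RHS]big_seq; apply: eq_bigr => p ps.
  have pN : (`|p.2| <= N')%N by move/allP: sN => /(_ p ps) h; exact: leq_trans NN.
  have jP : (`|(p.2 + N'%:Z)%R : int|%N < (2 * N').+1)%N by lia.
  have jE : (`|(p.2 + N'%:Z)%R : int|%N)%:Z = p.2 + N'%:Z by lia.
  rewrite (big_pred1 (Ordinal jP))// => j /=; rewrite /idx -val_eqE /=.
  apply/eqP/eqP => [->|->]; first by rewrite subrK absz_nat.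
  by rewrite jE addrK.
have L0 : 0 <= L by apply: le_trans sL; apply: sumr_ge0 => p _; exact: cabs_ge0.
have sk0 : 0 <= H * S ^+ N * L by rewrite !mulr_ge0// exprn_ge0// (le_trans ler01).
have cb n : cabs (hankel1 n (k * rho) * b n) <= H * S ^+ N * L.
  have [nN|nN] := leqP `|n|%N N; last first.
    rewrite /b big_seq_cond big1 ?mulr0 ?cabs0// => p /andP[ps /eqP pn].
    by move/allP: sN => /(_ p ps); rewrite pn leqNgt nN.
  have f0 := fact_gt0r R `|n|%N.
  have bL : cabs (b n) <= `|n|%N`!%:R^-1 * L.
    apply: le_trans (cabs_sum _ _ _) _.
    apply: (@le_trans _ _ (\sum_(p <- s | p.2 == n) cabs p.1 * `|n|%N`!%:R^-1)).
      apply: ler_sum => p _; rewrite cabsM cabs_real ger0_norm; last first.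
        by rewrite invr_ge0 mulr_ge0// exprn_ge0// ltW.
      rewrite ler_wpM2l ?cabs_ge0// lef_pV2 ?posrE ?mulr_gt0 ?exprn_gt0//.
      by rewrite ler_peMr ?(ltW f0)// exprn_ege1.
    rewrite -mulr_suml mulrC ler_wpM2l ?invr_ge0//; apply: le_trans sL.
    rewrite big_mkcond; apply: ler_sum => p _; case: ifP => // _; exact: cabs_ge0.
  rewrite cabsM; apply: le_trans (ler_pM _ _ (HP n) bL) _; rewrite ?cabs_ge0//.
  have -> : H * `|n|%N`!%:R * S ^+ `|n|%N * (`|n|%N`!%:R^-1 * L) = H * S ^+ `|n|%N * L.
    by field; rewrite lt0r_neq0.
  by rewrite ler_wpM2r// ler_wpM2l// ler_weXn2l.
set B := H * S ^+ N * L in sk0 cb *.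
apply: sqrt_le_sqr; first exact: mulr_ge0 (mulr_ge0 (ler0n R 2) (ler0n R _)) sk0.
(* There are 2 N' + 1 terms, each of weight at most 2 (N'+1). *)
have -> : (2 * N'.+1%:R * B) ^+ 2 = (2 * N'.+1%:R) * (2 * N'.+1%:R * B ^+ 2) by ring.
apply: (@le_trans _ _ (\sum_(j < (2 * N').+1) 2 * N'.+1%:R * B ^+ 2)).
  apply: ler_sum => j _; rewrite -/(idx j) ler_pM ?sqrtr_ge0 ?sqr_ge0//; last first.
    by rewrite lerXn2r ?nnegrE ?cabs_ge0.
  apply: sqrt_le_sqr; first by rewrite mulr_ge0.
  have nN : `|idx j|%:~R <= N'%:R :> R.
    by rewrite -[N'%:R]/(N'%:~R) ler_int /idx; case: j => j /= jN; lia.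
  have -> : ((idx j)%:~R : R) ^+ 2 = `|idx j|%:~R ^+ 2.
    by rewrite intr_norm real_normK ?num_real.
  have a0 : 0 <= (`|idx j|%:~R : R) by rewrite ler0z.
  have h2 : (`|idx j|%:~R : R) ^+ 2 <= N'%:R ^+ 2 by rewrite lerXn2r ?nnegrE.
  have n0 : 0 <= N'%:R :> R by [].
  rewrite -(natr1 N'); nra.
rewrite sumr_const card_ord -(mulr_natl (2 * N'.+1%:R * B ^+ 2)).
apply: ler_wpM2r; first exact: mulr_ge0 (mulr_ge0 (ler0n R 2) (ler0n R _)) (sqr_ge0 _).
by rewrite mulr_natl -mulrnA ler_nat; lia.
Qed.

End HankelSum.

(** * Approximation of the single layer potential *)

Section SourceApproximation.
Variable R : realType.
Local Notation D := (`[0%R, 1%R]%classic : set (measurableTypeR R)).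

(* The homothety of centre [p] and ratio [t] maps the disc about [y] into [Om];
   when [t] is small, the disc about [p] is used instead. *)
Lemma star_clearance (Om : set (R * R)) (p y : R * R) (r rp D0 t : R) (w : R * R) :
  (forall x s, Om x -> 0 <= s <= 1 -> Om ((1 - s) *: p + s *: x)) ->
  (forall w, enorm (w - p) < rp -> Om w) -> (forall w, enorm (w - y) < r -> Om w) ->
  0 < r -> 0 < rp -> 0 <= D0 -> enorm (y - p) <= D0 -> 0 <= t <= 1 ->
  enorm (w - (p + t *: (y - p))) < r * rp / (r + D0) -> Om w.
Proof.
move=> star bp by_ r0 rp0 D00 yp t01 wa; have /andP[t0 t1] := t01.
have rD : 0 < r + D0 by rewrite ltr_wpDr.
pose ts := rp / (r + D0); have ts0 : 0 < ts by rewrite divr_gt0.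
have r1E : r * rp / (r + D0) = ts * r by rewrite /ts; ring.
set a := p + _ in wa; rewrite r1E in wa.
have [tt|tt] := leP ts t.
  have tp : 0 < t by exact: lt_le_trans tt.
  have -> : w = (1 - t) *: p + t *: (y + t^-1 *: (w - a)).
    rewrite scalerDr scalerA divff ?lt0r_neq0// scale1r scalerBl scale1r addrA.
    rewrite (_ : p - t *: p + t *: y = a); first by rewrite addrC subrK.
    by rewrite /a scalerBr -addrA [- _ + _]addrC.
  apply: star => //; apply: by_; rewrite addrC addKr enormZ ger0_norm ?invr_ge0//.
  rewrite mulrC ltr_pdivrMr//; apply: lt_le_trans wa _.
  by rewrite mulrC ler_wpM2l// ltW.
apply: bp; rewrite -(subrKA a); apply: le_lt_trans (enormD _ _) _.
have ap : enorm (a - p) <= ts * D0.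
  by rewrite /a addrC addKr enormZ ger0_norm// ler_pM ?enorm_ge0// ltW.
apply: lt_le_trans (ltr_leD wa ap) _; rewrite -mulrDr /ts divfK//.
exact: lt0r_neq0.
Qed.

Lemma bounded_enorm (Om : set (R * R)) : bounded_set Om ->
  exists2 B : R, 0 < B & forall y, Om y -> enorm y <= B.
Proof.
move=> [M [Mr MP]]; pose B := `|M| + 1; have B0 : 0 < B by rewrite ltr_wpDl.
have MB : M < B by rewrite ltr_pwDr// ler_norm.
exists (B + B); first by rewrite addr_gt0.
move=> y Oy; apply: le_trans (enorm_le y) _.
have := MP B MB y Oy; rewrite /= prod_normE ge_max => /andP[h1 h2].
exact: lerD.
Qed.

Lemma cis_angle0 (x : R * R) : cis_angle 0 x = 1. Proof. exact: expr0z. Qed.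

(** The order of quantifiers matters: [sgm], [A], [c] and [B] are fixed before delta and X, which
    makes the rates uniform, whereas K may depend on delta, X and f. *)
Lemma source_approx (Om : set (R * R)) (m : nat) (gam : 'I_m -> R -> R * R) (k Rad delta0 : R) :
  smooth_domain Om gam -> star_shaped Om -> 0 < k -> 0 < Rad -> disk Rad `<=` Om ->
  0 < delta0 ->
  exists (sgm A c : R) (B : nat),
    [/\ 1 <= sgm, 1 <= A, 0 < c, c * delta0 <= 4^-1 & (0 < B)%N] /\
    forall (delta Dx : R) (X : set (R * R)) (f : R * R -> R[i]),
    0 < delta -> delta <= delta0 ->
    (forall x y, X x -> Om y -> delta <= enorm (x - y) <= Dx) ->
    in_L2 gam f ->
    exists2 K : R, 0 <= K & forall q,
      apx k sgm X (B * q) (K * A ^+ q) (K * (q.+1%:R ^+ 2 * (1 - c * delta) ^+ q))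
        (fun x => arc_cintegral gam (fun y => Phi k x y * f y)).
Proof.
move=> sd [p Op star] k0 Rad0 dRO delta00.
have [rI rI0 rIP] := interior_ball sd.
have [DO DO0 DOP] := bounded_enorm (sd_bounded sd).
have [rp rp0 bp] := open_enorm (sd_open sd) Op.
(* The entry 1/(2k) keeps the scaled displacement k/2 (r0 + dl/2) of the first move below 1/2, as
   [first_ratio_le] demands. *)
pose r0 : R := Num.min rI (2 * k)^-1.
have r00 : 0 < r0 by rewrite lt_min rI0 invr_gt0 mulr_gt0.
have r0I : r0 <= rI by rewrite ge_min lexx.
have kr0 : k * r0 <= 2^-1.
  apply: (@le_trans _ _ (k * (2 * k)^-1)); first by rewrite ler_wpM2l ?(ltW k0)// ge_min lexx orbT.
  by apply: eqle; field; rewrite lt0r_neq0.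
(* A common radius for the touching discs and for the disc about the origin. *)
pose rm : R := Num.min r0 Rad.
have rm0 : 0 < rm by rewrite lt_min r00.
pose D0 : R := 2 * DO.
have D00 : 0 < D0 by rewrite mulr_gt0.
pose r1 : R := rm * rp / (rm + D0).
have r10 : 0 < r1 by rewrite divr_gt0 ?mulr_gt0// addr_gt0.
pose sgm : R := Num.max 1 (k * r1 / 4)^-1.
have sgm1 : 1 <= sgm by rewrite le_max lexx.
have sgm0 : 0 < sgm by exact: lt_le_trans sgm1.
pose eta : R := Num.min (r1 / 2) (32 * k * sgm)^-1.
have eta0 : 0 < eta by rewrite lt_min divr_gt0// invr_gt0 mulr_gt0// mulr_gt0.
have eta_r1 : eta <= r1 / 2 by rewrite ge_min lexx.
have eta_sgm : k / 2 * eta * sgm <= 64^-1.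
  apply: (@le_trans _ _ (k / 2 * (32 * k * sgm)^-1 * sgm)).
    rewrite ler_wpM2r ?(ltW sgm0)// ler_wpM2l ?divr_ge0 ?(ltW k0)//.
    by rewrite ge_min lexx orbT.
  by apply: eqle; field; rewrite !lt0r_neq0.
pose n := (Num.bound (D0 / eta)).+1.
have nP : D0 <= eta * n%:R.
  rewrite mulrC -ler_pdivrMr//.
  have := archi_boundP (_ : 0 <= D0 / eta); rewrite divr_ge0 ?(ltW D00) ?(ltW eta0)// => /(_ isT) h.
  by apply: le_trans (ltW h) _; rewrite ler_nat.
pose E := (Num.bound (8 * sgm)).+1.
have E8 : 8 * sgm <= 4 ^+ E.
  have := archi_boundP (_ : 0 <= 8 * sgm); rewrite mulr_ge0 ?(ltW sgm0)// => /(_ isT) h.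
  apply: le_trans (ltW h) _; rewrite -natrX ler_nat.
  exact: leq_trans (leqnSn _) (ltnW (ltn_expl _ _)).
pose J := (n + n)%N.
(* Replacing delta by kappa delta <= r0 costs a constant in the rate and admits every delta up to
   delta0. *)
pose kappa : R := Num.min 1 (r0 / delta0).
have kap0 : 0 < kappa by rewrite lt_min ltr01 divr_gt0.
have kap1 : kappa <= 1 by rewrite ge_min lexx.
have kapr : kappa * delta0 <= r0 by rewrite -ler_pdivlMr// ge_min lexx orbT.
exists sgm, (4 * sgm * 2 ^+ ((2 ^ J).-1 * E)), (kappa / (4 * r0)), (2 ^ J * E)%N.
split.
  split => //.
  - have h1 : 1 <= 4 * sgm by lra.
    by apply: mulr_ege1 => //; apply: exprn_ege1; rewrite ler1n.
  - by rewrite divr_gt0// mulr_gt0.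
  - by rewrite mulrAC ler_pdivrMr ?mulr_gt0// mulrA mulVf// mul1r.
  - by rewrite muln_gt0 expn_gt0.
move=> delta Dx X f delta_gt0 dd0 far fL2.
pose b : R := Num.max (k * r1 / 4) (k / 2 * (Dx + eta)).
have a0 : 0 < k * r1 / 4 by rewrite divr_gt0// mulr_gt0.
have ab : k * r1 / 4 <= b by rewrite le_max lexx.
have Db : k / 2 * (Dx + eta) <= b by rewrite le_max lexx orbT.
have [C C0 bC] := psi_bounded_ex a0 ab.
pose KG : R := Num.max 1 C.
have KG1 : 1 <= KG by rewrite le_max lexx.
have CK : C <= KG by rewrite le_max lexx orbT.
have far1 x y : X x -> Om y -> delta <= enorm (x - y) by move=> Xx Oy; have /andP[] := far x y Xx Oy.
have clear y (t : R) x : (forall w, enorm (w - y) < rm -> Om w) -> 0 <= t <= 1 -> X x ->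
    r1 <= enorm (x - (p + t *: (y - p))) <= Dx.
  move=> by_ t01 Xx.
  have Oy : Om y by apply: by_; rewrite subrr enorm0.
  have yp : enorm (y - p) <= D0.
    apply: le_trans (enormD _ _) _; rewrite enormN /D0 mulr_natl mulr2n.
    by rewrite lerD ?DOP.
  have ba w : enorm (w - (p + t *: (y - p))) < r1 -> Om w.
    exact: (star_clearance star bp by_ rm0 rp0 (ltW D00) yp t01).
  have Oa : Om (p + t *: (y - p)) by apply: ba; rewrite subrr enorm0.
  have /andP[_ ->] := far x _ Xx Oa; rewrite andbT.
  apply: le_trans (ball_dist r10 delta_gt0 ba (fun w Ow => far1 x w Xx Ow)).
  by rewrite lerDl ltW.
have b0m w : enorm (w - 0) < rm -> Om w.
  move=> h; apply: dRO; rewrite /disk /= -(subr0 w); apply: lt_le_trans h _.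
  by rewrite ge_min lexx orbT.
have O0 : Om 0 by apply: b0m; rewrite subrr enorm0.
have HG y : (forall w, enorm (w - y) < r0 -> Om w) -> good k sgm X KG J y.
  move=> by_; have n0 : (0 < n)%N by [].
  have seg := good_segment k0 r10 (erefl sgm) (ltW C0) bC CK KG1 eta_r1 eta_sgm Db n0.
  have g0 := good0 k sgm X KG1.
  have gp : good k sgm X KG (0 + n) p.
    apply: (seg X (0, 0)) g0.
      rewrite -[(0, 0)]/(0 : R * R) subr0; apply: le_trans nP.
      by apply: le_trans (DOP p Op) _; rewrite /D0 mulr_natl mulr2n lerDl ltW.
    (* The segment from 0 to p is read backwards, as p + (1-t)(0-p), so that [clear] applies with
       the disc about 0. *)
    move=> t x t01 Xx; rewrite -[(0, 0)]/(0 : R * R) add0r subr0.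
    have s01 : 0 <= 1 - t <= 1 by move: t01 => /andP[t0 t1]; rewrite subr_ge0 t1 gerBl.
    have := clear 0 (1 - t) x b0m s01 Xx.
    rewrite (_ : p + (1 - t) *: (0 - p) = t *: p)//.
    by rewrite sub0r scalerN scalerBl scale1r opprB addrC subrK.
  apply: (seg X p) gp.
    apply: le_trans nP; apply: le_trans (enormD _ _) _; rewrite enormN /D0 mulr_natl mulr2n.
    by rewrite lerD ?DOP//; apply: by_; rewrite subrr enorm0.
  move=> t x t01 Xx; apply: clear => // w wy; apply: by_; apply: lt_le_trans wy _.
  by rewrite ge_min lexx.
pose dl := kappa * delta.
have dl0 : 0 < dl by rewrite mulr_gt0.
have dlr0 : dl <= r0 by apply: le_trans kapr; rewrite ler_wpM2l// ltW.
have fardl x y : X x -> Om y -> dl <= enorm (x - y) <= Dx.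
  move=> Xx Oy; have /andP[h1 ->] := far x y Xx Oy; rewrite andbT.
  by apply: le_trans h1; rewrite ler_piMl// ltW.
have sg j : smooth_curve (gam j) by exact: (sd_smooth sd).
have fr j t : frontier Om (gam j t) by rewrite (sd_frontier sd); exists j, t.
have Xg j x t : X x -> x <> gam j t.
  move=> Xx xg; have [y Oy yg] := closure_enorm (fr j t).1 delta_gt0.
  have := far1 x y Xx Oy; rewrite enormB xg => h.
  by have := le_lt_trans h yg; rewrite ltxx.
have cen j t e : 0 <= t <= 1 -> 0 < e ->
    exists2 y, enorm (gam j t - y) < r0 + e & forall w, enorm (w - y) < r0 -> Om w.
  by move=> _ e0; apply: rIP => //; rewrite r00.
pose dens j t : R[i] := 'i%C / 4%:R * (f (gam j t) * (speed (gam j) t)%:C).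
have ex j : exists K : R, 0 <= K /\ forall q,
    apx k sgm X (2 ^ J * (E * q)) (K * (4 * sgm * 2 ^+ ((2 ^ J).-1 * E)) ^+ q)
      (K * (q.+1%:R ^+ 2 * (1 - dl / (4 * r0)) ^+ q))
      (fun x => cint (fun t => psi 0 (scal k x - scal k (gam j t)) * dens j t)).
  have [nu [inu md dnu]] := in_L2_density (sg j) fL2.
  have md' : cmeas (dens j) by apply: cmeasM => //; exact: cmeas_cst.
  have i4 : cabs ('i%C / 4%:R : R[i]) <= 1.
    rewrite cabsM cabsV cabs_nat (_ : cabs 'i%C = 1); first by rewrite mul1r invf_le1// ler1n.
    by rewrite /cabs /= expr0n add0r expr1n sqrtr1.
  have dnu' t : D t -> cabs (dens j t) <= nu t.
    by move=> Dt; rewrite cabsM; apply: le_trans (dnu t Dt); rewrite ler_piMl ?cabs_ge0.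
  have [K K0 KP] := curve_expansion k0 sgm1 KG1 kr0 r00 dl0 dlr0 E8 (ltn0Sn _) fardl HG
    (sg j) (cen j) (Xg j) inu md' dnu'.
  by exists K.
have [K KP] := choice ex.
exists (\sum_j K j); first by apply: sumr_ge0 => j _; exact: (KP j).1.
move=> q.
have := @apx_sum R k sgm X 'I_m (index_enum _) xpredT _ _ _ _ (fun j _ => (KP j).2 q).
rewrite -!mulr_suml mulnA (_ : dl / (4 * r0) = kappa / (4 * r0) * delta); last by rewrite /dl mulrAC.
move=> h; apply: apx_ext h _ => x Xx; rewrite /arc_cintegral; apply: eq_bigr => j _.
rewrite /cint; congr (_ +i* _); apply: eq_Rintegral => t _.
  rewrite (_ : psi 0 _ * dens j t = Phi k x (gam j t) * f (gam j t) * (speed (gam j) t)%:C).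
    by rewrite [RHS]cReM /= mulr0 subr0.
  rewrite /dens -scalB -hankel1_psi//; last first.
    by rewrite lt0r enorm_ge0 andbT enorm_eq0 subr_eq0; apply/eqP/Xg.
  by rewrite cis_angle0 /Phi; ring.
rewrite (_ : psi 0 _ * dens j t = Phi k x (gam j t) * f (gam j t) * (speed (gam j) t)%:C).
  by rewrite [RHS]cImM /= mulr0 add0r.
rewrite /dens -scalB -hankel1_psi//; last first.
  by rewrite lt0r enorm_ge0 andbT enorm_eq0 subr_eq0; apply/eqP/Xg.
by rewrite cis_angle0 /Phi; ring.
Qed.

End SourceApproximation.

(** * Absorbing constants and powers of N into exponentials *)

Section Rates.
Variable R : realType.

(** From e^x >= 1 + x^3/6 and (N+1)^2 <= 4 N^2: it suffices that 24 |K| <= a^3 N. *)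
Lemma sqr_le_expR (K a : R) : 0 < a ->
  exists N0, forall N, (N0 <= N)%N -> K * N.+1%:R ^+ 2 <= expR (a * N%:R).
Proof.
move=> a0; pose b := 24 * `|K| / a ^+ 3.
have b0 : 0 <= b by rewrite divr_ge0 ?exprn_ge0 ?mulr_ge0// ltW.
exists (Num.bound b).+1 => N N0N.
have bN : b <= N%:R.
  by apply: le_trans (ltW (archi_boundP b0)) _; rewrite ler_nat ltnW.
have KN : 24 * `|K| <= a ^+ 3 * N%:R.
  by rewrite [_ ^+ 3 * _]mulrC -ler_pdivrMr ?exprn_gt0.
have N1 : (N.+1%:R : R) <= 2 * N%:R.
  by rewrite -natrM ler_nat mul2n -addnn -addn1 leq_add2l; case: N N0N {bN KN}.
have aN : 0 <= a * N%:R by rewrite mulr_ge0// ltW.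
apply: le_trans (expR_ge1Dxn 2 aN).
have n2 : (N.+1%:R : R) ^+ 2 <= 4 * N%:R ^+ 2.
  apply: (@le_trans _ _ ((2 * N%:R) ^+ 2)); first by rewrite lerXn2r ?nnegrE// mulr_ge0.
  by apply: eqle; ring.
apply: (@le_trans _ _ (`|K| * (4 * N%:R ^+ 2))).
  apply: le_trans (ler_wpM2r (sqr_ge0 _) (ler_norm K)) _.
  exact: ler_wpM2l.
have h : 4 * N%:R ^+ 2 * (24 * `|K|) <= 4 * N%:R ^+ 2 * (a ^+ 3 * N%:R).
  by rewrite ler_wpM2l// mulr_ge0// sqr_ge0.
rewrite (_ : 3`! = 6)//; apply: (@le_trans _ _ ((a * N%:R) ^+ 3 / 6)); last by rewrite lerDr.
rewrite ler_pdivlMr// exprMn; move: h; set n : R := N%:R => h.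
have p : 0 <= 4 * n ^+ 2 * (24 * `|K|) by rewrite !mulr_ge0// sqr_ge0.
rewrite (_ : a ^+ 3 * n ^+ 3 = (4 * n ^+ 2 * (a ^+ 3 * n)) / 4); last by field.
rewrite ler_pdivlMr//; apply: le_trans h; apply: eqle; ring.
Qed.

(* [q >= N / B - 1] gives the rate [c delta / B], twice what the claim needs; the
   other half pays for [K] and the polynomial factor. *)
Lemma error_rate (c delta C lam K M : R) (B : nat) :
  0 < delta -> 0 < c -> c * delta <= 1 -> 0 <= lam -> 0 < C -> 0 < M -> (0 < B)%N ->
  2 * B%:R * lam <= c * C ->
  exists N0, forall N, (N0 <= N)%N ->
    K * ((N %/ B).+1%:R ^+ 2 * (1 - c * delta) ^+ (N %/ B))
      <= expR (- (N%:R * (delta / (delta + C)) * lam)) * M.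
Proof.
move=> d0 c0 cd1 l0 C0 M0 B0 BC.
have BR : 0 < (B%:R : R) by rewrite ltr0n.
pose a := c * delta / (2 * B%:R).
have a0 : 0 < a by rewrite divr_gt0 ?mulr_gt0.
have [N0 hN0] := sqr_le_expR (`|K| * expR (c * delta) / M) a0.
exists N0 => N /hN0; rewrite mulrAC ler_pdivrMr// => hN.
set q := (N %/ B)%N.
have qN : (q.+1%:R : R) <= N.+1%:R by rewrite ler_nat ltnS leq_div.
have qB : N%:R <= (q%:R + 1) * B%:R :> R.
  by rewrite natr1 -natrM ler_nat ltnW// ltn_ceil.
have e1 : (1 - c * delta) ^+ q <= expR (c * delta) * expR (- (2 * a * N%:R)).
  apply: (@le_trans _ _ (expR (- (c * delta)) ^+ q)).
    by rewrite lerXn2r ?nnegrE ?expR_ge0 ?subr_ge0 ?expR_ge1Dx.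
  rewrite -expRM_natl -expRD ler_expR.
  have h : c * delta / B%:R * N%:R <= c * delta / B%:R * ((q%:R + 1) * B%:R).
    by rewrite ler_wpM2l// divr_ge0// mulr_ge0 ?ltW.
  have -> : 2 * a * N%:R = c * delta / B%:R * N%:R by rewrite /a; field; rewrite lt0r_neq0.
  have : c * delta / B%:R * ((q%:R + 1) * B%:R) = c * delta * q%:R + c * delta.
    by field; rewrite lt0r_neq0.
  by move: h; set A := _ * N%:R; move=> h E; lra.
(* delta lam / (delta + C) <= c delta / (2B), since 2 B lam <= c C <= c (delta + C). This is the
   condition that determines C. *)
have e2 : expR (- (a * N%:R)) <= expR (- (N%:R * (delta / (delta + C)) * lam)).
  rewrite ler_expR lerN2 mulrAC mulrC [_ * lam]mulrC.
  rewrite [leLHS]mulrA ler_wpM2r//.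
  rewrite mulrAC ler_pdivrMr ?addr_gt0// /a.
  rewrite mulrAC ler_pdivlMr ?mulr_gt0//.
  have h : delta * (2 * B%:R * lam) <= delta * (c * C) by rewrite ler_wpM2l// ltW.
  have h2 : delta * (c * C) <= c * delta * (delta + C).
    by rewrite mulrDr; apply: (@le_trans _ _ (c * delta * C)); [apply: eqle; ring | rewrite lerDr !mulr_ge0 ?ltW].
  by apply: le_trans (le_trans h h2); apply: eqle; ring.
apply: (@le_trans _ _ (`|K| * (N.+1%:R ^+ 2 * (expR (c * delta) * expR (- (2 * a * N%:R)))))).
  have p0 : 0 <= (1 - c * delta) ^+ q by rewrite exprn_ge0// subr_ge0.
  have p1 : 0 <= q.+1%:R ^+ 2 * (1 - c * delta) ^+ q by exact: mulr_ge0 (sqr_ge0 _) p0.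
  apply: le_trans (ler_wpM2r p1 (ler_norm K)) _; apply: ler_wpM2l => //.
  by apply: ler_pM => //; rewrite lerXn2r ?nnegrE.
apply: (@le_trans _ _ (expR (a * N%:R) * M * expR (- (2 * a * N%:R)))).
  apply: (@le_trans _ _ (`|K| * expR (c * delta) * N.+1%:R ^+ 2 * expR (- (2 * a * N%:R)))).
    by apply: eqle; ring.
  by rewrite ler_wpM2r// expR_ge0.
rewrite mulrAC -expRD (_ : _ + _ = - (a * N%:R)); last by ring.
by rewrite ler_wpM2r// ltW.
Qed.

(** The available exponent is at least lam N / 2. One half of it bounds S^q, through 4 ln S <= lam
    B; the other half absorbs K and N+1. *)
Lemma coef_rate (S lam C K M delta : R) (B : nat) :
  1 <= S -> 0 < lam -> 0 < C -> 0 < M -> 0 < delta -> delta <= C -> (0 < B)%N ->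
  4 * ln S <= lam * B%:R ->
  exists N0, forall N, (N0 <= N)%N ->
    K * N.+1%:R * S ^+ (N %/ B) <= C * expR (N%:R * (C / (delta + C)) * lam) * M.
Proof.
move=> S1 l0 C0 M0 d0 dC B0 SB.
have S0 : 0 < S by exact: lt_le_trans S1.
have BR : 0 < (B%:R : R) by rewrite ltr0n.
have l4 : 0 < lam / 4 by rewrite divr_gt0.
have [N0 hN0] := sqr_le_expR (`|K| / (C * M)) l4.
exists N0 => N /hN0; rewrite mulrAC ler_pdivrMr ?mulr_gt0// => hN.
set q := (N %/ B)%N.
have qB : q%:R * B%:R <= N%:R :> R by rewrite -natrM ler_nat leq_trunc_div.
have s1 : S ^+ q <= expR (lam / 4 * N%:R).
  rewrite -[S in S ^+ _]lnK ?posrE// -expRM_natl ler_expR.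
  have h1 : q%:R * (4 * ln S) <= q%:R * (lam * B%:R) by rewrite ler_wpM2l.
  have h2 : lam * (q%:R * B%:R) <= lam * N%:R by rewrite ler_wpM2l// ltW.
  rewrite mulrAC ler_pdivlMr//.
  apply: le_trans h2; apply: le_trans (eqle _) (le_trans h1 (eqle _)); ring.
have s2 : lam / 4 * N%:R + lam / 4 * N%:R <= N%:R * (C / (delta + C)) * lam.
  have -> : lam / 4 * N%:R + lam / 4 * N%:R = (N%:R * lam) * 2^-1 by field.
  rewrite [leRHS]mulrAC; apply: ler_wpM2l; first by rewrite mulr_ge0// ltW.
  by rewrite ler_pdivlMr ?addr_gt0//; lra.
have k1 : `|K| * N.+1%:R <= `|K| * N.+1%:R ^+ 2.
  by rewrite ler_wpM2l// ler_eXnr// ler1n.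
apply: (@le_trans _ _ (expR (lam / 4 * N%:R) * (C * M) * expR (lam / 4 * N%:R))).
  have Sq : 0 <= S ^+ q by exact: exprn_ge0 (ltW S0).
  apply: le_trans (ler_wpM2r Sq (ler_wpM2r _ (ler_norm K))) _ => //.
  by apply: ler_pM s1 => //; exact: le_trans k1 hN.
apply: (@le_trans _ _ ((C * M) * expR (lam / 4 * N%:R + lam / 4 * N%:R))).
  by rewrite expRD; apply: eqle; ring.
apply: (@le_trans _ _ (C * M * expR (N%:R * (C / (delta + C)) * lam))); last by apply: eqle; ring.
by rewrite ler_wpM2l ?ler_expR// mulr_ge0// ltW.
Qed.

Lemma powR_inv_ratio (a b x y : R) : 0 < a -> 0 < b ->
  x = y -> (a / b) `^ x = expR (- (y * ln (b / a))).
Proof.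
move=> a0 b0 <-; rewrite /powR gt_eqF ?divr_gt0// -invf_div lnV ?posrE ?divr_gt0//.
by rewrite mulrN.
Qed.

End Rates.

(** * Radii and distances in the statement *)

Section Geometry.
Variable R : realType.

(** The point (rho, 0) lies in the closure of the smaller disc. The strict inequality makes ln(Rad /
    rho) positive. *)
Lemma disk_radii (rho r : R) : 0 < rho ->
  compactly_contained (disk rho) (disk r) -> rho < r.
Proof.
move=> rho0 [_ h].
have e0 : enorm ((rho, 0) : R * R) = rho.
  by rewrite /enorm /= expr0n addr0 sqrtr_sqr gtr0_norm.
have : closure (disk rho) ((rho, 0) : R * R).
  move=> A /nbhs_enorm[e e0' eA].
  pose s : R := Num.min (e / 2) rho.
  have s0 : 0 < s by rewrite lt_min divr_gt0.
  have se : s < e by rewrite gt_min ltr_pdivrMr// ltr_pMr// ltr1n.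
  have srho : s <= rho by rewrite ge_min lexx orbT.
  exists (rho - s, 0); split.
    rewrite /disk /= /enorm /= expr0n addr0 sqrtr_sqr ger0_norm ?subr_ge0//.
    by rewrite ltrBlDr ltrDl.
  apply: eA; rewrite /enorm /= subrr expr0n addr0 sqrtr_sqr.
  by rewrite addrAC subrr add0r normrN gtr0_norm.
by move=> /h; rewrite /disk /= e0.
Qed.

Lemma frontier_dist (A B : set (R * R)) (delta : R) (x y : R * R) :
  (delta%:E <= set_dist A B)%E -> A x -> B y -> delta <= enorm (x - y).
Proof.
move=> h Ax By; rewrite -lee_fin; apply: le_trans h _.
by apply: ereal_inf_lbound; exists x, y.
Qed.

Lemma bounded_closure (A : set (R * R)) : bounded_set A ->
  exists2 b : R, 0 < b & forall x, closure A x -> enorm x <= b.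
Proof.
move=> /bounded_enorm[b b0 bA]; exists (b + 1); first by rewrite addr_gt0.
move=> x /closure_enorm-/(_ _ ltr01)[y Ay yx].
have -> : x = y + (x - y) by rewrite addrC subrK.
by apply: le_trans (enormD _ _) _; rewrite lerD ?bA// enormB ltW.
Qed.

End Geometry.

Theorem theorem4p1 (R : realType)
    (Om : set (R * R)) (m : nat) (gam : 'I_m -> R -> R * R) (k rho Rad : R) :
  smooth_domain Om gam -> star_shaped Om -> 0 < k ->
  0 < rho ->
  compactly_contained (disk rho) (disk Rad) ->
  compactly_contained (disk Rad) Om ->
  forall delta0 : R, 0 < delta0 ->
  exists C : R, 0 < C /\
  forall (delta : R)
    (Omd : set (R * R)) (md : nat) (gamd : 'I_md -> R -> R * R)
    (u mu : R * R -> R[i]) (M : R),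
  0 < delta -> delta <= delta0 ->
  smooth_domain Omd gamd ->
  compactly_contained Om Omd ->
  (delta%:E <= set_dist (frontier Omd) Om)%E ->
  helmholtz_sol k (~` closure Om) u ->
  radiating k u ->
  in_L2 gam mu ->
  (L2norm gam mu < M%:E)%E ->
  (forall x, (~` closure Om) x ->
     u x = arc_cintegral gam (fun y => Phi k x y * mu y)) ->
  let beta := C / delta in
  exists N0 : nat, forall N : nat, (N0 <= N)%N ->
  exists c : int -> R[i],
    (L2norm gamd (fun x => (u x - hankel_sum k rho N c x)%R)
       <= ((rho / Rad) `^ (N%:R * (1 / (1 + beta))) * M)%R%:E)%E
    /\
    weighted_coef_norm N c
      <= C * (Rad / rho) `^ (N%:R * (beta / (1 + beta))) * M.
Proof.
move=> sd st k0 rho0 rhoRad RadOm delta0 d00.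
have rR := disk_radii rho0 rhoRad.
have Rad0 : 0 < Rad by exact: lt_trans rR.
have dRO : disk Rad `<=` Om by apply: subset_trans RadOm.2; exact: subset_closure.
have O0 : Om 0 by apply: dRO; rewrite /disk /= enorm0.
have [sgm [A [c [B [[sgm1 A1 c0 cd0 B0] src]]]]] := source_approx sd st k0 Rad0 dRO d00.
have [H H0 HP] := hankel1_bound k0 rho0.
set S := Num.max 1 (k / 2 * rho)^-1 in HP.
have S1 : 1 <= S by rewrite le_max lexx.
pose lam := ln (Rad / rho).
have lam0 : 0 < lam by rewrite ln_gt0// ltr_pdivlMr// mul1r.
(* The growth of the coefficients per unit of q: A from moving the sources, S^B from H_n(k rho) at
   orders up to B q. *)
pose T := S ^+ B * A.
have T1 : 1 <= T by apply: mulr_ege1 => //; exact: exprn_ege1.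
have lT : 0 <= 4 * ln T / lam by rewrite divr_ge0 ?(ltW lam0)// mulr_ge0// ln_ge0.
(* With q = N / Bt, the summand B ensures B q <= N, and the other one ensures T^q <=
   (Rad/rho)^(N/4). *)
pose Bt := (B + Num.bound (4 * ln T / lam))%N.
have Bt0 : (0 < Bt)%N by rewrite addn_gt0 B0.
have BtR : 0 < (Bt%:R : R) by rewrite ltr0n.
have TB : 4 * ln T <= lam * Bt%:R.
  rewrite [lam * _]mulrC -ler_pdivrMr//; apply: le_trans (ltW (archi_boundP lT)) _.
  by rewrite ler_nat leq_addl.
(* The summand delta0 gives delta <= C, that is beta >= 1; the last one gives 2 Bt lam <= c C for
   the error rate. *)
pose C := 1 + delta0 + 2 * Bt%:R * lam / c.
have C3 : 0 <= 2 * Bt%:R * lam / c by rewrite divr_ge0 ?(ltW c0)// mulr_ge0 ?(ltW lam0)// mulr_ge0.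
have C0 : 0 < C by rewrite /C; apply: ltr_wpDr => //; rewrite addr_gt0.
have dC : delta0 <= C by rewrite /C -addrA addrCA lerDl addr_ge0.
have BC : 2 * Bt%:R * lam <= c * C.
  by rewrite [c * C]mulrC -ler_pdivrMr// /C lerDr addr_ge0// ltW.
exists C; split=> //.
move=> delta Omd md gamd u mu M d0 dd0 sdd _ dist _ _ muL muM uE beta.
have M0 : 0 < M by rewrite -lte_fin; apply: le_lt_trans muM; exact: sqrte_ge0.
pose X := frontier Omd.
have [b1 b10 b1P] := bounded_enorm (sd_bounded sd).
have [b2 b20 b2P] := bounded_closure (sd_bounded sdd).
have far x y : X x -> Om y -> delta <= enorm (x - y) <= b2 + b1.
  move=> Xx Oy; rewrite (frontier_dist dist Xx Oy)/=.
  by apply: le_trans (enormD _ _) _; rewrite enormN lerD ?b1P// b2P//; exact: Xx.1.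
have X0 x : X x -> 0 < enorm x.
  by move=> Xx; have /andP[h _] := far x 0 Xx O0; rewrite subr0 in h; exact: lt_le_trans h.
(* The distance delta separates the outer boundary from the closure of Om, so the integral
   representation of u holds there. *)
have XO x : X x -> (~` closure Om) x.
  move=> Xx xO; have [y Oy] := closure_enorm xO d0; rewrite enormB => yx.
  by have /andP[h _] := far x y Xx Oy; move: (le_lt_trans h yx); rewrite ltxx.
have Xg j t : X (gamd j t) by rewrite /X (sd_frontier sdd); exists j, t.
have [K K0 KP] := src delta (b2 + b1) X mu d0 dd0 far muL.
have [L L0 LP] := L2norm_le (sd_smooth sdd).
have cd1 : c * delta <= 1.
  apply: (@le_trans _ _ (c * delta0)); first by rewrite ler_wpM2l// ltW.
  by apply: le_trans cd0 _; rewrite invf_le1// ler1n.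
have [N1 hN1] := @error_rate R c delta C lam (K * L) M Bt d0 c0 cd1 (ltW lam0) C0 M0 Bt0 BC.
have [N2 hN2] := @coef_rate R T lam C (2 * H * K) M delta Bt T1 lam0 C0 M0 d0 (le_trans dd0 dC) Bt0 TB.
exists (maxn N1 N2) => N; rewrite geq_max => /andP[/hN1 e1 /hN2 e2].
set q := (N %/ Bt)%N in e1 e2.
have BqN : (B * q <= N)%N.
  by rewrite mulnC; apply: leq_trans (leq_trunc_div N Bt); rewrite leq_mul2l leq_addr orbT.
have [cf [cf1 cf2]] := apx_hankel_sum k0 rho0 sgm1 H0 S1 HP X0 BqN (KP q).
have dC0 : 0 < delta + C by rewrite addr_gt0.
have p1 : 1 / (1 + beta) = delta / (delta + C).
  by rewrite /beta; field; rewrite !lt0r_neq0.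
have p2 : beta / (1 + beta) = C / (delta + C).
  by rewrite /beta; field; rewrite !lt0r_neq0.
exists cf; split.
  have e0 : 0 <= K * (q.+1%:R ^+ 2 * (1 - c * delta) ^+ q).
    by rewrite !mulr_ge0// ?sqr_ge0// exprn_ge0// subr_ge0.
  apply: le_trans (LP _ _ e0 _) _.
    by move=> j t; rewrite uE; [exact: cf1|exact: XO].
  rewrite lee_fin (powR_inv_ratio _ _ (erefl _))// p1.
  by apply: le_trans e1; rewrite mulrAC.
rewrite p2 /powR gt_eqF ?divr_gt0//.
apply: le_trans cf2 (le_trans _ e2); apply: eqle.
rewrite /T exprMn -exprM; move: (S ^+ _) (A ^+ _) (N.+1%:R) => s a n.
by ring.
Qed.
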